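(* There is an algorithm that solves the FIFO Stack-Up problem in time $O(n+m^{p+2})$; in particular the problem parameterized by the number $p$ of stack-up places is in XP.
   Context: FIFO Stack-Up problem. An instance consists of a list $Q=(q_1,\ldots,q_k)$ of $k$ sequences of pairwise distinct bins, a pallet symbol ${\it plt}(b)$ (a positive integer) for every bin $b$, and a positive integer $p$. Standing assumptions: every pallet symbol that occurs is carried by at least two bins, and (practical instances) $p<m$ and $k<m$. $n$ is the total number of bins and $m$ the number of distinct pallet symbols (pallets). A configuration is a tuple $(i_1,\ldots,i_k)$ with $0\le i_j\le |q_j|$, meaning that the first $i_j$ bins of $q_j$ have been removed. A pallet $t$ is open in configuration $(i_1,\ldots,i_k)$ if there are indices $j,\ell$ such that some bin for $t$ is at a position $\le i_j$ in $q_j$ and some bin for $t$ is at a position $> i_\ell$ in $q_\ell$. A transformation step removes the bin at position $i_j+1$ of some sequence $q_j$ (with $i_j<|q_j|$). A processing of $Q$ is a sequence of transformation steps from $(0,\ldots,0)$ to $(|q_1|,\ldots,|q_k|)$. The question is whether there is a processing of $Q$ such that in each configuration during the processing at most $p$ pallets are open. A parameterized problem is in XP w.r.t. parameter $\kappa$ if it is solvable in time $f(\kappa)\cdot|I|^{g(\kappa)}$ for computable $f,g$. *)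

(* Defs.v *)
From mathcomp Require Import all_boot.

Set Implicit Arguments.
Unset Strict Implicit.
Unset Printing Implicit Defensive.

(** Cook-Reckhow style RAM over natural numbers with a read-only sequential
    input tape and unit cost per instruction.  The only arithmetic is addition
    and truncated subtraction, so the length of a word grows by at most one
    bit per step and unit-cost time is polynomially related to Turing machine
    time. *)

Inductive instr : Type :=
| IConst of nat & nat
| IAdd of nat & nat & nat
| ISub of nat & nat & nat
| ILoad of nat & nat
| IStore of nat & nat
| IRead of nat
| IJump of nat
| IJzero of nat & nat
| IHalt.

Definition program := seq instr.

Record state := State { pc : nat; mem : nat -> nat; input : seq nat }.

Definition initial (x : seq nat) : state := State 0 (fun=> 0) x.

Definition set_mem (s : state) (a v : nat) : state :=
  State (pc s).+1 [eta mem s with a |-> v] (input s).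

Definition goto (s : state) (l : nat) : state := State l (mem s) (input s).

(** Leaving the program also halts the machine. *)
Definition current (P : program) (s : state) : instr := nth IHalt P (pc s).

Definition halted (P : program) (s : state) : bool :=
  if current P s is IHalt then true else false.

Definition step (P : program) (s : state) : state :=
  match current P s with
  | IConst d c => set_mem s d c
  | IAdd d a b => set_mem s d (mem s a + mem s b)
  | ISub d a b => set_mem s d (mem s a - mem s b)
  | ILoad d a => set_mem s d (mem s (mem s a))
  | IStore d a => set_mem s (mem s d) (mem s a)
  | IRead d =>
      State (pc s).+1 [eta mem s with d |-> head 0 (input s)] (behead (input s))
  | IJump l => goto s l
  | IJzero a l => goto s (if mem s a == 0 then l else (pc s).+1)
  | IHalt => s
  end.

(** Halted states are fixed points of [step], so this says that [P] halts after
    at most [t] steps. *)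
Definition halts_within (P : program) (x : seq nat) (t out : nat) : Prop :=
  let s := iter t (step P) (initial x) in halted P s /\ mem s 0 = out.

Definition computable (f : nat -> nat) : Prop :=
  exists P : program, forall x, exists t, halts_within P [:: x] t (f x).

Record problem := Problem {
  instance : Type;
  valid : instance -> Prop;
  encode : instance -> seq nat;
  accepts : instance -> Prop
}.

Definition decides_within (L : problem) (P : program) (T : instance L -> nat) :
    Prop :=
  forall I : instance L, valid I ->
  exists b : bool, halts_within P (encode I) (T I) b /\ (b <-> accepts I).

Definition solvable_in_O (L : problem) (T : instance L -> nat) : Prop :=
  exists (P : program) (C : nat), decides_within P (fun I => C * T I).

(** Number of bits of the encoding; [0] takes one bit. *)
Definition bitsize (L : problem) (I : instance L) : nat :=
  \sum_(x <- encode I) (trunc_log 2 x).+1.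

Definition XP (L : problem) (kappa : instance L -> nat) : Prop :=
  exists (f g : nat -> nat) (P : program),
    [/\ computable f, computable g &
        decides_within P (fun I : instance L =>
          f (kappa I) * bitsize I ^ g (kappa I))].

Record fifo_instance := FifoInstance {
  bin : eqType;
  queues : seq (seq bin);
  plt : bin -> nat;
  places : nat
}.

Section Fifo.
Variable I : fifo_instance.

Definition bins : seq (bin I) := flatten (queues I).

Definition pallets : seq nat := undup (map (@plt I) bins).

Definition nbins : nat := size bins.
Definition npallets : nat := size pallets.
Definition nqueues : nat := size (queues I).

Record practical : Prop := Practical {
  bins_uniq : uniq bins;
  plt_gt0 : forall b, b \in bins -> 0 < plt b;
  places_gt0 : 0 < places I;
  pallet_ge2 : forall t, t \in pallets -> 2 <= count (fun b => plt b == t) bins;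
  places_lt : places I < npallets;
  nqueues_lt : nqueues < npallets
}.

Definition queue (j : 'I_nqueues) : seq (bin I) := nth [::] (queues I) j.

Definition config := {ffun 'I_nqueues -> nat}.

Definition start : config := [ffun=> 0].
Definition finish : config := [ffun j => size (queue j)].

(** The bound [c j <= size (queue j)] holds in every configuration reachable
    from [start] by such steps. *)
Definition transformation : rel config := fun c c' =>
  [exists j, (c j < size (queue j)) &&
             (c' == [ffun l => if l == j then (c j).+1 else c l])].

Definition is_open (c : config) (t : nat) : bool :=
  [exists j, has (fun b => plt b == t) (take (c j) (queue j))] &&
  [exists l, has (fun b => plt b == t) (drop (c l) (queue l))].

Definition nopen (c : config) : nat := count (is_open c) pallets.

(** [s] lists the configurations that follow [start]. *)
Definition processing (s : seq config) : bool :=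
  path transformation start s && (last start s == finish).

Definition stackable : Prop :=
  exists2 s : seq config,
    processing s & all (fun c => nopen c <= places I) (start :: s).

(** Number of places, number of sequences, then each sequence as its length
    followed by the pallet symbols of its bins; the names of the bins play no
    role in the problem. *)
Definition fifo_encode : seq nat :=
  places I :: nqueues ::
  flatten [seq size q :: map (@plt I) q | q <- queues I].

End Fifo.

Definition fifo_stackup : problem :=
  Problem practical fifo_encode stackable.

(* Main.v *)
Require Import Defs.
From mathcomp Require Import all_boot.
From mathcomp Require Import zify.

(** In the graph on pallets with an arc [u -> t] when some sequence holds a bin
    for [u] before a bin for [t], the pallets that are open once exactly the
    pallets of [S] have been started, and all bins that can be removed without
    starting another pallet are gone, are the members of [S] with an
    in-neighbour outside [S]; let [d S] be their number.  An instance can be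
    stacked up iff the pallets can be started one at a time with [d <= k] at
    every stage, where [k = p - 1], since starting a pallet occupies one more
    place.

    The function [d] is submodular.  Call [T] tight over [S] if
    [d (T :|: R) <= d R] for all [R] containing [S]; passing from [S] to a tight
    [T] that is reachable from it never loses a solution.  Adding one pallet
    raises [d] by at most one, so a search whose nodes are the words of length
    at most [k] over the [m] pallets suffices: the node [w a] holds a set
    [Q (w a)], reachable from and tight over [Q w] plus [a], which is enlarged
    until its value drops below the depth of the node or no reachable superset
    has a value that small.  When all children of [w] are finished, those whose
    value is at most the depth of [w] are successful; the union of their sets
    over a minimal strongly closed family of successful children is reachable
    from and tight over [Q w] and replaces it.  The sets only grow and are kept
    from one visit to the next, so each of the [m ^ k] leaves changes at most [m]
    times at cost [m ^ 2], each of the other nodes at most [m] times at cost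
    [m ^ 3], and the total is [O(m ^ (k + 3))]. *)

Set Implicit Arguments.
Unset Strict Implicit.
Unset Printing Implicit Defensive.

(** * Submodularity and tight extensions *)

Section Separation.
Variables (V : finType) (arc : rel V) (k : nat).
Implicit Types (A B P Q R S T X Y : {set V}) (u v t : V).

(** The set of a child is tight over [Q w] together with its own pallet [a], which says nothing
    about sets that contain [Q w] and avoid [a]. Hence one successful child cannot simply replace
    [Q w]: its set may fail to be tight over [Q w]. This is why a whole strongly closed family is
    joined at once.

    Keeping the set of a child while its parent grows from [S0] to [S] is legitimate because [S] is
    tight over [S0]: joining [S] to every stage of the path of the child does not increase [d], so
    the kept set joined with [S] is again reachable from and tight over [S] plus [a]. No work below
    a child is lost when its ancestors change, and the running time becomes a count of enlargements.

    A visit may therefore cost no more than one evaluation of [d], that is [m ^ 2]. Only the closure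
    of a family costs [m ^ 3], and the inner nodes, where it occurs, are fewer than the leaves by
    about a factor [m]. As [k + 3 = p + 2] with [p] positive, the bound also absorbs the [m ^ 2]
    spent on each sequence to build the graph, there being fewer sequences than pallets. *)

Definition front S : {set V} :=
  [set t in S | [exists u, (u \notin S) && arc u t]].

Definition dsep S : nat := #|front S|.

Lemma frontP S t :
  reflect (t \in S /\ exists2 u, u \notin S & arc u t) (t \in front S).
Proof.
rewrite inE; apply: (iffP andP) => -[Ht].
  by case/existsP=> u /andP[]; split=> //; exists u.
by case=> u Hu Ha; split=> //; apply/existsP; exists u; rewrite Hu.
Qed.

Lemma dsep0 : dsep set0 = 0.
Proof. by apply: eq_card0 => t; apply/negP => /frontP[]; rewrite inE. Qed.

Lemma dsepT : dsep setT = 0.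
Proof.
by apply: eq_card0 => t; apply/negP => /frontP[_ [u]]; rewrite inE.
Qed.

(** The fronts of [A :|: B] and [A :&: B] have their union inside the union, and their intersection
    inside the intersection, of the fronts of [A] and [B]; [cardsUI] turns these two inclusions into
    the inequality. *)
Lemma dsepUI A B : dsep (A :|: B) + dsep (A :&: B) <= dsep A + dsep B.
Proof.
rewrite /dsep -(cardsUI (front A)) -(cardsUI (front (A :|: B))).
apply: leq_add; apply: subset_leq_card; apply/subsetP => t.
  rewrite in_setU => /orP[] /frontP[Ht [u Hu Ha]].
    move: Ht Hu; rewrite !in_setU negb_or => /orP[] Ht /andP[HA HB].
      by rewrite (introT (frontP A t)) //; split=> //; exists u.
    by rewrite orbC (introT (frontP B t)) //; split=> //; exists u.
  move: Ht Hu; rewrite in_setU !in_setI negb_and => /andP[HA HB] /orP[] Hu.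
    by rewrite (introT (frontP A t)) //; split=> //; exists u.
  by rewrite orbC (introT (frontP B t)) //; split=> //; exists u.
rewrite !in_setI => /andP[/frontP[_ [u Hu Ha]] /frontP[]].
rewrite in_setI => /andP[HA HB] _; move: Hu; rewrite in_setU negb_or.
by case/andP=> uA uB; apply/andP; split; apply/frontP; split=> //; exists u.
Qed.

(** Only [v] itself can enter the front. *)
Lemma dsepU1 v S : dsep (v |: S) <= (dsep S).+1.
Proof.
rewrite /dsep -[_.+1]add1n -(cards1 v).
apply: leq_trans (leq_card_setU _ _); apply: subset_leq_card.
apply/subsetP => t /frontP[Ht [u]]; rewrite in_setU1 negb_or => /andP[_ Hu] Ha.
move: Ht; rewrite !in_setU1 => /orP[-> //|Ht]; apply/orP; right.
by apply/frontP; split=> //; exists u.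
Qed.

(** Only the sets entered after the start are bounded; nothing is asked of [dsep A]. *)
Inductive reach : {set V} -> {set V} -> Prop :=
| reach_refl A : reach A A
| reach_add v A B :
    v \notin A -> dsep (v |: A) <= k -> reach (v |: A) B -> reach A B.

Lemma reach_sub A B : reach A B -> A \subset B.
Proof.
by elim=> {A B} // v A B _ _ _; rewrite subUset => /andP[].
Qed.

Lemma reach_trans A B C : reach A B -> reach B C -> reach A C.
Proof. by elim=> {A B} // v A B Hv Hd _ IH /IH; apply: reach_add. Qed.

Lemma reachU1 v A : dsep (v |: A) <= k -> reach A (v |: A).
Proof.
move=> H; have [Hv|Hv] := boolP (v \in A).
  by rewrite (setUidPr _) ?sub1set //; exact: reach_refl.
exact: reach_add Hv H (reach_refl _).
Qed.

(** The path is joined with [X] stage by stage, and additions of members of [X] become idle. Since a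
    start carries no bound, the condition spares [P = A]. *)
Lemma reachU A B X :
  reach A B ->
  (forall P, A \subset P -> P \subset B -> P != A -> dsep P <= k ->
    dsep (X :|: P) <= k) ->
  reach (X :|: A) (X :|: B).
Proof.
elim=> {A B} [A|v A B Hv Hd H IH] HX; first exact: reach_refl.
have HvB := reach_sub H.
have E : X :|: (v |: A) = v |: (X :|: A) by rewrite setUCA.
apply: (reach_trans (B := X :|: (v |: A))).
  rewrite E; apply: reachU1; rewrite -E; apply: HX => //; first exact: subsetUr.
  by apply: contraNneq Hv => EA; rewrite -EA setU11.
apply: IH => P H1 H2 _ Hk; apply: HX => //.
  by apply: subset_trans H1; exact: subsetUr.
apply: contraNneq Hv => <-; apply: (subsetP H1); exact: setU11.
Qed.

(** Submodularity for a stage [P] and [Y] gives [dsep (P :&: Y) <= dsep P] as soon as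
    [dsep Y <= dsep (P :|: Y)]. *)
Lemma reachI A B Y :
  reach A B ->
  (forall P, A \subset P -> P \subset B -> dsep Y <= dsep (P :|: Y)) ->
  reach (A :&: Y) (B :&: Y).
Proof.
elim=> {A B} [A|v A B Hv Hd H IH] HY; first exact: reach_refl.
have HvB := reach_sub H.
have IH' : reach ((v |: A) :&: Y) (B :&: Y).
  apply: IH => P H1 H2; apply: HY => //; apply: subset_trans H1; exact: subsetUr.
apply: reach_trans IH'; rewrite setIUl.
have [HvY|HvY] := boolP (v \in Y); last first.
  rewrite (_ : [set v] :&: Y = set0) ?set0U; first exact: reach_refl.
  by apply/eqP; rewrite setI_eq0 disjoints1.
have E1 : [set v] :&: Y = [set v] by apply/setIidPl; rewrite sub1set.
rewrite E1; apply: reachU1; rewrite -{1}E1 -setIUl.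
have := dsepUI (v |: A) Y; have := HY _ (subsetUr _ _) HvB.
by move=> H1 H2; lia.
Qed.

Definition tight A B : Prop :=
  A \subset B /\ forall R, A \subset R -> dsep (B :|: R) <= dsep R.

Definition good A B : Prop := reach A B /\ tight A B.

Definition stuck S : Prop :=
  forall X, reach S X -> dsep X <= dsep S -> X = S.

Lemma tight_refl A : tight A A.
Proof. by split=> // R /setUidPr ->. Qed.

Lemma tight_trans A B C : tight A B -> tight B C -> tight A C.
Proof.
move=> [AB H1] [BC H2]; split=> [|R HR]; first exact: subset_trans BC.
rewrite -{1}(setUidPl BC) -setUA; apply: leq_trans (H2 _ _) (H1 _ HR).
exact: subsetUl.
Qed.

Lemma tight_dsep A B : tight A B -> dsep B <= dsep A.
Proof. by case=> AB H; have := H A (subxx _); rewrite (setUidPl AB). Qed.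

Lemma tight_mid A B Y :
  tight A B -> A \subset Y -> Y \subset B -> dsep B <= dsep Y.
Proof. by case=> _ H AY /setUidPl {1}<-; exact: H. Qed.

Lemma tightU A B X : tight A B -> tight (X :|: A) (X :|: B).
Proof.
move=> [AB H]; split=> [|R]; first exact: setUS.
rewrite subUset => /andP[XR AR].
by rewrite setUAC (setUidPr XR) setUC; exact: H.
Qed.

(** [B :&: R] lies between [A] and [B], so submodularity for [B] and [R] reduces tightness, a
    statement about all supersets of [A], to minimality of [B] in this interval. *)
Lemma tightP A B : A \subset B ->
  (forall Y, A \subset Y -> Y \subset B -> dsep B <= dsep Y) -> tight A B.
Proof.
move=> AB H; split=> // R AR; have := dsepUI B R.
have := H (B :&: R); rewrite subsetI AB AR subsetIl => /(_ isT isT) H1 H2.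
by lia.
Qed.

Lemma good_refl A : good A A.
Proof. by split; [exact: reach_refl | exact: tight_refl]. Qed.

Lemma good_trans A B C : good A B -> good B C -> good A C.
Proof.
move=> [R1 T1] [R2 T2]; split; [exact: reach_trans R2|exact: tight_trans T2].
Qed.

Lemma goodU1 v S : dsep (v |: S) <= dsep S -> dsep S <= k -> good S (v |: S).
Proof.
move=> H Hk; split; first by apply: reachU1; exact: leq_trans Hk.
apply: tightP; first exact: subsetUr.
move=> Y SY YS; have [Hv|Hv] := boolP (v \in Y).
  by rewrite (_ : v |: S = Y) //; apply/eqP; rewrite eqEsubset YS subUset sub1set Hv SY.
rewrite (_ : Y = S) //; apply/eqP; rewrite eqEsubset SY andbT.
apply/subsetP=> t Ht; move: (subsetP YS _ Ht); rewrite in_setU1.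
by case/predU1P=> // E; rewrite -E Ht in Hv.
Qed.

Lemma good_tightU S0 S v Q :
  tight S0 S -> good (v |: S0) Q -> good (v |: S) (Q :|: S).
Proof.
move=> [S0S HS] [RQ TQ].
have E : v |: S = S :|: (v |: S0) by rewrite setUCA (setUidPl S0S).
rewrite E [Q :|: S]setUC; split; last exact: tightU.
apply: (reachU RQ) => P H1 _ _; apply: leq_trans; apply: HS.
by apply: subset_trans H1; exact: subsetUr.
Qed.

(** Once [v] and [S0] are present, joining [v |: S] amounts to joining [S]. The lemma compares the
    old set of a node with its repaired one, so that the sets kept further below remain
    repairable. *)
Lemma tight_absorb S0 S Q v :
  tight S0 S -> v |: S0 \subset Q -> tight Q (Q :|: (v |: S)).
Proof.
move=> [S0S HS] HQ; split=> [|R QR]; first exact: subsetUl.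
have [vQ S0Q] : v \in Q /\ S0 \subset Q.
  by move: HQ; rewrite subUset sub1set => /andP[].
have -> : Q :|: (v |: S) :|: R = S :|: R.
  apply/setP=> x; rewrite !inE; case: (x =P v) => [->|_] /=.
    by rewrite (subsetP QR) ?orbT.
  by case: (boolP (x \in Q)) => //= /(subsetP QR) ->; rewrite orbT.
by apply: HS; exact: subset_trans QR.
Qed.

(** * From the children of a node to the node itself *)

Lemma min_interval A B :
  A \subset B ->
  exists Y, [/\ A \subset Y, Y \subset B
    & forall X, A \subset X -> X \subset B -> dsep Y <= dsep X].
Proof.
move=> AB; pose p := [pred X : {set V} | (A \subset X) && (X \subset B)].
have pA : p A by rewrite /p /= subxx.
case: (arg_minnP dsep pA) => Y /andP[AY YB] H; exists Y; split=> // X HA HB.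
by apply: H; rewrite /p /= HA.
Qed.

(** Sets [T u] are joined one after another while some member [u] of [K] in [X] asks for it;
    [B :\: X] shrinks each time, and [p] is the property carried along. *)
Lemma closed_superset A B (T : V -> {set V}) (K : {set V})
    (p : {set V} -> Prop) :
  A \subset B -> (forall u, u \in K -> T u \subset B) -> p A ->
  (forall X u, A \subset X -> X \subset B -> p X -> u \in K -> u \in X ->
     p (T u :|: X)) ->
  exists X, [/\ A \subset X, X \subset B, p X
    & forall u, u \in K -> u \in X -> T u \subset X].
Proof.
move=> AB TB pA pU.
suff: forall n X, #|B :\: X| <= n -> A \subset X -> X \subset B -> p X ->
    exists Y, [/\ A \subset Y, Y \subset B, p Y
      & forall u, u \in K -> u \in Y -> T u \subset Y].
  by move/(_ _ A (leqnn _) (subxx _) AB pA).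
elim=> [|n IH] X HX AX XB pX;
  case: (pickP [pred u | [&& u \in K, u \in X & ~~ (T u \subset X)]]) => [u|H].
- case/and3P=> uK _ /negP[]; apply: subset_trans (TB u uK) _.
  by rewrite -setD_eq0 -cards_eq0 -leqn0.
- exists X; split=> // u uK uX; apply: contraFT (H u) => /= HT.
  by rewrite uK uX.
- case/and3P=> uK uX HT; apply: (IH (T u :|: X)).
  + rewrite -ltnS; apply: leq_trans HX; apply: proper_card; apply/properP.
    split; first by apply: setDS; exact: subsetUr.
    case/subsetPn: HT => x xT xX; exists x; first by rewrite inE xX (subsetP (TB u uK)).
    by rewrite !inE xT.
  + apply: subset_trans AX _; exact: subsetUr.
  + by rewrite subUset TB.
  + exact: pU.
- exists X; split=> // u uK uX; apply: contraFT (H u) => /= HT.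
  by rewrite uK uX.
Qed.

(* [suc] holds of the successful children, [T v] is the set kept at the child [v],
   and [U] is the union of the sets of a minimal strongly closed family of them.
   Started from a member with least [dsep (T u)], the other paths can be followed
   within the bound.  A [Y] violating tightness of [U] would be reached through
   some first pallet; that child is successful and belongs to the family, so
   adding [U] to [Y] cannot increase [dsep]. *)
Lemma commit_children S (T : V -> {set V}) (suc : pred V) (U : {set V}) u0 :
  dsep S < k ->
  (forall v, suc v -> good (v |: S) (T v) /\ dsep (T v) <= dsep S) ->
  (forall v Y, v \notin S -> reach (v |: S) Y -> dsep (v |: S) <= k ->
     dsep Y <= dsep S -> suc v) ->
  suc u0 -> u0 \in U -> S \subset U ->
  (forall u, suc u -> u \in U -> T u \subset U) ->
  (forall u X, suc u -> u \in U -> S \subset X -> u \in X ->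
     (forall x, suc x -> x \in U -> x \in X -> T x \subset X) -> U \subset X) ->
  good S U /\ dsep U <= dsep S.
Proof.
move=> Sk HT comp su0 u0U SU closed strong.
pose K := [set u in U | suc u].
have KP u : (u \in K) = (u \in U) && suc u by rewrite inE.
have TU u : u \in K -> T u \subset U by rewrite KP => /andP[uU su]; exact: closed.
have mem_sub u X : u \in X -> S \subset X -> u |: S \subset X.
  by move=> uX SX; rewrite subUset sub1set uX.
(* Closing [R] under the sets of the family never increases [dsep], and by strong closure the result
   contains [U]. *)
have low u R : u \in K -> S \subset R -> u \in R -> dsep (U :|: R) <= dsep R.
  move=> uK SR uR.
  have TUR x : x \in K -> T x \subset U :|: R.
    by move=> xK; apply: subset_trans (TU x xK) _; exact: subsetUl.
  have [||X [RX XB pX cX]] := closed_superset (p := fun X => dsep X <= dsep R)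
      (subsetUr U R) TUR.
  - by [].
  - move=> X x RX _ pX; rewrite KP => /andP[xU sx] xX.
    have [[_ [_ tx]] _] := HT x sx; apply: leq_trans pX; apply: tx.
    by apply: mem_sub => //; exact: subset_trans RX.
  rewrite (_ : U :|: R = X) //; apply/eqP; rewrite eqEsubset XB andbT subUset RX andbT.
  move: uK; rewrite KP => /andP[uU su].
  apply: (strong u) => //; [exact: subset_trans RX | exact: (subsetP RX) |].
  by move=> x sx xU xX; apply: cX => //; rewrite KP xU.
have u0K : u0 \in K by rewrite KP u0U.
case: (arg_minnP (fun u => dsep (T u)) u0K) => u1 u1K minu1.
have /andP[u1U su1] : (u1 \in U) && suc u1 by rewrite -KP.
have [[R1 t1] d1] := HT _ su1.
have ST1 : u1 |: S \subset T u1 by case: t1.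
have dU : dsep U <= dsep S.
  apply: leq_trans d1; rewrite -{1}(setUidPl (TU _ u1K)); apply: (low u1) => //.
    by apply: subset_trans ST1; exact: subsetUr.
  by apply: (subsetP ST1); exact: setU11.
have reachSU : reach S U.
  have [||X [TX XU [pX dX] cX]] := closed_superset
      (p := fun X => reach S X /\ dsep X <= dsep (T u1)) (TU _ u1K) TU.
  - split=> //; apply: reach_trans R1; apply: reachU1.
    exact: leq_trans (dsepU1 _ _) Sk.
  - move=> X x TX XU [rX dX] xK xX.
    have /andP[xU sx] : (x \in U) && suc x by rewrite -KP.
    have [[rx tx] dx] := HT _ sx.
    have SX : x |: S \subset X.
      apply: mem_sub => //; apply: subset_trans TX; apply: subset_trans ST1.
      exact: subsetUr.
    have dTX : dsep (T x :|: X) <= dsep X by case: tx => _; apply.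
    split; last exact: leq_trans dX.
    apply: (reach_trans rX); rewrite -{1}(setUidPl SX) [T x :|: X]setUC.
    apply: (reachU rx) => P SP PT _; apply: leq_trans.
    (* [dsep (X :&: P)] is at least [dsep (T x)] by tightness, hence at least [dsep (T u1)] by the
       choice of [u1], hence at least [dsep X]; submodularity then gives
       [dsep (X :|: P) <= dsep P]. *)
    have h1 := dsepUI X P; have := tight_mid (Y := X :&: P) tx.
    rewrite subsetI SX SP (subset_trans (subsetIr _ _) PT) => /(_ isT isT) h2.
    have h3 : dsep (T u1) <= dsep (T x) := minu1 _ xK.
    by move: h1 h2 h3 dX; clear; lia.
  rewrite (_ : U = X) //; apply/eqP; rewrite eqEsubset XU andbT.
  apply: (strong u1) => //.
  - by apply: subset_trans TX; apply: subset_trans ST1; exact: subsetUr.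
  - by apply: (subsetP TX); apply: (subsetP ST1); exact: setU11.
  - by move=> x sx xU xX; apply: cX => //; rewrite KP xU.
split=> //; split=> //.
have [Y [SY YU minY]] := min_interval SU.
suff HY : dsep U <= dsep Y.
  by apply: tightP => // X SX XU; exact: leq_trans HY (minY _ SX XU).
rewrite leqNgt; apply/negP=> ltYU.
(* [Y] is minimal in the whole interval from [S] to [U], which is what [reachI] asks at every stage
   of the path to [U]. *)
have rY : reach S Y.
  rewrite -(setIidPl SY) -[X in reach _ X](setIidPr YU); apply: (reachI reachSU).
  by move=> P SP PU; apply: minY; rewrite ?subUset ?PU // (subset_trans SP) // subsetUl.
case: rY SY YU minY ltYU => [A|v A B vA dv rB] AB BU minB ltBU in Sk comp dU low SU mem_sub *.
  by rewrite ltnNge dU in ltBU.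
have sv : suc v by apply: (comp v B) => //; exact: leq_trans (ltnW ltBU) dU.
have vB : v \in B by apply: (subsetP (reach_sub rB)); exact: setU11.
have vK : v \in K by rewrite KP sv (subsetP BU).
by have := low _ _ vK AB vB; rewrite (setUidPl BU) leqNgt ltBU.
Qed.

(** A path from [S] to a set [B] with [dsep B <= dsep S] starts with some [v]. By tightness,
    [T v :|: B] is reachable from [T v] and has a value at most [dsep B], which is below
    [dsep (T v)]; this contradicts that [T v] is stuck. *)
Lemma stuck_of_children S (T : V -> {set V}) :
  (forall v, v \notin S -> dsep (v |: S) <= k ->
     [/\ good (v |: S) (T v), stuck (T v) & dsep S < dsep (T v)]) ->
  stuck S.
Proof.
move=> H X rX dX; case: rX dX H => // v A B vA dv rB dB H.
have [[rT [_ tT]] sT lt] := H v vA dv.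
have dU : dsep (T v :|: B) <= dsep B by apply: tT; exact: reach_sub rB.
have vT : v |: A \subset T v := reach_sub rT.
have := sT (T v :|: B); rewrite -{1}(setUidPl vT) => E.
suff : T v :|: B = T v by move=> E'; move: dU; rewrite E'; lia.
apply: E; last lia.
by apply: (reachU rB) => P AP _ _; apply: leq_trans; exact: tT.
Qed.

Lemma reachT_good S : good set0 S -> reach set0 setT -> reach S setT.
Proof.
move=> [_ [_ H]] R; rewrite -[S]setU0 -[X in reach _ X](setUT S).
by apply: (reachU R) => P _ _ _; apply: leq_trans; apply: H; exact: sub0set.
Qed.

(** The full set has value [0], so a stuck set from which it can be reached is already full. *)
Lemma stuck_setT S : good set0 S -> stuck S -> S = setT <-> reach set0 setT.
Proof.
move=> gS sS; split=> [<-|R]; first by case: gS.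
by symmetry; apply: sS; [exact: reachT_good | rewrite dsepT].
Qed.

End Separation.

(** * The search tree and its invariant *)

Section Search.
Variables (m : nat) (arc : rel 'I_m) (k : nat).
Implicit Types (Q : seq 'I_m -> {set 'I_m}) (w x y z : seq 'I_m) (a u : 'I_m).
Implicit Types (S X : {set 'I_m}).

Local Notation dsep := (dsep arc).
Local Notation good := (good arc k).
Local Notation tight := (tight arc).
Local Notation stuck := (stuck arc k).

Definition upd Q w X : seq 'I_m -> {set 'I_m} := fun x => if x == w then X else Q x.

Lemma updE Q w X : upd Q w X w = X.
Proof. by rewrite /upd eqxx. Qed.

Lemma upd_neq Q w X x : x != w -> upd Q w X x = Q x.
Proof. by rewrite /upd => /negPf ->. Qed.

(* The set [X] kept at the child [u] was computed for an earlier set [S0] of the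
   parent, which has grown to [S] since. *)
Definition stale S u X : Prop :=
  X = set0 \/ exists S0, tight S0 S /\ good (u |: S0) X.

(* [w] is the current node and [v] its next child to be visited; the entry of [w]
   following a proper prefix [y] plays the part of [v] for [y].  [inv_off]: a node
   off the current path is unvisited, successful or stuck. *)
Record tree_inv Q w (v : nat) : Prop := TreeInv {
  inv_root : good set0 (Q [::]);
  inv_stale : forall x u, stale (Q x) u (Q (rcons x u));
  inv_empty : forall x u, x != [::] -> Q x = set0 -> Q (rcons x u) = set0;
  inv_off : forall x, ~~ prefix x w ->
    [\/ Q x = set0, dsep (Q x) < size x | stuck (Q x)];
  inv_path : forall y a z, w = y ++ a :: z ->
    [/\ a \notin Q y, dsep (Q y) = size y, a |: Q y \subset Q (rcons y a)
      & forall u, u < a -> u \notin Q y -> good (u |: Q y) (Q (rcons y u))];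
  inv_top : forall u, u < v -> u \notin Q w -> good (u |: Q w) (Q (rcons w u));
  inv_dsep : dsep (Q w) <= size w;
  inv_size : size w <= k
}.

Lemma tree_inv0 : tree_inv (fun=> set0) [::] 0.
Proof.
split=> //; first exact: good_refl.
- by move=> x u; left.
- by move=> x _; apply: Or31.
- by case.
- by rewrite dsep0.
Qed.

Lemma stale_good S u X : stale S u X -> good (u |: S) (X :|: (u |: S)).
Proof.
case=> [->|[S0 [tS gX]]]; first by rewrite set0U; exact: good_refl.
have uX : [set u] \subset X.
  by rewrite sub1set; case: gX => /reach_sub /subsetP H _; apply: H; exact: setU11.
rewrite setUA (setUidPl uX); exact: good_tightU gX.
Qed.

Lemma stale_tight S u X : stale S u X -> X != set0 -> tight X (X :|: (u |: S)).
Proof.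
case=> [->|[S0 [tS gX]] _]; first by rewrite eqxx.
by apply: tight_absorb tS _; case: gX => /reach_sub.
Qed.

Lemma tree_inv_nonempty Q w v : tree_inv Q w v -> w != [::] -> Q w != set0.
Proof.
move=> I; case/lastP: w I => // y a I _; have := inv_path I (y := y) (a := a) (z := [::]).
rewrite cats1 => /(_ erefl) [_ _ H _]; apply/set0Pn; exists a.
by apply: (subsetP H); exact: setU11.
Qed.

Lemma rcons_cat_neq y a z u : u < a -> rcons y u != y ++ a :: z.
Proof.
move=> Hu; rewrite -cats1 eqseq_cat // eqxx /=; apply/eqP => -[E _].
by rewrite E ltnn in Hu.
Qed.

Lemma cat_neq y a z : y != y ++ a :: z.
Proof. by apply/eqP => /(congr1 size); rewrite size_cat /=; lia. Qed.

(** The counter returns to [0]: the sets of the children were good over the old [Q w] and are only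
    stale for the new one. *)
Lemma tree_inv_grow Q w v X : tree_inv Q w v -> good (Q w) X -> tree_inv (upd Q w X) w 0.
Proof.
move=> I gX; have QX : Q w \subset X by case: gX => /reach_sub.
have nx x : rcons x =1 rcons x by [].
split=> //.
- rewrite /upd; case: eqP => [E|_]; last exact: inv_root I.
  by apply: good_trans gX; rewrite -E; exact: inv_root I.
- move=> x u; have S0 := inv_stale I x u.
  have [E|N] := eqVneq (rcons x u) w.
    rewrite E updE upd_neq; last first.
      by apply/eqP => Ex; move/(congr1 size): E; rewrite size_rcons Ex; lia.
    have NE : Q w != set0 by apply: (tree_inv_nonempty I); rewrite -E; case: (x).
    rewrite E in S0; case: S0 => [E0|[S0 [t0 g0]]]; first by rewrite E0 eqxx in NE.
    right; exists S0; split=> //; exact: good_trans gX.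
  rewrite (upd_neq _ _ N); have [Ex|Nx] := eqVneq x w; last by rewrite upd_neq.
  rewrite Ex updE -Ex; case: S0 => [->|[S0 [t0 g0]]]; first by left.
  right; exists S0; split=> //; apply: tight_trans t0 _; rewrite Ex.
  by case: gX.
- move=> x u xne; have [Ex|N] := eqVneq x w.
    subst x; rewrite updE => E; have Q0 : Q w = set0.
      by apply/eqP; rewrite -subset0 -E.
    rewrite upd_neq; last by apply/eqP => /(congr1 size); rewrite size_rcons; lia.
    exact: (inv_empty I).
  rewrite upd_neq // => Ex; have E := inv_empty I u xne Ex.
  rewrite upd_neq //; apply/eqP => Ew.
  have ne : w != [::] by rewrite -Ew; case: (x).
  by have := tree_inv_nonempty I ne; rewrite -Ew E eqxx.
- move=> x Hx; rewrite upd_neq; first exact: inv_off I _ Hx.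
  by apply: contraNneq Hx => ->; exact: prefix_refl.
- move=> y a z E; have [H1 H2 H3 H4] := inv_path I E.
  have Ny : y != w by rewrite E cat_neq.
  rewrite (upd_neq _ _ Ny); split=> //.
    rewrite /upd; case: eqP => // E'; apply: subset_trans QX; by rewrite -E'.
  move=> u Hu uQ; rewrite upd_neq ?E ?rcons_cat_neq //; exact: H4.
- by rewrite updE; apply: leq_trans (inv_dsep I); apply: tight_dsep; case: gX.
- exact: inv_size I.
Qed.

(** If repairing the stale set of child [v] changes nothing, then it is already good over the
    current [Q w]. *)
Lemma tree_inv_next Q w (v : nat) :
  tree_inv Q w v ->
  (forall u, u = v :> nat -> u \notin Q w ->
     Q (rcons w u) :|: (u |: Q w) = Q (rcons w u)) ->
  tree_inv Q w v.+1.
Proof.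
move=> I H; case: (I) => H1 H2 H3 H4 H5 H6 H7 H8; split=> // u.
rewrite ltnS leq_eqVlt => /orP[/eqP E|]; last exact: H6.
by move=> uQ; rewrite -(H u E uQ); apply: stale_good.
Qed.

Lemma prefix_rconsP x w a : prefix x (rcons w a) = prefix x w || (x == rcons w a).
Proof.
apply/prefixP/orP => [[s]|[/prefixP[s ->]|/eqP->]].
- case/lastP: s => [|s b]; first by rewrite cats0 => ->; right.
  rewrite -rcons_cat => /rcons_inj[-> _]; left; exact: prefix_prefix.
- by exists (rcons s a); rewrite rcons_cat.
- by exists [::]; rewrite cats0.
Qed.

(** Sets kept below the child stay stale after the repair, because the repaired set is tight over
    the old one; below a child never visited nothing is kept, by [inv_empty]. *)
Lemma tree_inv_push Q w a :
  tree_inv Q w a -> a \notin Q w -> dsep (Q w) = size w -> size w < k ->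
  tree_inv (upd Q (rcons w a) (Q (rcons w a) :|: (a |: Q w))) (rcons w a) 0.
Proof.
move=> I aQ dQ wk; set c := rcons w a; set X := _ :|: _.
have sX := inv_stale I w a.
have gX : good (a |: Q w) X by exact: stale_good sX.
have aX : a \in X by rewrite inE setU11 orbT.
have cne : c != [::] by rewrite /c; case: (w).
have Nc x u : rcons x u == c -> x = w /\ u = a by move/eqP/rcons_inj => -[].
have wc : w != c by apply/eqP => /(congr1 size); rewrite size_rcons; lia.
split=> //.
- by rewrite upd_neq 1?eq_sym //; exact: inv_root I.
- move=> x u; have S0 := inv_stale I x u.
  have [E|N] := eqVneq (rcons x u) c.
    have [-> ->] := Nc _ _ (introT eqP E).
    rewrite updE upd_neq //; right; exists (Q w); split=> //; exact: tight_refl.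
  rewrite (upd_neq _ _ N); have [Ex|Nx] := eqVneq x c; last by rewrite upd_neq.
  rewrite Ex updE -Ex; have [E0|NE] := eqVneq (Q c) set0.
    by left; rewrite Ex; exact: (inv_empty I).
  case: S0 => [->|[S0 [t0 g0]]]; first by left.
  right; exists S0; split=> //; apply: tight_trans t0 _; rewrite Ex.
  exact: stale_tight.
- move=> x u xne; have [->|N] := eqVneq x c.
    by rewrite updE => E; move: aX; rewrite E inE.
  rewrite upd_neq // => Ex; have E := inv_empty I u xne Ex.
  rewrite upd_neq //; apply/eqP => Ew; have [Exw _] := Nc _ _ (introT eqP Ew).
  by have := tree_inv_nonempty I; rewrite -Exw Ex eqxx => /(_ xne).
- move=> x; rewrite prefix_rconsP negb_or => /andP[Hx Nx].
  by rewrite upd_neq //; exact: inv_off I _ Hx.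
- move=> y b z; case/lastP: z => [|z d].
    rewrite cats1 => /rcons_inj [<- <-]; rewrite updE upd_neq //; split=> //.
      exact: subsetUr.
    move=> u Hu uQ; rewrite upd_neq; first exact: inv_top I _ Hu uQ.
    by apply/eqP => /rcons_inj[E]; rewrite E ltnn in Hu.
  rewrite -rcons_cons -rcons_cat => /rcons_inj [E _].
  have [H1 H2 H3 H4] := inv_path I E.
  have sy : size y < size w by rewrite E size_cat /=; lia.
  have N x : size x <= size w -> x != c.
    by move=> Hx; apply/eqP => Ex; move: Hx; rewrite Ex /c size_rcons ltnn.
  rewrite (upd_neq Q X (N y (ltnW sy))) upd_neq; last by rewrite N ?size_rcons.
  split=> // u Hu uQ; rewrite upd_neq ?N ?size_rcons //; exact: H4.
- rewrite updE size_rcons; case: gX => _ /tight_dsep H; apply: leq_trans H _.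
  by rewrite -dQ; exact: dsepU1.
- by rewrite size_rcons.
Qed.

(** The counter of the parent stays at [a]. The next visit finds that the set of this child already
    contains [a |: Q w], and advances. *)
Lemma tree_inv_pop Q w a v :
  tree_inv Q (rcons w a) v ->
  dsep (Q (rcons w a)) < size (rcons w a) \/ stuck (Q (rcons w a)) ->
  tree_inv Q w a.
Proof.
move=> I D; case: (I) => H1 H2 H3 H4 H5 H6 H7 H8.
have [P1 P2 P3 P4] := H5 w a [::] (esym (cats1 _ _)).
split=> //.
- move=> x Hx; have [->|N] := eqVneq x (rcons w a).
    by case: D => D; [apply: Or32 | apply: Or33].
  by apply: H4; rewrite prefix_rconsP negb_or Hx.
- move=> y b z E; apply: (H5 y b (rcons z a)).
  by rewrite E -rcons_cons rcons_cat.
- by rewrite P2.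
- by rewrite size_rcons in H8; exact: ltnW.
Qed.

Lemma child_good Q w u : tree_inv Q w m -> u \notin Q w -> good (u |: Q w) (Q (rcons w u)).
Proof. by move=> I; apply: (inv_top I). Qed.

Lemma child_done Q w u : tree_inv Q w m -> u \notin Q w ->
  dsep (Q (rcons w u)) <= size w \/ stuck (Q (rcons w u)).
Proof.
move=> I uQ; have [] := inv_off I (x := rcons w u).
- apply/negP => /prefixP[s] /(congr1 size).
  by rewrite size_cat size_rcons; lia.
- move=> E; have [/reach_sub /subsetP /(_ u)] := child_good I uQ.
  by rewrite E setU11 inE => /(_ isT).
- by rewrite size_rcons ltnS => ?; left.
- by right.
Qed.

Definition success Q w u := (u \notin Q w) && (dsep (Q (rcons w u)) <= size w).

Lemma search_stuck Q w : tree_inv Q w m -> dsep (Q w) = size w ->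
  (forall u, ~~ success Q w u) -> stuck (Q w).
Proof.
move=> I D H; apply: (stuck_of_children (T := fun u => Q (rcons w u))) => u uQ _.
have := H u; rewrite /success uQ /= -ltnNge -D => lt; split=> //.
  exact: child_good.
by case: (child_done I uQ) => //; lia.
Qed.

Lemma search_commit Q w (U : {set 'I_m}) u0 : tree_inv Q w m -> dsep (Q w) = size w ->
  size w < k -> success Q w u0 -> u0 \in U -> Q w \subset U ->
  (forall u, success Q w u -> u \in U -> Q (rcons w u) \subset U) ->
  (forall u X, success Q w u -> u \in U -> Q w \subset X -> u \in X ->
     (forall v, success Q w v -> v \in U -> v \in X -> Q (rcons w v) \subset X) ->
     U \subset X) ->
  good (Q w) U.
Proof.
move=> I D wk su0 u0U SU closed strong.
suff [] : good (Q w) U /\ dsep U <= dsep (Q w) by [].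
apply: (@commit_children _ arc k _ (fun u => Q (rcons w u)) (success Q w) _ u0) => //.
- by rewrite D.
- by move=> v /andP[vQ]; rewrite -D; split=> //; exact: child_good.
(* A child that is not successful is stuck at a value above [dsep (Q w)]; joining [Y] to its set
   would lower that value. *)
- move=> v Y vQ rY dv dY; rewrite /success vQ /=.
  have [//|sv] := child_done I vQ; rewrite leqNgt; apply/negP => lt.
  have [rT [_ tT]] := child_good I vQ.
  have dU : dsep (Q (rcons w v) :|: Y) <= dsep Y by apply: tT; exact: reach_sub rY.
  have vT : v |: Q w \subset Q (rcons w v) := reach_sub rT.
  have := sv (Q (rcons w v) :|: Y); rewrite -{1}(setUidPl vT) => E.
  suff : Q (rcons w v) :|: Y = Q (rcons w v) by move=> E'; move: dU; rewrite E'; lia.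
  apply: E; last lia.
  by apply: (reachU rY) => P AP _ _; apply: leq_trans; exact: tT.
Qed.

(** At depth [k] the value is [k], so every addition exceeds the bound and only the trivial path
    remains. *)
Lemma leaf_stuck Q w v : tree_inv Q w v -> size w = k -> dsep (Q w) = size w ->
  (forall u, u \notin Q w -> dsep (Q w) < dsep (u |: Q w)) -> stuck (Q w).
Proof.
move=> I wk D H X rX _; case: rX D H => // u A B uA du _ D /(_ u uA).
by rewrite D wk ltnNge du.
Qed.

Lemma leaf_grow Q w v u : tree_inv Q w v -> size w = k -> dsep (u |: Q w) <= dsep (Q w) ->
  good (Q w) (u |: Q w).
Proof. by move=> I wk H; apply: goodU1 => //; rewrite -wk; exact: inv_dsep I. Qed.

Lemma search_done Q v : tree_inv Q [::] v -> stuck (Q [::]) ->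
  Q [::] = setT <-> reach arc k set0 setT.
Proof. by move=> I; apply: stuck_setT; exact: inv_root I. Qed.

(* A step that replaces [Q w] by the set of a child costs at most [b * m ^ 3], any
   other step at most [b * m ^ 2].  An enlargement of [Q x] releases
   [weight (size x)], which pays for a fresh pass over the children of [x]; [path_fuel] and
   [node_fuel] account for the passes under way along the current path. *)
Variable b : nat.

Definition weight j := if j == k then 2 * (b * m ^ 2) else 3 * (b * m ^ 3).

Definition potential Q : nat :=
  \sum_(j < k.+1) \sum_(t : j.-tuple 'I_m) weight j * (m - #|Q t|).

Definition node_fuel w v : nat :=
  if size w == k then b * m ^ 2 else (m - v) * (b * m ^ 2) + b * m ^ 3.

Definition path_fuel w : nat := \sum_(a <- w) ((m - a) * (b * m ^ 2) + b * m ^ 3).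

Definition fuel Q w v : nat := potential Q + path_fuel w + node_fuel w v.

(** * Bounds on the fuel *)

Lemma potential_upd Q w X : size w <= k -> Q w \proper X ->
  potential (upd Q w X) + weight (size w) <= potential Q.
Proof.
move=> wk QX; rewrite /potential.
have -> : weight (size w) =
    \sum_(j < k.+1) \sum_(t : j.-tuple 'I_m | tval t == w) weight j.
  have jk : size w < k.+1 by [].
  rewrite (bigD1 (Ordinal jk)) //= (big_pred1 (in_tuple w)) => [|t]; last first.
    by apply/eqP/eqP => [E|->] //; apply: val_inj.
  rewrite big1 ?addn0 // => j Hj; rewrite big_pred0 // => t.
  by apply: contraNF Hj => /eqP E; rewrite -val_eqE /= -E size_tuple.
rewrite -big_split /=; apply: leq_sum => j _.
rewrite [X in _ + X]big_mkcond -big_split /=; apply: leq_sum => t _.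
rewrite /upd; case: eqP => [->|_]; last by rewrite addn0.
rewrite -mulnSr leq_mul2l; apply/orP; right.
have h1 : #|Q w| < #|X| := proper_card QX.
have h2 : #|X| <= m by apply: leq_trans (max_card _) _; rewrite card_ord.
by move: (#|X|) (#|Q w|) h1 h2 => ? ?; lia.
Qed.

Lemma path_fuel_rcons w a : path_fuel (rcons w a) = path_fuel w + ((m - a) * (b * m ^ 2) + b * m ^ 3).
Proof. by rewrite /path_fuel -cats1 big_cat big_seq1. Qed.

Lemma m2_le_m3 : b * m ^ 2 <= b * m ^ 3.
Proof. by case: m => [|n]; rewrite ?muln0 // leq_mul2l leq_pexp2l // orbT. Qed.

Lemma node_fuel_ge w v : b * m ^ 2 <= node_fuel w v.
Proof. by rewrite /node_fuel; case: eqP => // _; apply: leq_trans m2_le_m3 (leq_addl _ _). Qed.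

Lemma fuel_pop Q w a v : size w < k ->
  fuel Q w a + node_fuel (rcons w a) v = fuel Q (rcons w a) v.
Proof. by move=> wk; rewrite /fuel path_fuel_rcons {1}/node_fuel ltn_eqF //; lia. Qed.

Lemma fuel_next Q w v : size w < k -> v < m ->
  fuel Q w v.+1 + b * m ^ 2 = fuel Q w v.
Proof.
move=> wk vm; rewrite /fuel /node_fuel ltn_eqF //.
by rewrite -[in RHS](@subnSK v m) // mulSn; lia.
Qed.

(** The fuel of the parent moves into [path_fuel], so the released weight must cover a full pass at
    the child and the step itself: [2 * (b * m ^ 2)] at a leaf, and [2 * (b * m ^ 3) + b * m ^ 2] at
    an inner node. This is the origin of the constants in [weight]. *)
Lemma fuel_push Q w a X : size w < k -> Q (rcons w a) \proper X ->
  fuel (upd Q (rcons w a) X) (rcons w a) 0 + b * m ^ 2 <= fuel Q w a.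
Proof.
move=> wk QX; have := potential_upd _ QX; rewrite /fuel path_fuel_rcons size_rcons => /(_ wk).
rewrite {2}/node_fuel (ltn_eqF wk) /weight /node_fuel size_rcons; have := m2_le_m3.
by case: eqP => _; rewrite ?subn0 ?expnS; nia.
Qed.

Lemma fuel_leaf Q w X v : size w = k -> Q w \proper X ->
  fuel (upd Q w X) w 0 + b * m ^ 2 <= fuel Q w v.
Proof.
move=> wk QX; have := potential_upd _ QX; rewrite wk => /(_ (leqnn _)).
by rewrite /fuel /weight /node_fuel wk eqxx; lia.
Qed.

(** The [b * m ^ 3] that remains at the end of a pass pays for the step, and the released weight
    covers the next pass, worth [2 * (b * m ^ 3)]. *)
Lemma fuel_commit Q w X : size w < k -> Q w \proper X ->
  fuel (upd Q w X) w 0 + b * m ^ 3 <= fuel Q w m.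
Proof.
move=> wk QX; have := potential_upd (ltnW wk) QX.
by rewrite /fuel /weight /node_fuel (ltn_eqF wk) subn0 subnn !expnS; nia.
Qed.

Lemma geometric_sum j : 1 < m -> \sum_(i < j) m ^ i.+1 <= 2 * m ^ j.
Proof.
move=> m1; elim: j => [|j IH]; first by rewrite big_ord0.
rewrite big_ord_recr /= expnS mulnCA; apply: leq_trans (leq_add IH (leqnn _)) _.
by move: (m ^ j) m1 => x; clear; nia.
Qed.

(** In units of [b * m ^ (k + 3)], the leaves hold [2], the inner nodes [6] by the geometric sum,
    and the pass at the root at most [2]. *)
Lemma fuel0 : 1 < m -> fuel (fun=> set0) [::] 0 <= 10 * b * m ^ (k + 3).
Proof.
move=> m1; rewrite /fuel /path_fuel big_nil addn0.
have Ht : node_fuel [::] 0 <= 2 * b * m ^ (k + 3).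
  have H3 : m ^ 3 <= m ^ (k + 3) by rewrite leq_pexp2l ?leq_addl //; lia.
  have H2 := m2_le_m3; rewrite /node_fuel; case: eqP => _; first nia.
  by rewrite subn0 [m ^ 3]expnS in H2 H3 *; nia.
have Hp : potential (fun=> set0) <= 2 * b * m ^ (k + 3) + 3 * b * m ^ 3 * (2 * m ^ k).
  rewrite /potential big_ord_recr /= addnC; apply: leq_add.
    rewrite (eq_bigr (fun=> 2 * (b * m ^ 2) * m)) => [|t _]; last first.
      by rewrite /weight eqxx cards0 subn0.
    by rewrite sum_nat_const card_tuple card_ord expnD !expnS; nia.
  rewrite (eq_bigr (fun i : 'I_k => 3 * b * m ^ 3 * m ^ i.+1)) => [|i _].
    by rewrite -big_distrr /= leq_mul2l geometric_sum ?orbT.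
  rewrite (eq_bigr (fun=> 3 * (b * m ^ 3) * m)) => [|t _]; last first.
    by rewrite /weight ltn_eqF // cards0 subn0.
  rewrite sum_nat_const card_tuple card_ord [m ^ i.+1]expnS; nia.
by move: Hp Ht; rewrite !expnD; nia.
Qed.

End Search.

(** * Processings and orders of pallets *)

(** The first occurrence of [u] counts; for an absent [u], [index] is the size of [s] and nothing
    follows. *)
Definition before (s : seq nat) (u t : nat) : bool :=
  t \in drop (index u s).+1 s.

Lemma mem_drop_leq (T : eqType) (s : seq T) i j x :
  i <= j -> x \in drop j s -> x \in drop i s.
Proof. by move=> /subnK <-; rewrite -drop_drop; exact: mem_drop. Qed.

Lemma mem_take_leq (T : eqType) (s : seq T) i j x :
  i <= j -> x \in take i s -> x \in take j s.
Proof. by move=> H; rewrite -(take_takel s H); exact: mem_take. Qed.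

Lemma sum_delta (T : finType) (j : T) : \sum_l (l == j) = 1.
Proof. by rewrite (bigD1 j) //= eqxx big1 // => l /negPf ->. Qed.

Section Graph.
Variables (I : fifo_instance) (tt : seq nat).
Hypotheses (pI : practical I) (tt_uniq : uniq tt) (tt_mem : tt =i pallets I).
Local Notation m := (size tt).
Local Notation Q j := (map (@plt I) (queue j)).
Implicit Types (c d : config I) (a i u v : 'I_m).

(** Loops are excluded so that a pallet outside a set is not counted there as its own
    in-neighbour. *)
Definition pallet_arc : rel 'I_m := fun u v =>
  (u != v) &&
  has (fun q => before (map (@plt I) q) (nth 0 tt u) (nth 0 tt v)) (queues I).

Local Notation pal i := (nth 0 tt (nat_of_ord i)).
Local Notation k := (places I).-1.

Lemma pal_inj : injective (fun i => pal i).
Proof. by move=> i j /eqP; rewrite nth_uniq // => /eqP /val_inj. Qed.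

Lemma pallet_arcP u v :
  reflect (u != v /\ exists j : 'I_(nqueues I), before (Q j) (pal u) (pal v))
    (pallet_arc u v).
Proof.
apply: (iffP andP) => -[uv H]; split=> //.
  have [q qI Hq] := hasP H; have qj : index q (queues I) < nqueues I by rewrite index_mem.
  by exists (Ordinal qj); rewrite /queue nth_index.
have [j Hj] := H; apply/hasP; exists (queue j) => //.
by apply: mem_nth; exact: ltn_ord.
Qed.

Lemma mem_bins b : b \in bins I -> exists j : 'I_(nqueues I), b \in queue j.
Proof.
case/flattenP=> q qI bq; have qj : index q (queues I) < nqueues I by rewrite index_mem.
by exists (Ordinal qj); rewrite /queue nth_index.
Qed.

Lemma queue_bins (j : 'I_(nqueues I)) b : b \in queue j -> b \in bins I.
Proof. by move=> H; apply/flattenP; exists (queue j) => //; apply: mem_nth. Qed.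

Lemma queue_pal (j : 'I_(nqueues I)) t : t \in Q j -> exists i, t = pal i.
Proof.
case/mapP=> b /queue_bins bI ->.
have H : plt b \in tt by rewrite tt_mem mem_undup map_f.
have Hi : index (plt b) tt < m by rewrite index_mem.
by exists (Ordinal Hi); rewrite nth_index.
Qed.

Lemma pal_queue i : exists j : 'I_(nqueues I), pal i \in Q j.
Proof.
have : pal i \in pallets I by rewrite -tt_mem mem_nth.
rewrite mem_undup => /mapP[b /mem_bins[j bj] ->].
by exists j; rewrite map_f.
Qed.

(** * From processings to orders of pallets *)

Definition opened c : {set 'I_m} :=
  [set i | [exists j, pal i \in take (c j) (Q j)]].

Definition left_over c : {set 'I_m} :=
  [set i | [exists j, pal i \in drop (c j) (Q j)]].

Lemma nopenE c : nopen c = #|opened c :&: left_over c|.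
Proof.
have Hp : perm_eq (pallets I) tt by apply: uniq_perm; rewrite ?undup_uniq.
rewrite /nopen (permP Hp) -{1}(mkseq_nth 0 tt) /mkseq -val_enum_ord -map_comp.
rewrite count_map -sum1_count big_enum_cond /= -sum1_card; apply: eq_bigl => i /=.
rewrite !inE /is_open; congr andb; apply: eq_existsb => j.
  by rewrite -map_take -has_pred1 has_map.
by rewrite -map_drop -has_pred1 has_map.
Qed.

Lemma openedP c i :
  reflect (exists j, pal i \in take (c j) (Q j)) (i \in opened c).
Proof. by rewrite inE; exact: existsP. Qed.

Lemma left_overP c i :
  reflect (exists j, pal i \in drop (c j) (Q j)) (i \in left_over c).
Proof. by rewrite inE; exact: existsP. Qed.

Lemma opened_finish : opened (finish I) = setT.
Proof.
apply/setP=> i; rewrite [RHS]inE; apply/openedP; have [j Hj] := pal_queue i.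
by exists j; rewrite ffunE -map_take take_size.
Qed.

(** If nothing were left for [i], the bin just removed from sequence [j] would be its only one,
    against the assumption of two bins per pallet. *)
Lemma left_over_newly_opened c i (j : 'I_(nqueues I)) :
  i \notin opened c -> pal i \in take (c j).+1 (Q j) ->
  i \in left_over [ffun l => if l == j then (c j).+1 else c l].
Proof.
move=> iS iT; apply: contraT => iL.
have cnt : 2 <= count (fun b => plt b == pal i) (bins I).
  by apply: (pallet_ge2 pI); rewrite -tt_mem mem_nth.
have E : count (fun b => plt b == pal i) (bins I) =
    \sum_(l : 'I_(nqueues I)) count_mem (pal i) (Q l).
  rewrite /bins count_flatten sumnE big_map (big_nth [::]) big_mkord.
  by apply: eq_bigr => l _; rewrite count_map.
have H l : count_mem (pal i) (Q l) <= (l == j).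
  rewrite -(cat_take_drop (c l) (Q l)) count_cat.
  have /count_memPn -> : pal i \notin take (c l) (Q l).
    by apply: contra iS => ?; apply/openedP; exists l.
  rewrite add0n; have := iL; rewrite inE negb_exists => /forallP /(_ l).
  rewrite ffunE; case: eqP => [->|_] /count_memPn Hl; last by rewrite Hl.
  case E1 : (drop (c j) (Q j)) => [|x s] //=.
  have := drop_drop (Q j) 1 (c j); rewrite E1 /= drop0 add1n => ->; rewrite Hl addn0.
  by case: eqP.
have := leq_sum (index_enum _) (P := predT) (fun l _ => H l).
rewrite -E => /(leq_trans cnt).
by rewrite sum_delta.
Qed.

Lemma transformationP c c' :
  transformation c c' -> exists2 j : 'I_(nqueues I), c j < size (Q j) &
    c' = [ffun l => if l == j then (c j).+1 else c l].
Proof. by case/existsP=> j /andP[H /eqP->]; exists j; rewrite ?size_map. Qed.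

(** When a step opens a new pallet [a], then [a] and the whole front of the pallets opened so far
    are open after it; so this front has at most [p - 1] members. *)
Lemma processing_reach c s :
  path (@transformation I) c s -> last c s = finish I ->
  all (fun c => nopen c <= places I) s ->
  dsep pallet_arc (opened c) <= k /\ reach pallet_arc k (opened c) setT.
Proof.
elim: s c => [|c' s IH] c /=.
  by move=> _ -> _; rewrite opened_finish dsepT; split=> //; exact: reach_refl.
case/andP=> /transformationP[j jc Ec'] Hp Hl /andP[Hn Ha].
have {IH Hp Hl Ha} [IH1 IH2] := IH _ Hp Hl Ha.
set t := nth 0 (Q j) (c j).
have Etake : take (c j).+1 (Q j) = rcons (take (c j) (Q j)) t.
  by rewrite -(take_nth 0).
have [a Ea] : exists a, t = pal a by apply: (queue_pal (j := j)); exact: mem_nth.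
have Eopen : opened c' = a |: opened c.
  apply/setP=> i; rewrite in_setU1; apply/openedP/orP => [[l]|].
    rewrite Ec' ffunE; case: eqP => [->|_] H; last by right; apply/openedP; exists l.
    move: H; rewrite Etake mem_rcons inE => /orP[/eqP E|H].
      by left; apply/eqP/pal_inj; rewrite E.
    by right; apply/openedP; exists j.
  case=> [/eqP->|/openedP[l Hl]].
    by exists j; rewrite Ec' ffunE eqxx Etake mem_rcons inE Ea eqxx.
  exists l; rewrite Ec' ffunE; case: eqP => // El; subst l.
  by apply: mem_take_leq Hl.
have [aS|aS] := boolP (a \in opened c).
  by move: IH1 IH2; rewrite Eopen (setUidPr _) ?sub1set.
split; last by apply: (reach_add aS); rewrite -Eopen.
have H : a |: front pallet_arc (opened c) \subset opened c' :&: left_over c'.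
  apply/subsetP=> i; rewrite in_setU1 => /orP[/eqP->|].
    rewrite in_setI Eopen setU11 Ec'; apply: left_over_newly_opened => //.
    by rewrite Etake mem_rcons inE Ea eqxx.
  case/frontP=> iS [u uS /pallet_arcP[_ [l Hl]]].
  rewrite in_setI Eopen in_setU1 iS orbT; apply/left_overP; exists l.
  apply: (mem_drop_leq _ Hl); rewrite Ec' ffunE.
  (* No bin for [u] has been removed, so everything behind its first bin survives even the removal
     of one more bin from sequence [l]. *)
  have Hu : c l <= index (pal u) (Q l).
    rewrite leqNgt; apply: contra uS => Hu; apply/openedP; exists l.
    rewrite in_take // -index_mem ltnNge; apply/negP => lt.
    by move: Hl; rewrite /before drop_oversize // ltnW.
  by case: eqP => [<-|_] //; exact: leqW.
have := subset_leq_card H; rewrite -nopenE cardsU1.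
have -> /= : a \notin front pallet_arc (opened c).
  by apply: contra aS => /frontP[].
by move/leq_trans => /(_ _ Hn); rewrite add1n => ?; rewrite -ltnS prednK // (places_gt0 pI).
Qed.

(** * From orders of pallets to processings *)

Definition greedy (A : {set 'I_m}) : config I :=
  [ffun j => find (predC (mem [seq pal i | i in A])) (Q j)].

Lemma greedy_take A j t : t \in take (greedy A j) (Q j) -> exists2 i, i \in A & t = pal i.
Proof.
rewrite ffunE; set P := predC _; elim: (Q j) => //= x s IH.
case: ifP => //= /negbFE xA; rewrite inE => /orP[/eqP->|/IH//].
by case/imageP: xA => i iA ->; exists i.
Qed.

Lemma greedy_size A j : greedy A j <= size (queue j).
Proof. by rewrite ffunE -(size_map (@plt I)) find_size. Qed.

Lemma greedy0 : greedy set0 = start I.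
Proof.
apply/ffunP=> j; rewrite !ffunE; case: (Q j) => //= x s.
by rewrite (_ : _ \in _ = false) //; apply/negP => /imageP[i]; rewrite inE.
Qed.

Lemma greedyT : greedy setT = finish I.
Proof.
apply/ffunP=> j; rewrite !ffunE hasNfind ?size_map //.
rewrite has_predC negbK; apply/allP => t /queue_pal[i ->].
by apply/imageP; exists i.
Qed.

Definition config_le c d := [forall j, c j <= d j].

Lemma config_leP c d : reflect (forall j, c j <= d j) (config_le c d).
Proof. exact: forallP. Qed.

Lemma config_le_path c d : config_le c d -> config_le d (finish I) ->
  exists s, [/\ path (@transformation I) c s, last c s = d
    & all (fun e => config_le c e && config_le e d) s].
Proof.
move=> /config_leP cd /config_leP df; move: {2}(\sum_j (d j - c j)) (erefl (\sum_j (d j - c j))) => n.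
elim: n c cd => [|n IH] c cd En.
  exists [::]; split=> //=; apply/ffunP=> j; apply/eqP; rewrite eqn_leq cd /=.
  have/eqP := En; rewrite sum_nat_eq0 => /forallP /(_ j) /=; by rewrite subn_eq0.
have [j cj] : exists j, c j < d j.
  apply/existsP; apply: contra_eqT En; rewrite negb_exists => /forallP H.
  by rewrite big1 // => j _; apply/eqP; rewrite subn_eq0 leqNgt.
set c' : config I := [ffun l => if l == j then (c j).+1 else c l].
have cc' l : c l <= c' l by rewrite ffunE; case: eqP => // ->.
have c'd l : c' l <= d l by rewrite ffunE; case: eqP => // ->.
have [] := IH c' c'd.
  have : \sum_l (d l - c l) = \sum_l ((l == j) + (d l - c' l)).
    apply: eq_bigr => l _; rewrite ffunE; case: eqP => [->|_] //=.
    by rewrite add1n subnSK.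
  rewrite big_split /= sum_delta.
  by rewrite En add1n => -[].
move=> s [Hp Hl Ha]; exists (c' :: s); split=> //=.
  rewrite Hp andbT; apply/existsP; exists j; rewrite eqxx andbT.
  by apply: leq_trans cj _; have := df j; rewrite ffunE.
apply/andP; split; first by apply/andP; split; apply/config_leP.
apply: sub_all Ha => e /andP[/config_leP c'e ->]; rewrite andbT; apply/config_leP => l.
exact: leq_trans (c'e l).
Qed.

(** An open pallet other than [v] belongs to [A]. One of its remaining bins lies behind the bin at
    which [greedy A] stopped in that sequence; the latter is for a pallet outside [A], so the open
    pallet is in the front of [A]. *)
Lemma nopen_between A v d : dsep pallet_arc A <= k ->
  config_le (greedy A) d -> config_le d (greedy (v |: A)) -> nopen d <= places I.
Proof.
move=> dA /config_leP Ad /config_leP dv.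
rewrite -(prednK (places_gt0 pI)) nopenE.
apply: leq_trans (_ : #|v |: front pallet_arc A| <= _); last first.
  by rewrite cardsU1 -[k.+1]add1n leq_add // leq_b1.
apply: subset_leq_card; apply/subsetP=> i; rewrite in_setI.
case/andP=> /openedP[j Hj] /left_overP[l Hl]; rewrite in_setU1.
have [//|iv] := eqVneq i v; rewrite /=.
have iA : i \in A.
  have [i' + /pal_inj E] := greedy_take (mem_take_leq (dv j) Hj).
  by rewrite -E in_setU1 (negPf iv).
have := mem_drop_leq (Ad l) Hl; rewrite ffunE; set P := predC _ => Hd.
have Hh : has P (Q l).
  by rewrite has_find ltnNge; apply/negP => H; rewrite drop_oversize in Hd.
have PN := nth_find 0 Hh; set f := find P (Q l) in Hd PN.
have fs : f < size (Q l) by rewrite -has_find.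
have [u Eu] : exists u, nth 0 (Q l) f = pal u by apply: (queue_pal (j := l)); exact: mem_nth.
have uA : u \notin A.
  by apply: contra PN => uA; rewrite Eu; apply/imageP; exists u.
apply/frontP; split=> //; exists u => //; apply/pallet_arcP; split.
  by apply: contraNneq uA => ->.
exists l; rewrite /before.
(* All bins before position [f] are for members of [A], so [f] is the first occurrence of [u]. *)
have -> : index (pal u) (Q l) = f.
  rewrite -Eu; apply/eqP; rewrite eqn_leq; apply/andP; split.
    by rewrite leqNgt; apply/negP => H; have := before_find 0 H; rewrite /= eqxx.
  by rewrite leqNgt; apply/negP => H; have := before_find 0 H; rewrite nth_index ?PN // mem_nth.
move: Hd; rewrite (drop_nth 0 fs) in_cons Eu => /orP[/eqP /pal_inj E|//].
by rewrite -E iA in uA.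
Qed.

Lemma reach_processing A : reach pallet_arc k A setT -> dsep pallet_arc A <= k ->
  exists s, [/\ path (@transformation I) (greedy A) s, last (greedy A) s = finish I
    & all (fun c => nopen c <= places I) s].
Proof.
move EB: [set: 'I_m] => B R; elim: R EB => {A B} [A <- _|v A B vA dv _ IH EB dA].
  by exists [::]; split=> //=; exact: greedyT.
have [s [Hp Hl Ha]] := IH EB dv.
have H1 : config_le (greedy A) (greedy (v |: A)).
  apply/config_leP=> j; rewrite !ffunE; apply: sub_find => t /=.
  apply: contra => /imageP[i iA ->]; apply/imageP; exists i => //.
  by rewrite in_setU1 iA orbT.
have H2 : config_le (greedy (v |: A)) (finish I).
  by apply/config_leP=> j; rewrite [finish I j]ffunE greedy_size.
have [s' [Hp' Hl' Ha']] := config_le_path H1 H2.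
exists (s' ++ s); rewrite cat_path last_cat Hl' Hp' Hp Hl all_cat Ha andbT; split=> //.
rewrite andbT; apply: sub_all Ha' => e /andP[]; exact: nopen_between.
Qed.

Lemma opened_start : opened (start I) = set0.
Proof. by apply/setP=> i; rewrite !inE; apply/existsP => -[j]; rewrite ffunE take0. Qed.

Lemma stackable_reach : stackable I <-> reach pallet_arc k set0 setT.
Proof.
split=> [[s /andP[Hp /eqP Hl] /= /andP[_ Ha]]|R].
  by have [] := processing_reach Hp Hl Ha; rewrite opened_start.
have [|s [Hp Hl Ha]] := reach_processing R; first by rewrite dsep0.
rewrite greedy0 in Hp Hl; exists s; first by rewrite /processing Hp Hl eqxx.
by rewrite /= Ha nopenE opened_start set0I cards0.
Qed.

End Graph.

(** * Pallets whose addition does not increase the front *)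

Section Candidates.
Variables (m : nat) (arc : rel 'I_m).
Hypothesis arc_irr : irreflexive arc.
Implicit Types (S : {set 'I_m}) (t u v : 'I_m).

Definition inout S t : {set 'I_m} := [set u | (u \notin S) && arc u t].

Lemma frontE S t : (t \in front arc S) = (t \in S) && (0 < #|inout S t|).
Proof.
apply/frontP/andP => -[tS H]; split=> //.
  by case: H => u uS ut; apply/card_gt0P; exists u; rewrite inE uS.
by case/card_gt0P: H => u; rewrite inE => /andP[uS ut]; exists u.
Qed.

Lemma dsepU1_source S v : v \notin S -> #|inout S v| = 0 ->
  dsep arc (v |: S) <= dsep arc S.
Proof.
move=> vS Hv; apply: subset_leq_card; apply/subsetP=> t /frontP[tS [u]].
rewrite in_setU1 negb_or => /andP[_ uS] ut.
apply/frontP; split; last by exists u.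
move: tS; rewrite in_setU1 => /predU1P[E|//].
by move/eqP: Hv; rewrite cards_eq0 => /eqP/setP/(_ u); rewrite !inE uS -E ut.
Qed.

(** [t] leaves the front and at most [v] enters it. *)
Lemma dsepU1_closing S t v : t \in S -> #|inout S t| = 1 -> v \in inout S t ->
  v \notin S /\ dsep arc (v |: S) <= dsep arc S.
Proof.
move=> tS /eqP/cards1P[v' E]; rewrite E inE => /eqP->.
have : v' \in inout S t by rewrite E set11.
rewrite inE => /andP[vS vt]; split=> //.
have tF : t \in front arc S by rewrite frontE tS E cards1.
apply: leq_trans (_ : #|v' |: (front arc S :\ t)| <= _); last first.
  rewrite cardsU1 /dsep [X in _ <= X](cardsD1 t) tF leq_add2r leq_b1 //.
apply: subset_leq_card; apply/subsetP=> x /frontP[xS [u uS ux]].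
move: uS xS; rewrite !in_setU1 negb_or => /andP[uv uS] /predU1P[->|xS].
  by rewrite eqxx.
apply/orP; right; rewrite in_setD1; apply/andP; split; last first.
  by apply/frontP; split=> //; exists u.
apply: contra uv => /eqP Ex; move/setP: E => /(_ u).
by rewrite !inE uS -Ex ux => <-.
Qed.

(** No member of the front loses its last in-neighbour outside, while [v], having an in-neighbour
    outside that differs from it, joins the front. *)
Lemma dsepU1_grows S :
  (forall t, t \in S -> #|inout S t| <> 1) ->
  (forall t, t \notin S -> #|inout S t| <> 0) ->
  forall v, v \notin S -> dsep arc S < dsep arc (v |: S).
Proof.
move=> H1 H0 v vS; rewrite /dsep.
have vF : v \notin front arc S by rewrite frontE (negPf vS).
rewrite -[_.+1]add1n -[1]/(nat_of_bool true) -vF -cardsU1.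
apply: subset_leq_card; apply/subsetP=> t; rewrite in_setU1 => /predU1P[->|].
  apply/frontP; split; first exact: setU11.
  have /eqP := H0 v vS; rewrite -lt0n => /card_gt0P[u]; rewrite inE => /andP[uS uv].
  exists u => //; rewrite in_setU1 negb_or uS andbT.
  by apply: contraTneq uv => ->; rewrite arc_irr.
rewrite frontE => /andP[tS H]; apply/frontP; split; first by rewrite in_setU1 tS orbT.
have : 1 < #|inout S t| by move: H (H1 t tS); case: #|_| => [|[|]].
rewrite (cardsD1 v) => H2.
have : 0 < #|inout S t :\ v| by move: H2; case: (v \in _) => //=; rewrite add0n => /ltnW.
case/card_gt0P=> u; rewrite !inE => /and3P[uv uS ut].
by exists u => //; rewrite in_setU1 negb_or uv.
Qed.

Definition cand_spec S (c : nat) : Prop :=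
  if c is c'.+1 then
    exists v, [/\ v = c' :> nat, v \notin S & dsep arc (v |: S) <= dsep arc S]
  else forall v, v \notin S -> dsep arc S < dsep arc (v |: S).

End Candidates.

(* [Defs.mem] is hidden by the membership predicate of ssrbool up to here. *)
Import Defs.

(** * Structured programs and their compilation *)

Inductive expr : Type :=
| Cst of nat
| Var of nat
| Add of expr & expr
| Sub of expr & expr
| Arr of nat & expr.

Inductive cmd : Type :=
| Skip
| Asg of nat & expr
| Sto of nat & expr & expr
| Rd of nat
| Seq of cmd & cmd
| Ite of expr & cmd & cmd
| While of expr & cmd.

Record store := Store { vr : nat -> nat; ar : nat -> nat -> nat; inp : seq nat }.

Fixpoint eval (s : store) (e : expr) : nat :=
  match e with
  | Cst n => n
  | Var x => vr s x
  | Add a b => eval s a + eval s b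
  | Sub a b => eval s a - eval s b
  | Arr a i => ar s a (eval s i)
  end.

Definition setv (s : store) (x v : nat) : store :=
  Store [eta vr s with x |-> v] (ar s) (inp s).

Definition seta (s : store) (a i v : nat) : store :=
  Store (vr s) (fun b j => if (b == a) && (j == i) then v else ar s b j) (inp s).

Definition getin (s : store) (x : nat) : store :=
  Store [eta vr s with x |-> head 0 (inp s)] (ar s) (behead (inp s)).

(* The numerical index counts assignments, tests and loop iterations; by [sim] each
   unit costs at most [size (ccmd c l)] machine steps. *)
Inductive exec : cmd -> store -> nat -> store -> Prop :=
| ESkip s : exec Skip s 0 s
| EAsg s x e : exec (Asg x e) s 1 (setv s x (eval s e))
| ESto s a i e : exec (Sto a i e) s 1 (seta s a (eval s i) (eval s e))
| ERd s x : exec (Rd x) s 1 (getin s x)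
| ESeq s t s1 t' s2 c1 c2 :
    exec c1 s t s1 -> exec c2 s1 t' s2 -> exec (Seq c1 c2) s (t + t') s2
| EIteT s t s1 e c1 c2 :
    eval s e != 0 -> exec c1 s t s1 -> exec (Ite e c1 c2) s t.+1 s1
| EIteF s t s1 e c1 c2 :
    eval s e = 0 -> exec c2 s t s1 -> exec (Ite e c1 c2) s t.+1 s1
| EWhileT s t s1 t' s2 e c :
    eval s e != 0 -> exec c s t s1 -> exec (While e c) s1 t' s2 ->
    exec (While e c) s (t + t').+1 s2
| EWhileF s e c : eval s e = 0 -> exec (While e c) s 1 s.

(* Registers below [ntmp] hold the variables, those from [ntmp] on the temporaries
   of expression evaluation.  Interleaving the arrays with stride [nreg] lets all
   of them grow without bound. *)
Definition ntmp := 40.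
Definition nreg := 64.

(** The shift [i.+1] puts cell [0] of every array above the registers. *)
Definition addr (a i : nat) : nat := nreg * i.+1 + a.

(* Six doublings multiply by [nreg = 64]. *)
Definition caddr (a d : nat) : seq instr :=
  [:: IConst d.+1 1; IAdd d d d.+1; IAdd d d d; IAdd d d d; IAdd d d d;
      IAdd d d d; IAdd d d d; IAdd d d d; IConst d.+1 a; IAdd d d d.+1].

(** The value is left in register [d], and the registers from [d] on serve as an evaluation stack.
    The machine has no move, so a copy is an addition to zero. *)
Fixpoint cexpr (e : expr) (d : nat) : seq instr :=
  match e with
  | Cst n => [:: IConst d n]
  | Var x => [:: IConst d 0; IAdd d d x]
  | Add a b => cexpr a d ++ cexpr b d.+1 ++ [:: IAdd d d d.+1]
  | Sub a b => cexpr a d ++ cexpr b d.+1 ++ [:: ISub d d d.+1]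
  | Arr a i => cexpr i d ++ caddr a d ++ [:: ILoad d d]
  end.

Fixpoint ccmd (c : cmd) (l : nat) : seq instr :=
  match c with
  | Skip => [::]
  | Asg x e => cexpr e ntmp ++ [:: IConst x 0; IAdd x x ntmp]
  | Sto a i e =>
      cexpr i ntmp ++ caddr a ntmp ++ cexpr e ntmp.+1 ++
      [:: IStore ntmp ntmp.+1]
  | Rd x => [:: IRead x]
  | Seq c1 c2 => let p := ccmd c1 l in p ++ ccmd c2 (l + size p)
  | Ite e c1 c2 =>
      let p := cexpr e ntmp in
      let p1 := ccmd c1 (l + size p).+1 in
      let l2 := (l + size p).+1 + (size p1).+1 in
      let p2 := ccmd c2 l2 in
      p ++ IJzero ntmp l2 :: p1 ++ IJump (l2 + size p2) :: p2
  | While e c1 =>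
      let p := cexpr e ntmp in
      let p1 := ccmd c1 (l + size p).+1 in
      p ++ IJzero ntmp ((l + size p).+1 + (size p1).+1) :: p1 ++ [:: IJump l]
  end.

Fixpoint wfe (e : expr) (d : nat) : bool :=
  match e with
  | Cst _ => d < nreg
  | Var x => (x < ntmp) && (d < nreg)
  | Add a b | Sub a b => wfe a d && wfe b d.+1
  | Arr a i => [&& a < nreg, wfe i d & d.+1 < nreg]
  end.

Fixpoint wfc (c : cmd) : bool :=
  match c with
  | Skip => true
  | Asg x e => (x < ntmp) && wfe e ntmp
  | Sto a i e => [&& a < nreg, wfe i ntmp & wfe e ntmp.+1]
  | Rd x => x < ntmp
  | Seq c1 c2 => wfc c1 && wfc c2
  | Ite e c1 c2 => [&& wfe e ntmp, wfc c1 & wfc c2]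
  | While e c1 => wfe e ntmp && wfc c1
  end.

(** * Simulation of structured programs by the machine *)

Definition istep (i : instr) (s : state) : state :=
  match i with
  | IConst d c => set_mem s d c
  | IAdd d a b => set_mem s d (mem s a + mem s b)
  | ISub d a b => set_mem s d (mem s a - mem s b)
  | ILoad d a => set_mem s d (mem s (mem s a))
  | IStore d a => set_mem s (mem s d) (mem s a)
  | IRead d =>
      State (pc s).+1 [eta mem s with d |-> head 0 (input s)] (behead (input s))
  | IJump l => goto s l
  | IJzero a l => goto s (if mem s a == 0 then l else (pc s).+1)
  | IHalt => s
  end.

Lemma stepE P s : step P s = istep (current P s) s.
Proof. by []. Qed.

Definition straight (i : instr) : bool :=
  match i with IJump _ | IJzero _ _ | IHalt => false | _ => true end.

Definition code_at (P : program) (l : nat) (code : seq instr) : Prop :=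
  forall i, i < size code -> nth IHalt P (l + i) = nth IHalt code i.

Lemma code_at_cat P l a b :
  code_at P l (a ++ b) -> code_at P l a /\ code_at P (l + size a) b.
Proof.
move=> H; split=> i Hi.
  by rewrite H ?nth_cat ?Hi // size_cat ltn_addr.
by rewrite -addnA H ?size_cat ?ltn_add2l // nth_cat ltnNge leq_addr addKn.
Qed.

Lemma code_at_cons P l i b :
  code_at P l (i :: b) -> nth IHalt P l = i /\ code_at P l.+1 b.
Proof.
move=> H; split; first by rewrite -[l]addn0 H.
by move=> j Hj; rewrite addSnnS H.
Qed.

Definition irun (code : seq instr) (s : state) : state :=
  foldl (fun s i => istep i s) s code.

Lemma irun_cat a b s : irun (a ++ b) s = irun b (irun a s).
Proof. by rewrite /irun foldl_cat. Qed.

Lemma iter_straight P code s :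
  all straight code -> code_at P (pc s) code ->
  iter (size code) (step P) s = irun code s /\
  pc (irun code s) = pc s + size code.
Proof.
elim: code s => [|i code IH] s /=; first by rewrite addn0.
case/andP=> Hi Hc /code_at_cons [H1 H2].
have E : step P s = istep i s by rewrite stepE /current H1.
have Epc : pc (istep i s) = (pc s).+1 by case: (i) Hi.
have := IH (istep i s) Hc; rewrite Epc => /(_ H2) [E1 E2].
by rewrite -iterS iterSr E E1 E2 /= addSnnS.
Qed.

Lemma straight_cexpr e d : all straight (cexpr e d).
Proof.
by elim: e d => [n|x|a IHa b IHb|a IHa b IHb|a i IHi] d //=;
   rewrite ?all_cat ?IHa ?IHb ?IHi.
Qed.

Record rep (s : store) (x : state) : Prop := Rep {
  rep_vr : forall y, y < ntmp -> mem x y = vr s y;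
  rep_ar : forall a i, a < nreg -> mem x (addr a i) = ar s a i;
  rep_inp : input x = inp s
}.

Lemma cexpr_Arr a i d :
  cexpr (Arr a i) d = cexpr i d ++ caddr a d ++ [:: ILoad d d].
Proof. by []. Qed.

Lemma irun_caddr a d x x' :
  irun (caddr a d) x = x' ->
  [/\ mem x' d = addr a (mem x d), input x' = input x
    & forall y, y != d -> y != d.+1 -> mem x' y = mem x y].
Proof.
move=> <-; have H1 : (d == d.+1) = false by apply/eqP; lia.
rewrite /caddr /= !(eqxx, H1) /=; split=> //.
  by rewrite /addr /nreg; lia.
by move=> y /negPf N1 /negPf N2; rewrite !(N1, N2).
Qed.

Lemma wfe_ltn e d : wfe e d -> d < nreg.
Proof.
elim: e d => [n|y|a IHa b IHb|a IHa b IHb|a i IHi] d //=.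
- by case/andP.
- by case/andP=> /IHa.
- by case/andP=> /IHa.
- by case/and3P=> _ /IHi.
Qed.

Lemma irun_cexpr s e d x :
  ntmp <= d -> wfe e d -> rep s x ->
  let x' := irun (cexpr e d) x in
  [/\ mem x' d = eval s e, input x' = input x
    & forall y, (y < d) || (nreg <= y) -> mem x' y = mem x y].
Proof.
have keep s' x1 x2 d' : ntmp <= d' -> rep s' x1 -> input x2 = input x1 ->
    (forall y, (y < d') || (nreg <= y) -> mem x2 y = mem x1 y) -> rep s' x2.
  move=> Hd [H1 H2 H3] Hi Hm; split=> [y Hy|a i Ha|].
  - by rewrite Hm ?H1 // (leq_trans Hy Hd).
  - by rewrite Hm ?H2 // /addr; apply/orP; right; rewrite /nreg; lia.
  - by rewrite Hi.
elim: e d x => [n|y|a IHa b IHb|a IHa b IHb|a i IHi] d x Hd.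
- move=> /= Hn _; rewrite eqxx; split=> // y Hy.
  by case: eqP => // E; move: Hy; rewrite E; lia.
- move=> /= /andP[Hy Hn] R; rewrite /= !eqxx; split=> //.
    rewrite (_ : (y == d) = false) ?(rep_vr R) //; apply/eqP; lia.
  move=> z Hz; case: eqP => // E; move: Hz; rewrite E; lia.
- move=> /= /andP[Wa Wb] R.
  have [Ea Ia Ma] := IHa d x Hd Wa R.
  have Ra := keep _ _ _ _ Hd R Ia Ma.
  have [|Eb Ib Mb] := IHb d.+1 _ _ Wb Ra; first exact: leqW.
  rewrite !irun_cat /= eqxx; split.
  + by rewrite Mb ?leqnn ?Ea ?Eb.
  + by rewrite Ib Ia.
  + move=> y Hy; have Wd := wfe_ltn Wb.
    case: eqP => [E|_]; first by move: Hy; rewrite E; lia.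
    by rewrite Mb ?Ma //; lia.
- move=> /= /andP[Wa Wb] R.
  have [Ea Ia Ma] := IHa d x Hd Wa R.
  have Ra := keep _ _ _ _ Hd R Ia Ma.
  have [|Eb Ib Mb] := IHb d.+1 _ _ Wb Ra; first exact: leqW.
  rewrite !irun_cat /= eqxx; split.
  + by rewrite Mb ?leqnn ?Ea ?Eb.
  + by rewrite Ib Ia.
  + move=> y Hy; have Wd := wfe_ltn Wb.
    case: eqP => [E|_]; first by move: Hy; rewrite E; lia.
    by rewrite Mb ?Ma //; lia.
- case/and3P=> Ha Wi Hd1 R.
  rewrite cexpr_Arr.
  have [Ei Ii Mi] := IHi d x Hd Wi R.
  rewrite irun_cat irun_cat.
  have [x2 Ex2] : exists x2, irun (caddr a d) (irun (cexpr i d) x) = x2 by eexists.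
  have [Em Im Mm] := irun_caddr Ex2; rewrite Ex2 {Ex2}.
  rewrite /= eqxx; split.
  + rewrite Em Ei Mm; last 2 first.
    * by apply/eqP; move: Hd1; rewrite /addr /nreg; lia.
    * by apply/eqP; move: Hd1; rewrite /addr /nreg; lia.
    rewrite Mi ?(rep_ar R) // /addr; apply/orP; right; rewrite /nreg; lia.
  + by rewrite Im Ii.
  + move=> y Hy; case: eqP => [E|N]; first by move: Hy; rewrite E; lia.
    rewrite Mm ?Mi //; first exact/eqP.
    apply/eqP=> E; move: Hy; rewrite E; lia.
Qed.

Lemma rep_tmp s x x2 : rep s x -> input x2 = input x ->
  (forall y, (y < ntmp) || (nreg <= y) -> mem x2 y = mem x y) -> rep s x2.
Proof.
move=> [H1 H2 H3] Hi Hm; split=> [y Hy|a i Ha|].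
- by rewrite Hm ?H1 // Hy.
- by rewrite Hm ?H2 // /addr /nreg; apply/orP; right; lia.
- by rewrite Hi.
Qed.

Lemma sim_cexpr P s e x :
  wfe e ntmp -> rep s x -> code_at P (pc x) (cexpr e ntmp) ->
  exists x', [/\ iter (size (cexpr e ntmp)) (step P) x = x', rep s x',
    mem x' ntmp = eval s e & pc x' = pc x + size (cexpr e ntmp)].
Proof.
move=> W R C; have [E Epc] := iter_straight (straight_cexpr e ntmp) C.
have [E1 E2 E3] := irun_cexpr (leqnn _) W R.
exists (irun (cexpr e ntmp) x); split=> //; exact: rep_tmp R E2 E3.
Qed.

Lemma addr_inj a b i j : a < nreg -> b < nreg ->
  (addr a i == addr b j) = (a == b) && (i == j).
Proof.
move=> Ha Hb; apply/eqP/andP=> [|[/eqP-> /eqP->] //]; rewrite /addr => E.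
have /eqP Ei : i = j by move: Ha Hb E; rewrite /nreg; nia.
split=> //; move: E; rewrite (eqP Ei) => /addnI ->; exact: eqxx.
Qed.

(** [K] stays fixed through the induction: each unit of [t] is charged the size of an enclosing
    program, which covers the tests and jumps around a subcommand. The address [l] is generalized
    because jump targets are absolute. *)
Lemma sim P c s t s' : exec c s t s' -> forall l x K,
  wfc c -> size (ccmd c l) <= K -> code_at P l (ccmd c l) -> pc x = l ->
  rep s x ->
  exists u x', [/\ u <= K * t, iter u (step P) x = x', rep s' x'
    & pc x' = l + size (ccmd c l)].
Proof.
elim=> {c s t s'}.
- move=> s l x K _ _ _ Hl R; exists 0, x; split=> //; by rewrite addn0.
- move=> s y e l x K /= /andP[Hy We] HK C Hl R.
  have [C1 C2] := code_at_cat C; subst l.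
  have S1 : all straight (ccmd (Asg y e) 0) by rewrite /= all_cat straight_cexpr.
  have [E Ep] := iter_straight S1 C.
  exists (size (ccmd (Asg y e) 0)), (irun (ccmd (Asg y e) 0) x).
  split=> //; first by rewrite muln1.
  have [E1 E2 E3] := irun_cexpr (leqnn _) We R.
  have [R1 R2 R3] := rep_tmp R E2 E3.
  move: E1; rewrite /= irun_cat; set x1 := irun _ x in R1 R2 R3 * => E1; clearbody x1.
  have Hyt : (ntmp == y) = false by apply/eqP; lia.
  split=> [z Hz|a i Ha|] //=.
    by rewrite eqxx Hyt E1 add0n; case: eqP => // _; rewrite R1.
  rewrite eqxx Hyt; case: eqP => [Ez|_]; last exact: R2.
  by move: Hy Ez; rewrite /addr /nreg /ntmp; lia.
- move=> s a i e l x K /= /and3P[Ha Wi We] HK C Hl R; subst l.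
  have S1 : all straight (ccmd (Sto a i e) 0).
    by rewrite /= all_cat /= all_cat !straight_cexpr.
  have [E Ep] := iter_straight S1 C.
  exists (size (ccmd (Sto a i e) 0)), (irun (ccmd (Sto a i e) 0) x).
  split=> //; first by rewrite muln1.
  have [E1 E2 E3] := irun_cexpr (leqnn _) Wi R.
  have R1 := rep_tmp R E2 E3.
  rewrite /ccmd !irun_cat; move: E1 R1; set x1 := irun _ x => E1 R1; clearbody x1.
  have [x2 Ex2] : exists x2, irun (caddr a ntmp) x1 = x2 by eexists.
  have [F1 F2 F3] := irun_caddr Ex2; rewrite Ex2 {Ex2}.
  have R2 : rep s x2.
    apply: (rep_tmp R1 F2) => y Hy; apply: F3; apply/eqP => Ey; move: Hy;
      by rewrite Ey /ntmp /nreg.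
  have [G1 G2 G3] := irun_cexpr (leqnSn _) We R2.
  move: G1 G2 G3; set x3 := irun _ x2 => G1 G2 G3; clearbody x3.
  have R3 : rep s x3.
    apply: (rep_tmp R2 G2) => y Hy; apply: G3; lia.
  have Ead : mem x3 ntmp = addr a (eval s i) by rewrite G3 ?F1 ?E1 // ltnSn.
  split=> [z Hz|b j Hb|] //=; last exact: (rep_inp R3).
    rewrite Ead; case: eqP => [Ez|_]; last exact: (rep_vr R3).
    by move: Hz Ez; rewrite /addr /nreg /ntmp; lia.
  by rewrite Ead G1 addr_inj //; case: andb => //; exact: (rep_ar R3).
- move=> s y l x K /= Hy HK C Hl R; subst l.
  have [E _] := code_at_cons C.
  exists 1, (istep (IRead y) x); split=> //; try by rewrite ?muln1 ?addn1.
    by rewrite /= stepE /current E.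
  have [R1 R2 R3] := R; split=> [z Hz|a i Ha|] /=; rewrite R3 //.
    by case: eqP => // _; exact: R1.
  case: eqP => [Ez|_]; last exact: R2.
  by move: Hy Ez; rewrite /addr /nreg /ntmp; lia.
- move=> s t s1 t' s2 c1 c2 _ IH1 _ IH2 l x K /= /andP[W1 W2].
  rewrite size_cat => HK /code_at_cat [C1 C2] Hl R.
  have [|u1 [x1 [U1 I1 R1 P1]]] := IH1 l x K W1 _ C1 Hl R; first lia.
  have [|u2 [x2 [U2 I2 R2 P2]]] := IH2 _ x1 K W2 _ C2 P1 R1; first lia.
  exists (u2 + u1), x2; split=> //; first lia.
    by rewrite iterD I1.
  by rewrite P2 addnA.
- move=> s t s1 e c1 c2 He _ IH l x K /= /and3P[We W1 W2].
  rewrite size_cat /= size_cat /= => HK /code_at_cat [C1 C2] Hl R.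
  have [] := code_at_cons C2; rewrite {C2} => J1.
  case/code_at_cat=> C2; case/code_at_cons=> J2 _; subst l.
  have [x0 [I0 R0 M0 P0]] := sim_cexpr We R C1.
  (* The target [0] is a placeholder: the test is nonzero and the machine falls through. *)
  set x1 := istep (IJzero ntmp 0) x0.
  have I1 : step P x0 = x1.
    by rewrite stepE /current P0 J1 /x1 /= /goto M0 (negPf He).
  have P1 : pc x1 = (pc x + size (cexpr e ntmp)).+1 by rewrite /= M0 (negPf He) P0.
  have R1 : rep s x1 by case: R0.
  have [|u2 [x2 [U2 I2 R2 P2]]] := IH _ x1 K W1 _ C2 P1 R1; first lia.
  exists (u2.+2 + size (cexpr e ntmp)), (istep (IJump ((pc x + size (cexpr e ntmp)).+1 + (size (ccmd c1 (pc x + size (cexpr e ntmp)).+1)).+1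
     + size (ccmd c2 ((pc x + size (cexpr e ntmp)).+1 + (size (ccmd c1 (pc x + size (cexpr e ntmp)).+1)).+1)))) x2); split=> //=.
  + by rewrite mulnS; lia.
  + by rewrite iterD I0 -iterS iterSr I1 I2 stepE /current P2 J2.
  + by case: R2.
  + lia.
- move=> s t s1 e c1 c2 He _ IH l x K /= /and3P[We W1 W2].
  rewrite size_cat /= size_cat /= => HK /code_at_cat [C1 C2] Hl R.
  have [] := code_at_cons C2; rewrite {C2} => J1.
  case/code_at_cat=> _; case/code_at_cons=> _ C2; subst l.
  have [x0 [I0 R0 M0 P0]] := sim_cexpr We R C1.
  set l2 := (pc x + size (cexpr e ntmp)).+1 + (size (ccmd c1 (pc x + size (cexpr e ntmp)).+1)).+1 in HK C2 J1 *.
  set x1 := goto x0 l2.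
  have I1 : step P x0 = x1.
    by rewrite stepE /current P0 J1 /x1 /= /goto M0 He.
  have P1 : pc x1 = l2 by [].
  have R1 : rep s x1 by case: R0.
  have C3 : code_at P l2 (ccmd c2 l2) by move: C2; rewrite /l2 -addnS.
  have [|u2 [x2 [U2 I2 R2 P2]]] := IH _ x1 K W2 _ C3 P1 R1; first lia.
  exists (u2.+1 + size (cexpr e ntmp)), x2; split=> //.
  + by rewrite mulnS; lia.
  + by rewrite iterD I0 iterSr I1.
  + by rewrite P2 /l2; lia.
- move=> s t s1 t' s2 e c He _ IH1 _ IH2 l x K W.
  move=> HK C Hl R; have := C; have := HK; have := W; rewrite /= size_cat /= size_cat /=.
  case/andP=> We W1 HK'.
  case/code_at_cat=> C1; case/code_at_cons=> J1; case/code_at_cat=> C2; case/code_at_cons=> J2 _.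
  subst l.
  have [x0 [I0 R0 M0 P0]] := sim_cexpr We R C1.
  set x1 := istep (IJzero ntmp 0) x0.
  have I1 : step P x0 = x1.
    by rewrite stepE /current P0 J1 /x1 /= /goto M0 (negPf He).
  have P1 : pc x1 = (pc x + size (cexpr e ntmp)).+1 by rewrite /= M0 (negPf He) P0.
  have R1 : rep s x1 by case: R0.
  have [|u2 [x2 [U2 I2 R2 P2]]] := IH1 _ x1 K W1 _ C2 P1 R1; first lia.
  set x3 := goto x2 (pc x).
  have I3 : step P x2 = x3 by rewrite stepE /current P2 J2.
  have R3 : rep s1 x3 by case: R2.
  have [u4 [x4 [U4 I4 R4 P4]]] := IH2 _ x3 K W HK C (erefl _) R3.
  exists (u4 + (u2.+2 + size (cexpr e ntmp))), x4; split=> //.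
  + by rewrite mulnS mulnDr; lia.
  + have I5 : iter u2.+2 (step P) x0 = x3 by rewrite iterS iterSr I1 I2.
    by rewrite iterD iterD I0 I5.
  + by rewrite P4 /= size_cat /= size_cat.
- move=> s e c He l x K /= /andP[We W1].
  rewrite size_cat /= size_cat /= => HK.
  case/code_at_cat=> C1; case/code_at_cons=> J1 _ Hl R; subst l.
  have [x0 [I0 R0 M0 P0]] := sim_cexpr We R C1.
  eexists (size (cexpr e ntmp)).+1, _; split.
  + by rewrite muln1; lia.
  + by [].
  + by rewrite iterS I0 stepE /current P0 J1 /=; case: R0.
  + rewrite iterS I0 stepE /current P0 J1 /= M0 He /=; lia.
Qed.

Lemma halted_iter P x n : halted P x -> iter n (step P) x = x.
Proof.
move=> H; elim: n => //= n ->; rewrite stepE.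
by move: H; rewrite /halted; case: current.
Qed.

Lemma halts_within_leq P x t t' o :
  t <= t' -> halts_within P x t o -> halts_within P x t' o.
Proof. by move=> /subnK <- [H E]; split; rewrite iterD halted_iter. Qed.

Definition store0 (x : seq nat) : store := Store (fun=> 0) (fun _ _ => 0) x.

(** The machine halts by running past the last instruction. *)
Lemma compile_correct c x t s :
  wfc c -> exec c (store0 x) t s ->
  halts_within (ccmd c 0) x (size (ccmd c 0) * t) (vr s 0).
Proof.
move=> W E.
have R : rep (store0 x) (initial x) by [].
have C : code_at (ccmd c 0) 0 (ccmd c 0) by [].
have [u [x' [U I [R1 _ _] P]]] := sim E W (leqnn _) C (erefl (pc (initial x))) R.
apply: (halts_within_leq U); split; last by rewrite I R1.
by rewrite /halted /current I P nth_default.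
Qed.

(** * Program logic with running times *)

Definition run (c : cmd) (s : store) (n : nat) (Q : store -> Prop) : Prop :=
  exists t s', [/\ exec c s t s', t <= n & Q s'].

(** Syntactic footprints are computed as booleans, so that for concrete commands a frame condition
    is settled by evaluation. *)
Fixpoint modv (c : cmd) (x : nat) : bool :=
  match c with
  | Asg y _ | Rd y => y == x
  | Seq a b | Ite _ a b => modv a x || modv b x
  | While _ a => modv a x
  | _ => false
  end.

Fixpoint moda (c : cmd) (x : nat) : bool :=
  match c with
  | Sto y _ _ => y == x
  | Seq a b | Ite _ a b => moda a x || moda b x
  | While _ a => moda a x
  | _ => false
  end.

Fixpoint reads (c : cmd) : bool :=
  match c with
  | Rd _ => true
  | Seq a b | Ite _ a b => reads a || reads b
  | While _ a => reads a
  | _ => false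
  end.

Record frame (c : cmd) (s s' : store) : Prop := Frame {
  fr_v : forall x, modv c x = false -> vr s' x = vr s x;
  fr_a : forall a i, moda c a = false -> ar s' a i = ar s a i;
  fr_i : reads c = false -> inp s' = inp s
}.

Lemma frame_trans c s1 s2 s3 : frame c s1 s2 -> frame c s2 s3 -> frame c s1 s3.
Proof.
move=> [v1 a1 i1] [v2 a2 i2]; split=> [x H|a i H|H].
- by rewrite v2 ?v1.
- by rewrite a2 ?a1.
- by rewrite i2 ?i1.
Qed.

Lemma frame_sub c c' s s' :
  (forall x, modv c' x = false -> modv c x = false) ->
  (forall x, moda c' x = false -> moda c x = false) ->
  (reads c' = false -> reads c = false) -> frame c s s' -> frame c' s s'.
Proof.
move=> Hv Ha Hi [v a i]; split=> [x /Hv|x j /Ha|/Hi]; by [exact: v|exact: a|exact: i].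
Qed.

Lemma exec_frame c s t s' : exec c s t s' -> frame c s s'.
Proof.
have orl a b : a || b = false -> a = false by case: a.
have orr a b : a || b = false -> b = false by case: a.
elim=> {c s t s'} //=.
- by move=> s x e; split=> //= y; rewrite eq_sym => ->.
- by move=> s a i e; split=> //= b j; rewrite eq_sym => ->.
- by move=> s x; split=> //= y; rewrite eq_sym => ->.
- move=> s t s1 t' s2 c1 c2 _ IH1 _ IH2.
  by apply: (@frame_trans _ _ s1); [apply: frame_sub IH1|apply: frame_sub IH2];
    move=> /= *; first [apply: orl; eassumption|apply: orr; eassumption].
- move=> s t s1 e c1 c2 _ _ IH; apply: frame_sub IH;
    by move=> /= *; first [apply: orl; eassumption|apply: orr; eassumption].
- move=> s t s1 e c1 c2 _ _ IH; apply: frame_sub IH;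
    by move=> /= *; first [apply: orl; eassumption|apply: orr; eassumption].
- by move=> s t s1 t' s2 e c _ _ IH1 _ IH2; apply: (frame_trans _ IH2); case: IH1.
Qed.

Lemma run_le c s n n' Q : run c s n Q -> n <= n' -> run c s n' Q.
Proof. by move=> [t [s' [E H q]]] nn; exists t, s'; split=> //; exact: leq_trans nn. Qed.

Lemma run_conseq c s n (Q Q' : store -> Prop) :
  run c s n Q -> (forall s', frame c s s' -> Q s' -> Q' s') -> run c s n Q'.
Proof.
move=> [t [s' [E H q]]] HQ; exists t, s'; split=> //.
exact: HQ (exec_frame E) q.
Qed.

Lemma run_skip s (Q : store -> Prop) : Q s -> run Skip s 0 Q.
Proof. by move=> q; exists 0, s; split=> //; constructor. Qed.

Lemma run_asg s x e (Q : store -> Prop) : Q (setv s x (eval s e)) -> run (Asg x e) s 1 Q.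
Proof. by move=> q; eexists 1, _; split; [constructor| |exact: q]. Qed.

Lemma run_sto s a i e (Q : store -> Prop) :
  Q (seta s a (eval s i) (eval s e)) -> run (Sto a i e) s 1 Q.
Proof. by move=> q; eexists 1, _; split; [constructor| |exact: q]. Qed.

Lemma run_rd s x (Q : store -> Prop) : Q (getin s x) -> run (Rd x) s 1 Q.
Proof. by move=> q; eexists 1, _; split; [constructor| |exact: q]. Qed.

Lemma run_seq c1 c2 s n1 n2 Q :
  run c1 s n1 (fun s1 => run c2 s1 n2 Q) -> run (Seq c1 c2) s (n1 + n2) Q.
Proof.
move=> [t1 [s1 [E1 H1 [t2 [s2 [E2 H2 q]]]]]]; exists (t1 + t2), s2; split=> //.
  exact: ESeq E1 E2.
exact: leq_add.
Qed.

Lemma run_ite e c1 c2 s n1 n2 Q :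
  (eval s e != 0 -> run c1 s n1 Q) -> (eval s e = 0 -> run c2 s n2 Q) ->
  run (Ite e c1 c2) s (n1 + n2).+1 Q.
Proof.
move=> H1 H2; have [He|He] := eqVneq (eval s e) 0.
  have [t [s' [E H q]]] := H2 He; exists t.+1, s'; split=> //; first exact: EIteF.
  by rewrite ltnS (leq_trans H) // leq_addl.
have [t [s' [E H q]]] := H1 He; exists t.+1, s'; split=> //; first exact: EIteT.
by rewrite ltnS (leq_trans H) // leq_addr.
Qed.

(** The index of [Inv] is a budget for all that remains: an iteration of cost [b] leaves [n'] with
    [b + n' < n]. The strict inequality pays for the test of the iteration, the final successor for
    the last test. *)
Lemma run_while e body (Inv : nat -> store -> Prop) (Q : store -> Prop) s n :
  (forall n s, Inv n s -> eval s e != 0 ->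
     exists b, run body s b (fun s' => exists2 n', Inv n' s' & b + n' < n)) ->
  (forall n s, Inv n s -> eval s e = 0 -> Q s) ->
  Inv n s -> run (While e body) s n.+1 Q.
Proof.
move=> step stop; elim: {n}_.+1 {-2}n (ltnSn n) s => // N IH n nN s I.
have [He|He] := eqVneq (eval s e) 0.
  exists 1, s; split=> //; [exact: EWhileF | exact: stop I He].
have [b [t [s1 [E Hb [n' I' lt]]]]] := step _ _ I He.
have [|t' [s' [E' H' q]]] := IH n' _ s1 I'; first lia.
exists (t + t').+1, s'; split=> //; first exact: EWhileT E E'.
by clear -lt Hb H'; lia.
Qed.

(** * Counting loops *)

Definition For (x l : nat) (body : cmd) : cmd :=
  Seq (Asg x (Cst 0))
    (While (Sub (Var l) (Var x)) (Seq body (Asg x (Add (Var x) (Cst 1))))).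

(** The increment follows the body, hence [Inv i.+1] is asked of the store with the counter
    advanced. The cost may depend on [i], so that lengths of sequences can be summed. *)
Lemma run_for x l body s n (b : nat -> nat) (Inv : nat -> store -> Prop) Q :
  vr s l = n -> modv body x = false -> modv body l = false -> x != l ->
  Inv 0 (setv s x 0) ->
  (forall i s1, i < n -> frame (For x l body) s s1 -> vr s1 x = i -> Inv i s1 ->
     run body s1 (b i) (fun s2 => Inv i.+1 (setv s2 x i.+1))) ->
  (forall s1, frame (For x l body) s s1 -> Inv n s1 -> Q s1) ->
  run (For x l body) s (\sum_(i < n) (b i + 2) + 2) Q.
Proof.
move=> Hn xb lb xl I0 Hb HQ; rewrite addnC.
apply: (@run_seq _ _ _ 1 (\sum_(i < n) (b i + 2)).+1); apply: run_asg => /=.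
pose c := For x l body.
(* The budget is the exact cost of the iterations still to come. *)
pose J f s1 := exists i, [/\ i <= n, f = \sum_(i <= j < n) (b j + 2),
  frame c s s1, vr s1 x = i & Inv i s1].
have cl : modv c l = false by rewrite /= (negPf xl) lb.
apply: (@run_while _ _ J).
- move=> f s1 [i [i_n -> fr xi Ii]] /=; rewrite (fr_v fr cl) Hn xi -lt0n subn_gt0 => lt.
  have fr' := Hb _ _ lt fr xi Ii.
  exists (b i + 1); apply: run_seq; apply: run_conseq fr' _ => s2 fr2 I2.
  apply: run_asg; rewrite /= (fr_v fr2 xb) xi addn1.
  exists (\sum_(i.+1 <= j < n) (b j + 2)); last by rewrite (big_ltn lt); lia.
  exists i.+1; split=> //=; last by rewrite eqxx.
  apply: (frame_trans fr); split=> [y /=|a j /=|/=].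
  + by case E: (x == y) => //=; rewrite orbF eq_sym E => H; rewrite (fr_v fr2).
  + by rewrite orbF => H; rewrite (fr_a fr2).
  + by rewrite orbF => H; rewrite (fr_i fr2).
- move=> f s1 [i [i_n _ fr xi Ii]] /=; rewrite (fr_v fr cl) Hn xi => /eqP.
  rewrite subn_eq0 => ni; have Ei : i = n by apply/eqP; rewrite eqn_leq i_n.
  by rewrite Ei in Ii; exact: HQ fr Ii.
- exists 0; split=> //=; last by rewrite eqxx.
  + by rewrite big_mkord.
  + by split=> //= y; rewrite eq_sym; case: eqP.
Qed.

Lemma run_forc x l body s n b (Inv : nat -> store -> Prop) Q :
  vr s l = n -> modv body x = false -> modv body l = false -> x != l ->
  Inv 0 (setv s x 0) ->
  (forall i s1, i < n -> frame (For x l body) s s1 -> vr s1 x = i -> Inv i s1 ->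
     run body s1 b (fun s2 => Inv i.+1 (setv s2 x i.+1))) ->
  (forall s1, frame (For x l body) s s1 -> Inv n s1 -> Q s1) ->
  run (For x l body) s (n * (b + 2) + 2) Q.
Proof.
move=> H1 H2 H3 H4 H5 H6 H7; apply: run_le (run_for (b := fun=> b) H1 H2 H3 H4 H5 H6 H7) _.
by rewrite sum_nat_const card_ord.
Qed.

(** * The search as a program *)

(* Names of variables ([v]) and arrays ([a]) are notations for numerals so that
   [simpl] evaluates accesses to an updated store. *)
Notation vRes := 0 (only parsing).
Notation vK := 1 (only parsing).
Notation vM := 2 (only parsing).
Notation vNQ := 3 (only parsing).
Notation vG := 4 (only parsing).
Notation vRun := 5 (only parsing).
Notation vOff := 6 (only parsing).
Notation vV := 7 (only parsing).
Notation vD := 8 (only parsing).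
Notation vCand := 9 (only parsing).
Notation vC := 10 (only parsing).
Notation vCh := 11 (only parsing).
Notation vT := 12 (only parsing).
Notation vU := 13 (only parsing).
Notation vUm := 14 (only parsing).
Notation vCnt := 15 (only parsing).
Notation vLst := 16 (only parsing).
Notation vX := 17 (only parsing).
Notation vY := 18 (only parsing).
Notation vRow := 19 (only parsing).
Notation vXr := 20 (only parsing).
Notation vSuc := 21 (only parsing).
Notation vBs := 22 (only parsing).
Notation vBr := 23 (only parsing).
Notation vW := 24 (only parsing).
Notation vPos := 25 (only parsing).
Notation vLen := 26 (only parsing).
Notation vI := 27 (only parsing).
Notation vJ := 28 (only parsing).
Notation aArc := 0 (only parsing).
Notation aQ := 1 (only parsing).
Notation aOff := 2 (only parsing).
Notation aV := 3 (only parsing).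
Notation aMx := 4 (only parsing).
Notation aId := 5 (only parsing).
Notation aB := 6 (only parsing).
Notation aLen := 7 (only parsing).
Notation aFst := 8 (only parsing).
Notation aLast := 9 (only parsing).

Declare Scope cmd_scope.
Delimit Scope cmd_scope with cmd.
Notation "x ::= e" := (Asg x e) (at level 70, no associativity) : cmd_scope.
Notation "c1 ;; c2" := (Seq c1 c2) (at level 90, right associativity) : cmd_scope.

Ltac cstep :=
  lazymatch goal with
  | |- run (Seq _ _) _ _ _ => eapply run_seq
  | |- run (Asg _ _) _ _ _ => eapply run_asg; simpl
  | |- run (Sto _ _ _) _ _ _ => eapply run_sto; simpl
  | |- run (Rd _) _ _ _ => eapply run_rd; simpl
  | |- run Skip _ _ _ => eapply run_skip
  end.

(** Multiplication by [m] as repeated addition; its linear cost is dominated by that of [scan]. *)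
Definition mult (dst src : nat) : cmd :=
  (dst ::= Cst 0 ;; For vT vM (dst ::= Add (Var dst) (Var src)))%cmd.

Lemma run_mult dst src s m :
  vr s vM = m -> dst != vM -> dst != vT -> src != dst -> src != vT ->
  run (mult dst src) s (3 * m + 3) (fun s' => vr s' dst = m * vr s src).
Proof.
move=> Hm n1 n2 n3 n4; eapply run_le.
  eapply run_seq; apply: run_asg.
  apply: (run_forc (n := m) (b := 1) (Inv := fun i s' => vr s' dst = i * vr s src)) => //=.
  - by rewrite eq_sym (negPf n1).
  - by rewrite (negPf n2).
  - by rewrite (negPf n1).
  - by rewrite (negPf n2) eqxx.
  - move=> i s1 im fr xi E; apply: run_asg => /=.
    rewrite (negPf n2) eqxx E (fr_v fr) /=; last first.
      by rewrite eq_sym (negPf n4) eq_sym (negPf n3).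
    by rewrite (negPf n3) mulSn addnC.
by clear; lia.
Qed.

(* For the set [S] stored from cell [b] on, [scan] puts [dsep S] in [vD], and in
   [vCand] either [0] or one more than a pallet outside [S] whose addition does not
   increase [dsep].  Such a pallet has no in-neighbour outside [S], or is the only
   one of a member of [S]; hence a single pass over the arcs finds it, as the
   budget of a leaf requires. *)
Definition scan_in (b : nat) : cmd :=
  (Ite (Arr aArc (Var vUm))
     (Ite (Arr aQ (Add (Var b) (Var vU))) Skip
        (vCnt ::= Add (Var vCnt) (Cst 1) ;; vLst ::= Add (Var vU) (Cst 1)))
     Skip ;;
   vUm ::= Add (Var vUm) (Var vM))%cmd.

Definition scan_out (b : nat) : cmd :=
  (vCnt ::= Cst 0 ;; vLst ::= Cst 0 ;; vUm ::= Var vT ;;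
   For vU vM (scan_in b) ;;
   Ite (Arr aQ (Add (Var b) (Var vT)))
     (Ite (Var vCnt)
        (vD ::= Add (Var vD) (Cst 1) ;;
         Ite (Sub (Var vCnt) (Cst 1)) Skip (vCand ::= Var vLst))
        Skip)
     (Ite (Var vCnt) Skip (vCand ::= Add (Var vT) (Cst 1))))%cmd.

Definition scan (b : nat) : cmd :=
  (vD ::= Cst 0 ;; vCand ::= Cst 0 ;; For vT vM (scan_out b))%cmd.

Section Scan.
Variables (m : nat) (arc : rel 'I_m).
Hypothesis arc_irr : irreflexive arc.

Definition arc_ok (s : store) : Prop :=
  vr s vM = m /\
  forall u t : 'I_m, (ar s aArc (u * m + t) != 0) = arc u t.

Definition row_ok (s : store) (a o : nat) (S : {set 'I_m}) : Prop :=
  forall t : 'I_m, (ar s a (o + t) != 0) = (t \in S).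

Lemma card_prefixS (p : pred 'I_m) (i : nat) (im : i < m) :
  #|[set t | p t & (t : 'I_m) < i.+1]| =
  p (Ordinal im) + #|[set t | p t & (t : 'I_m) < i]|.
Proof.
rewrite [LHS](cardsD1 (Ordinal im)) inE ltnSn andbT; congr (_ + _).
apply: eq_card => t; rewrite !inE ltnS [X in _ = _ && X]ltn_neqAle -val_eqE /=.
by rewrite andbCA.
Qed.

Lemma card_prefix0 (p : pred 'I_m) : #|[set t | p t & (t : 'I_m) < 0]| = 0.
Proof. by apply: eq_card0 => t; rewrite !inE ltn0 andbF. Qed.

Lemma run_scan b s S :
  arc_ok s -> row_ok s aQ (vr s b) S -> b = vOff \/ b = vC ->
  run (scan b) s (20 * m ^ 2 + 20 * m + 4)
    (fun s' => vr s' vD = dsep arc S /\ cand_spec arc S (vr s' vCand)).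
Proof.
move=> [Hm Harc] Hrow Hb; eapply run_le.
  rewrite /scan; do 2! (cstep; cstep).
  pose F i := [set t | t \in front arc S & (t : 'I_m) < i].
  (* While no candidate is recorded, no pallet below [i] has provided one; a recorded candidate
     stays or is overwritten by another valid one. *)
  pose Inv i s' := vr s' vD = #|F i| /\
    if vr s' vCand is c.+1 then cand_spec arc S c.+1
    else forall t : 'I_m, t < i -> (t \in S -> #|inout arc S t| <> 1) /\
           (t \notin S -> #|inout arc S t| <> 0).
  eapply (run_forc (n := m) (Inv := Inv)) => //=.
  - by split=> //; rewrite /F card_prefix0.
  - move=> i s1 im fr xi [Ed Ec]; pose t := Ordinal im.
    rewrite /scan_out; do 3! (cstep; cstep); cstep.
    pose N j := [set u | u \in inout arc S t & (u : 'I_m) < j].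
    pose Inv' j s' := [/\ vr s' vUm = j * m + i, vr s' vCnt = #|N j|
      & vr s' vCnt != 0 -> exists2 u, u \in N j & vr s' vLst = u.+1].
    have Hm1 : vr s1 vM = m by rewrite (fr_v fr).
    have Hb1 : vr s1 b = vr s b.
      by case: Hb => ->; rewrite (fr_v fr).
    eapply (run_forc (n := m) (Inv := Inv')) => //=.
    + by split=> //=; rewrite /N card_prefix0.
    + move=> j s2 jm fr2 xj [Eum Ecnt Elst]; pose u := Ordinal jm.
      have Hm2 : vr s2 vM = m by rewrite (fr_v fr2).
      have HA : (eval s2 (Arr aArc (Var vUm)) != 0) = arc u t.
        by rewrite /= Eum (fr_a fr2) //= (fr_a fr) //= (Harc u t).
      have Hb2 : vr s2 b = vr s b.
        by rewrite -Hb1; case: Hb => ->; rewrite (fr_v fr2).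
      have HS : (eval s2 (Arr aQ (Add (Var b) (Var vU))) != 0) = (u \in S).
        by rewrite /= xj Hb2 (fr_a fr2) //= (fr_a fr) //= (Hrow u).
      have EN : #|N j.+1| = (u \in inout arc S t) + #|N j| by exact: card_prefixS.
      have sub x : x \in N j -> x \in N j.+1.
        by rewrite !inE => /andP[-> /leqW ->].
      rewrite inE in EN; rewrite /scan_in; cstep; apply: run_ite => [|/eqP] HAt; last first.
        rewrite (_ : arc u t = false) ?andbF in EN; last by rewrite -HA HAt.
        do 2 cstep; split=> /=; first by rewrite Eum Hm2; clear; lia.
          by rewrite EN Ecnt.
        by move=> /Elst[x /sub xN ->]; exists x.
      rewrite -HA HAt andbT in EN; apply: run_ite => [|/eqP] HSt.
        rewrite (_ : u \notin S = false) in EN; last by rewrite -HS HSt.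
        do 2 cstep; split=> /=; first by rewrite Eum Hm2; clear; lia.
          by rewrite EN Ecnt.
        by move=> /Elst[x /sub xN ->]; exists x.
      rewrite -HS HSt in EN.
      do 2 cstep; do 2 cstep; split=> /=; first by rewrite Eum Hm2; clear; lia.
        by rewrite EN Ecnt addnC.
      move=> _; exists u; last by rewrite xj addn1.
      by rewrite !inE -HA HAt -HS HSt /=.
    + move=> s2 fr2 [_ Ecnt Elst].
      have EN : N m = inout arc S t by apply/setP=> u; rewrite inE ltn_ord andbT.
      rewrite EN in Ecnt Elst.
      have EF : #|F i.+1| = (t \in front arc S) + #|F i| by exact: card_prefixS.
      have HS : (eval s2 (Arr aQ (Add (Var b) (Var vT))) != 0) = (t \in S).
        have Hb2 : vr s2 b = vr s b.
          by rewrite -Hb1; case: Hb => ->; rewrite (fr_v fr2).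
        by rewrite /= (fr_v fr2 (x := vT)) //= xi Hb2 (fr_a fr2) //= (fr_a fr) //= (Hrow t).
      have Ed2 : vr s2 vD = vr s1 vD by rewrite (fr_v fr2).
      have Ec2 : vr s2 vCand = vr s1 vCand by rewrite (fr_v fr2).
      have Et2 : vr s2 vT = i by rewrite (fr_v fr2).
      have ext c : (if c is c'.+1 then cand_spec arc S c'.+1
            else forall t : 'I_m, t < i -> (t \in S -> #|inout arc S t| <> 1) /\
                   (t \notin S -> #|inout arc S t| <> 0)) ->
          (t \in S -> #|inout arc S t| <> 1) -> (t \notin S -> #|inout arc S t| <> 0) ->
          if c is c'.+1 then cand_spec arc S c'.+1
          else forall t : 'I_m, t < i.+1 -> (t \in S -> #|inout arc S t| <> 1) /\
                   (t \notin S -> #|inout arc S t| <> 0).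
        case: c => // H H1 H0 x; rewrite ltnS leq_eqVlt => /orP[/eqP E|]; last exact: H.
        by have -> : x = t by exact: val_inj.
      rewrite frontE -HS in EF.
      apply: run_ite => [|/eqP] HSt; [rewrite HSt in EF HS|rewrite HSt /= in EF HS].
        apply: run_ite => /= [|] Hc.
          have EF1 : #|F i.+1| = #|F i| + 1 by rewrite EF -Ecnt lt0n Hc addnC.
          do 2 cstep.
          apply: run_ite => /= H1.
            cstep; split=> /=; first by rewrite Ed2 Ed EF1.
            rewrite Ec2; apply: ext => //; last by rewrite -HS.
            by move=> _; rewrite -Ecnt => E; rewrite E in H1.
          cstep; split=> /=; first by rewrite Ed2 Ed EF1.
          have [u uN Eu] := Elst Hc; rewrite Eu; exists u.
          have N1 : #|inout arc S t| = 1 by rewrite -Ecnt; move: Hc H1; clear; lia.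
          by have [] := dsepU1_closing (esym HS) N1 uN.
        cstep; split=> /=; first by rewrite Ed2 Ed EF -Ecnt Hc.
        rewrite Ec2; apply: ext => //; first by rewrite -Ecnt Hc.
        by rewrite -HS.
      apply: run_ite => /= Hc.
        cstep; split=> /=; first by rewrite Ed2 Ed EF.
        rewrite Ec2; apply: ext => //; first by rewrite -HS.
        by rewrite -Ecnt => _ E; rewrite E in Hc.
      cstep; split=> /=; first by rewrite Ed2 Ed EF.
      rewrite Et2 addn1; exists t; split=> //; first by rewrite -HS.
      by apply: dsepU1_source; rewrite -?HS // -Ecnt.
  - move=> s1 fr [Ed Ec]; split.
      by rewrite Ed; apply: eq_card => t; rewrite inE ltn_ord andbT.
    case: (vr s1 vCand) Ec => // H; apply: dsepU1_grows => // t tS.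
      by have [/(_ tS)] := H t (ltn_ord t).
    by have [_ /(_ tS)] := H t (ltn_ord t).
by clear; nia.
Qed.
End Scan.

(** * Rows of cells: merging, transitive closure, smallest row *)

Lemma run_iteb e (b : bool) c1 c2 s n1 n2 Q :
  (eval s e != 0) = b -> (b -> run c1 s n1 Q) -> (~~ b -> run c2 s n2 Q) ->
  run (Ite e c1 c2) s (n1 + n2).+1 Q.
Proof.
move=> <- H1 H2; apply: run_ite => // E; apply: H2; by rewrite E.
Qed.

(** The loop rewrites the cells from [base] to [base + m] in order; at iteration [i] those from
    [base + i] on still have their initial values, so [P] can refer to these. *)
Lemma run_row a base body s m b (P : nat -> nat -> Prop) :
  vr s vM = m -> modv body vT = false -> modv body vM = false ->
  (forall i s1, i < m -> frame (For vT vM body) s s1 -> vr s1 vT = i ->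
     (forall z, (z < base) || (base + i <= z) -> ar s1 a z = ar s a z) ->
     run body s1 b (fun s2 => P i (ar s2 a (base + i)) /\
       forall z, z != base + i -> ar s2 a z = ar s1 a z)) ->
  run (For vT vM body) s (m * (b + 2) + 2) (fun s' =>
    (forall i, i < m -> P i (ar s' a (base + i))) /\
    forall z, (z < base) || (base + m <= z) -> ar s' a z = ar s a z).
Proof.
move=> Hm bT bM Hb.
pose Inv i s' := (forall j, j < i -> P j (ar s' a (base + j))) /\
    forall z, (z < base) || (base + i <= z) -> ar s' a z = ar s a z.
apply: (run_forc (Inv := Inv)) => //.
move=> i s1 im fr xi [I1 I2]; apply: run_conseq (Hb _ _ im fr xi I2) _ => s2 _ [P2 E2].
split=> [j|z Hz] /=.
  rewrite ltnS leq_eqVlt => /orP[/eqP-> //|ji].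
  by rewrite E2 ?eqn_add2l ?ltn_eqF //; exact: I1.
by rewrite E2 ?I2 //; lia.
Qed.

(** With truncated subtraction, [1 - ((t - v) + (v - t))] is nonzero exactly when [t = v]; this adds
    the pallet of the child itself. [vCh] records whether anything was added. *)
Definition merge : cmd :=
  (vCh ::= Cst 0 ;;
   For vT vM
     (Ite (Arr aQ (Add (Var vC) (Var vT))) Skip
       (Ite (Add (Arr aQ (Add (Var vOff) (Var vT)))
               (Sub (Cst 1) (Add (Sub (Var vT) (Var vV)) (Sub (Var vV) (Var vT)))))
          (Sto aQ (Add (Var vC) (Var vT)) (Cst 1) ;; vCh ::= Cst 1)
          Skip)))%cmd.

Definition load_row : cmd :=
  For vT vM
    (Ite (Var vSuc)
       (Sto aMx (Add (Var vRow) (Var vT)) (Arr aQ (Add (Var vC) (Var vT))))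
       (Sto aMx (Add (Var vRow) (Var vT)) (Cst 0))).

Definition or_row : cmd :=
  For vT vM
    (Ite (Arr aMx (Add (Var vXr) (Var vT)))
       (Sto aMx (Add (Var vRow) (Var vT)) (Cst 1)) Skip).

Definition save_row : cmd :=
  For vT vM
    (Sto aQ (Add (Var vOff) (Var vT)) (Arr aMx (Add (Var vBr) (Var vT)))).

Definition warshall : cmd :=
  (vXr ::= Cst 0 ;;
   For vX vM
     (vRow ::= Cst 0 ;;
      For vY vM
        (Ite (Arr aMx (Add (Var vRow) (Var vX))) or_row Skip ;;
         vRow ::= Add (Var vRow) (Var vM)) ;;
      vXr ::= Add (Var vXr) (Var vM)))%cmd.

Definition best_row : cmd :=
  (vBs ::= Add (Var vM) (Cst 1) ;; vBr ::= Cst 0 ;; vRow ::= Cst 0 ;;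
   For vX vM
     (vCnt ::= Cst 0 ;;
      For vT vM
        (Ite (Arr aMx (Add (Var vRow) (Var vT)))
           (vCnt ::= Add (Var vCnt) (Cst 1)) Skip) ;;
      Ite (Var vCnt)
        (Ite (Sub (Var vBs) (Var vCnt)) (vBs ::= Var vCnt ;; vBr ::= Var vRow) Skip)
        Skip ;;
      vRow ::= Add (Var vRow) (Var vM)))%cmd.

Section Rows.
Variable m : nat.
Implicit Types (A B S : {set 'I_m}) (W : 'I_m -> {set 'I_m}) (u x y t : 'I_m).

Lemma run_merge s (a : 'I_m) S Sc :
  vr s vM = m -> vr s vV = a -> vr s vOff + m <= vr s vC ->
  row_ok s aQ (vr s vOff) S -> row_ok s aQ (vr s vC) Sc ->
  run merge s (8 * m + 8) (fun s' =>
    [/\ row_ok s' aQ (vr s vC) (Sc :|: (a |: S)),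
        (vr s' vCh == 0) = (Sc :|: (a |: S) == Sc)
      & forall z, (z < vr s vC) || (vr s vC + m <= z) -> ar s' aQ z = ar s aQ z]).
Proof.
move=> Hm Hv Hoc HS HSc; eapply run_le.
  rewrite /merge; do 2 cstep.
  pose Inv i s' := [/\ forall t : 'I_m, (ar s' aQ (vr s vC + t) != 0) =
        (t \in Sc) || (t < i) && (t \in a |: S),
      (vr s' vCh == 0) = [forall t : 'I_m, (t < i) && (t \in a |: S) ==> (t \in Sc)]
    & forall z, (z < vr s vC) || (vr s vC + m <= z) -> ar s' aQ z = ar s aQ z].
  eapply (run_forc (n := m) (Inv := Inv)) => //=.
  - split=> /= [t| |//]; first by rewrite HSc orbF.
    by apply/esym/forallP => t.
  - move=> i s1 im fr xi [I1 I2 I3]; pose t := Ordinal im.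
    have EC : vr s1 vC = vr s vC by rewrite (fr_v fr).
    have EO : vr s1 vOff = vr s vOff by rewrite (fr_v fr).
    have EV : vr s1 vV = a by rewrite (fr_v fr).
    have tS (x : 'I_m) : (x < i.+1) && (x \in a |: S) =
        (x < i) && (x \in a |: S) || (x == t) && (t \in a |: S).
      rewrite ltnS leq_eqVlt -[x == t]val_eqE /=; case: eqP => /= [E|_]; last by rewrite orbF.
      have -> : x = t by exact: val_inj.
      by rewrite /= ltnn.
    have E1 : (eval s1 (Arr aQ (Add (Var vC) (Var vT))) != 0) = (t \in Sc).
      by rewrite /= EC xi (I1 t) ltnn orbF.
    have keep : (t \in a |: S -> t \in Sc) -> Inv i.+1 (setv s1 vT i.+1).
      move=> Ht; split=> /= [x| |]; last exact: I3.
        rewrite I1 tS; case: (eqVneq x t) => [->|_]; last by rewrite orbF.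
        by case: (t \in a |: S) Ht => [->|]; rewrite ?orbF // ?orbT.
      rewrite I2; apply: eq_forallb => x; rewrite tS.
      case: (eqVneq x t) => [->|_]; last by rewrite orbF.
      by rewrite /= ltnn /=; case: (t \in a |: S) Ht => [->|].
    apply: (run_iteb E1) => HtSc; first by cstep; apply: keep.
    have E2 : (eval s1 (Add (Arr aQ (Add (Var vOff) (Var vT)))
          (Sub (Cst 1) (Add (Sub (Var vT) (Var vV)) (Sub (Var vV) (Var vT))))) != 0)
        = (t \in a |: S).
      rewrite /= EO xi EV addn_eq0 negb_and I3; last first.
        by apply/orP; left; move: Hoc (im); clear; lia.
      rewrite (HS t) in_setU1 orbC; congr orb.
      by rewrite -val_eqE /=; clear; lia.
    apply: (run_iteb E2) => Ht; last first.
      by cstep; apply: keep => H; rewrite H in Ht.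
    do 2 cstep; cstep; split=> /= [x| |z Hz].
    + rewrite EC xi tS eqn_add2l -[x == i :> nat]/(x == t).
      case: (eqVneq x t) => [->|_]; first by rewrite Ht /= !orbT.
      by rewrite I1 orbF.
    + apply/esym/negbTE/forallPn; exists t; rewrite negb_imply.
      by rewrite /= ltnSn Ht.
    + rewrite EC xi; case: eqP => [E|_]; last exact: I3.
      by move: Hz (im); rewrite E; clear; lia.
  - move=> s1 fr [I1 I2 I3]; split=> // [t|].
      by rewrite I1 ltn_ord [RHS]in_setU.
    rewrite I2; apply/forallP/eqP => [H|E t]; last first.
      by apply/implyP => /andP[_ H]; rewrite -E in_setU H orbT.
    apply/setUidPl/subsetP=> t Ht; apply: (implyP (H t)).
    by rewrite ltn_ord.
by clear; lia.
Qed.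

Lemma run_load_row s S (b : bool) :
  vr s vM = m -> row_ok s aQ (vr s vC) S -> (vr s vSuc != 0) = b ->
  run load_row s (5 * m + 2) (fun s' =>
    row_ok s' aMx (vr s vRow) (if b then S else set0) /\
    forall z, (z < vr s vRow) || (vr s vRow + m <= z) -> ar s' aMx z = ar s aMx z).
Proof.
move=> Hm HS Hb; eapply run_le.
  eapply run_conseq.
    eapply (run_row (a := aMx) (base := vr s vRow)
      (P := fun i v => (v != 0) = b && (ar s aQ (vr s vC + i) != 0)) Hm) => //.
    move=> i s1 im fr xi I2.
    have Eb : (eval s1 (Var vSuc) != 0) = b by rewrite /= (fr_v fr).
    apply: (run_iteb Eb) => Hb1; cstep; split=> [|z /negPf Hz] /=;
      rewrite xi !(fr_v fr) //= ?eqxx ?Hz ?Hb1 ?(negPf Hb1) // (fr_a fr) //.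
  move=> s1 fr [H1 H2]; split=> // t; rewrite (H1 _ (ltn_ord t)) (HS t).
  by case: (b); rewrite ?inE.
by clear; lia.
Qed.

(** The two rows coincide or are disjoint; in either case a cell of the second row still has its
    initial value when it is read. *)
Lemma run_or_row s A B :
  vr s vM = m -> row_ok s aMx (vr s vRow) A -> row_ok s aMx (vr s vXr) B ->
  (vr s vXr = vr s vRow \/ vr s vXr + m <= vr s vRow \/ vr s vRow + m <= vr s vXr) ->
  run or_row s (4 * m + 2) (fun s' =>
    row_ok s' aMx (vr s vRow) (A :|: B) /\
    forall z, (z < vr s vRow) || (vr s vRow + m <= z) -> ar s' aMx z = ar s aMx z).
Proof.
move=> Hm HA HB dis; eapply run_le.
  eapply run_conseq.
    eapply (run_row (a := aMx) (base := vr s vRow)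
      (P := fun i v => (v != 0) = (ar s aMx (vr s vRow + i) != 0) ||
         (ar s aMx (vr s vXr + i) != 0)) Hm) => //.
    move=> i s1 im fr xi I2.
    have Eb : (eval s1 (Arr aMx (Add (Var vXr) (Var vT))) != 0) =
        (ar s aMx (vr s vXr + i) != 0).
      rewrite /= (fr_v fr) //= xi I2 //.
      by case: dis => [|[|]]; move: (im); clear; lia.
    have Er : ar s1 aMx (vr s vRow + i) = ar s aMx (vr s vRow + i).
      by rewrite I2 // leqnn orbT.
    apply: (run_iteb Eb) => Hb1; cstep; last first.
      by split=> //; rewrite Er (negPf Hb1) orbF.
    split=> [|z /negPf Hz] /=; rewrite xi (fr_v fr) //= ?Hz //.
    by rewrite eqxx Hb1 orbT.
  move=> s1 fr [H1 H2]; split=> // t; rewrite (H1 _ (ltn_ord t)) (HA t) (HB t).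
  by rewrite in_setU.
by clear; lia.
Qed.

Lemma run_save_row s A :
  vr s vM = m -> row_ok s aMx (vr s vBr) A ->
  run save_row s (3 * m + 2) (fun s' =>
    row_ok s' aQ (vr s vOff) A /\
    forall z, (z < vr s vOff) || (vr s vOff + m <= z) -> ar s' aQ z = ar s aQ z).
Proof.
move=> Hm HA; eapply run_le.
  eapply run_conseq.
    eapply (run_row (a := aQ) (base := vr s vOff)
      (P := fun i v => (v != 0) = (ar s aMx (vr s vBr + i) != 0)) Hm) => //.
    move=> i s1 im fr xi I2; cstep; split=> [|z /negPf Hz] /=;
      rewrite xi !(fr_v fr) //= ?eqxx ?Hz // (fr_a fr) //.
  by move=> s1 fr [H1 H2]; split=> // t; rewrite (H1 _ (ltn_ord t)) (HA t).
by clear; lia.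
Qed.

Lemma pow_le : m <= m ^ 2 /\ m ^ 2 <= m ^ 3.
Proof. by case: m => [//|n]; rewrite -{1}[n.+1]expn1 !leq_pexp2l. Qed.

Definition rows_ok s W : Prop := forall u, row_ok s aMx (u * m) (W u).

(** The invariant of Warshall's algorithm: composition through indices below [i] adds nothing. *)
Definition closed_upto i W : Prop :=
  forall u y, y < i -> y \in W u -> W y \subset W u.

(** [W] contains [W0] and never exceeds its closure; together with [closed_upto m] this makes [W]
    the closure. *)
Definition generated W0 W : Prop := forall u, W0 u \subset W u /\
  forall S, W0 u \subset S -> (forall x, x \in S -> W0 x \subset S) -> W u \subset S.

Definition wstep x W u : {set 'I_m} := if x \in W u then W u :|: W x else W u.

Lemma wstep_sub x W u : W u \subset wstep x W u.
Proof. by rewrite /wstep; case: ifP => // _; exact: subsetUl. Qed.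

(** If [x] is outside [W u], it is outside [W y] for every [y < i] in [W u], and neither row
    changes; otherwise all rows concerned end up inside [W u :|: W x]. *)
Lemma wstep_closed i (im : i < m) W :
  closed_upto i W -> closed_upto i.+1 (wstep (Ordinal im) W).
Proof.
set x := Ordinal im => C u y; rewrite ltnS leq_eqVlt => /orP[/eqP E|yi].
  have -> : y = x by exact: val_inj.
  move=> H; have xu : x \in W u.
    by move: H; rewrite /wstep; case: ifP => // ->.
  by rewrite /wstep xu; case: ifP => _; rewrite ?setUid subsetUr.
rewrite {1}/wstep; case: ifP => [xu|xu yu]; last first.
  have yx : (x \in W y) = false.
    by apply: contraFF xu => xy; exact: (subsetP (C _ _ yi yu)).
  by rewrite /wstep yx xu; exact: C.
have Hx z : W z \subset W u :|: W x -> wstep x W z \subset wstep x W u.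
  by move=> H; rewrite /wstep xu; case: ifP => // _; rewrite subUset H subsetUr.
rewrite in_setU => /orP[yu|yx]; apply: Hx.
  by apply: subset_trans (C _ _ yi yu) _; exact: subsetUl.
by apply: subset_trans (C _ _ yi yx) _; exact: subsetUr.
Qed.

Lemma wstep_generated x W0 W : generated W0 W -> generated W0 (wstep x W).
Proof.
move=> G u; have [G1 G2] := G u; split; first exact: subset_trans (wstep_sub x W u).
move=> S H1 H2; have WS := G2 S H1 H2; rewrite /wstep; case: ifP => // xu.
rewrite subUset WS /=; have [_] := G x; apply=> //.
by apply: H2; exact: (subsetP WS).
Qed.

Lemma run_warshall s W0 :
  vr s vM = m -> rows_ok s W0 ->
  run warshall s (20 * m ^ 3 + 20) (fun s' =>
    exists W, [/\ rows_ok s' W, closed_upto m W & generated W0 W]).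
Proof.
move=> Hm H0; eapply run_le.
  rewrite /warshall; do 2 cstep.
  pose Inv i s' := vr s' vXr = i * m /\
    exists W, [/\ rows_ok s' W, closed_upto i W & generated W0 W].
  eapply (run_forc (n := m) (Inv := Inv)) => //.
  - split=> //=; exists W0; split=> // u; split=> // S.
  - move=> i s1 im fr xi [Ex [W [HW CW GW]]]; pose x := Ordinal im.
    have Hm1 : vr s1 vM = m by rewrite (fr_v fr).
    do 2 cstep; cstep.
    pose Inv' j s' := vr s' vRow = j * m /\
      rows_ok s' (fun u => if u < j then wstep x W u else W u).
    eapply (run_forc (n := m) (Inv := Inv')) => //.
    + move=> j s2 jm fr2 yj [Er HR]; pose y := Ordinal jm.
      have Hm2 : vr s2 vM = m by rewrite (fr_v fr2).
      have Ex2 : vr s2 vXr = i * m by rewrite (fr_v fr2).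
      have Ei2 : vr s2 vX = i by rewrite (fr_v fr2).
      have HRy : row_ok s2 aMx (vr s2 vRow) (W y).
        by have := HR y; rewrite ltnn -Er.
      (* Row [x] is unchanged by its own step, so it may be read before or after its turn. *)
      have HRx : row_ok s2 aMx (vr s2 vXr) (W x).
        have := HR x; rewrite -Ex2 /wstep setUid.
        by case: ifP => // _; case: ifP.
      have E1 : (eval s2 (Arr aMx (Add (Var vRow) (Var vX))) != 0) = (x \in W y).
        by rewrite /= Ei2 (HRy x).
      have fin s3 : vr s3 vRow = j * m -> vr s3 vM = m ->
          row_ok s3 aMx (j * m) (wstep x W y) ->
          (forall z, (z < j * m) || (j * m + m <= z) -> ar s3 aMx z = ar s2 aMx z) ->
          run (vRow ::= Add (Var vRow) (Var vM))%cmd s3 1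
            (fun s' => Inv' j.+1 (setv s' vY j.+1)).
        move=> Er3 Em3 Hy Hz; cstep; split=> /=; first by rewrite Er3 Em3 mulSnr.
        move=> u t; rewrite /= ltnS leq_eqVlt.
        have [E|N] := eqVneq (u : nat) j.
          by have -> : u = y by exact: val_inj; exact: Hy.
        rewrite Hz; first exact: HR.
        have := ltn_ord t; case: (ltngtP u j) N => // [uj|ju] _ tm.
          by apply/orP; left; apply: leq_trans (_ : u.+1 * m <= _); rewrite ?leq_mul2r ?uj ?orbT // mulSnr ltn_add2l.
        by apply/orP; right; rewrite -mulSnr (leq_trans _ (leq_addr _ _)) // leq_mul2r ju orbT.
      cstep; apply: (run_iteb E1) => Hxy; last first.
        cstep; apply: fin => //; rewrite /wstep (negPf Hxy) -Er; exact: HRy.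
      eapply run_conseq.
        apply: (run_or_row Hm2 HRy HRx); rewrite Er Ex2.
        case: (ltngtP i j) => [ij|ji|->]; last by left.
          by right; left; rewrite -mulSnr leq_mul2r ij orbT.
        by right; right; rewrite -mulSnr leq_mul2r ji orbT.
      move=> s3 fr3 [R3 Z3]; apply: fin; rewrite ?(fr_v fr3) //.
        by rewrite -Er /wstep Hxy.
      by move=> z Hz; apply: Z3; rewrite Er.
    + move=> s2 fr2 [_ HR]; cstep; split=> /=.
        by rewrite !(fr_v fr2) //= Ex Hm1 mulSnr.
      exists (wstep x W); split; last exact: wstep_generated.
        by move=> u t /=; have := HR u t; rewrite ltn_ord.
      exact: wstep_closed.
  - by move=> s1 _ [].
by have [] := pow_le; clear; nia.
Qed.

(** The value [m.+1] exceeds every cardinality and signals that all rows are empty. A smallest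
    nonempty row of the closure is what yields a minimal strongly closed family. *)
Lemma run_best_row s W :
  vr s vM = m -> rows_ok s W ->
  run best_row s (20 * m ^ 2 + 20 * m + 20) (fun s' =>
    if vr s' vBs == m.+1 then forall u, W u = set0
    else exists u, [/\ vr s' vBr = u * m, W u != set0, vr s' vBs <= m
      & forall x, W x != set0 -> #|W u| <= #|W x|]).
Proof.
move=> Hm HW; eapply run_le.
  rewrite /best_row; do 3 (cstep; cstep).
  pose Inv i s' := vr s' vRow = i * m /\
    (vr s' vBs = m.+1 /\ (forall u, u < i -> W u = set0) \/
     exists u, [/\ vr s' vBr = u * m, W u != set0, vr s' vBs = #|W u|
      & forall x, x < i -> W x != set0 -> #|W u| <= #|W x|]).
  eapply (run_forc (n := m) (Inv := Inv)) => //.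
  - by split=> //=; left; rewrite Hm addn1.
  - move=> i s1 im fr xi [Er IH]; pose x := Ordinal im.
    do 2 cstep; cstep.
    pose Inv' j s' := vr s' vCnt = #|[set t | t \in W x & (t : 'I_m) < j]|.
    have Hm1 : vr s1 vM = m by rewrite (fr_v fr).
    eapply (run_forc (n := m) (Inv := Inv')) => //.
    + by rewrite /Inv' card_prefix0.
    + move=> j s2 jm fr2 tj I2; have EN := card_prefixS (fun t => t \in W x) jm.
      have E1 : (eval s2 (Arr aMx (Add (Var vRow) (Var vT))) != 0) = (Ordinal jm \in W x).
        rewrite /= tj (fr_v fr2) //= Er (fr_a fr2) //= (fr_a fr) //.
        exact: (HW x (Ordinal jm)).
      apply: (run_iteb E1) => Ht; cstep; rewrite /Inv' /= I2 EN /=.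
        by rewrite Ht addnC.
      by rewrite (negPf Ht).
    + move=> s2 fr2 I2.
      have EC : vr s2 vCnt = #|W x|.
        by rewrite I2; apply: eq_card => t; rewrite inE ltn_ord andbT.
      have Er2 : vr s2 vRow = i * m by rewrite (fr_v fr2).
      have Em2 : vr s2 vM = m by rewrite (fr_v fr2).
      have Eb2 : vr s2 vBs = vr s1 vBs by rewrite (fr_v fr2).
      have Ebr2 : vr s2 vBr = vr s1 vBr by rewrite (fr_v fr2).
      have E1 : (eval s2 (Var vCnt) != 0) = (W x != set0) by rewrite /= EC cards_eq0.
      have split_i (p : 'I_m -> Prop) : p x -> (forall u, u < i -> p u) ->
          forall u : 'I_m, u < i.+1 -> p u.
        move=> px pi u; rewrite ltnS leq_eqVlt => /orP[/eqP E|]; last exact: pi.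
        by have -> : u = x by exact: val_inj.
      have fin s3 : vr s3 vRow = i * m -> vr s3 vM = m ->
          (vr s3 vBs = m.+1 /\ (forall u, u < i.+1 -> W u = set0) \/
           exists u, [/\ vr s3 vBr = u * m, W u != set0, vr s3 vBs = #|W u|
             & forall x, x < i.+1 -> W x != set0 -> #|W u| <= #|W x|]) ->
          run (vRow ::= Add (Var vRow) (Var vM))%cmd s3 1
            (fun s' => Inv i.+1 (setv s' vX i.+1)).
        by move=> Er3 Em3 H3; cstep; split=> //=; rewrite Er3 Em3 mulSnr.
      cstep; apply: (run_iteb E1) => Hx; last first.
        cstep; apply: fin => //; rewrite Eb2 Ebr2; move: Hx; rewrite negbK => /eqP Hx.
        case: IH => [[H1 H2]|[u [H1 H2 H3 H4]]]; [left|right].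
          by split=> //; apply: split_i.
        by exists u; split=> //; apply: split_i => //; rewrite Hx eqxx.
      have E2 : (eval s2 (Sub (Var vBs) (Var vCnt)) != 0) = (#|W x| < vr s1 vBs).
        by rewrite /= Eb2 EC -lt0n subn_gt0.
      apply: (run_iteb E2) => Hlt; last first.
        cstep; apply: fin => //; rewrite Eb2 Ebr2; right.
        case: IH => [[H1 H2]|[u [H1 H2 H3 H4]]].
          move: Hlt; rewrite H1 ltnS; case/negP.
          by apply: leq_trans (max_card _) _; rewrite card_ord.
        exists u; split=> //; apply: split_i => // _.
        by rewrite leqNgt -H3.
      do 2 cstep; cstep; apply: fin => //=; right; exists x; split=> //.
      apply: split_i => // u ui Wu; case: IH => [[H1 H2]|[u' [H1 H2 H3 H4]]].
        by rewrite H2 ?eqxx // in Wu.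
      by apply: leq_trans (ltnW Hlt) _; rewrite H3 H4.
  - move=> s1 _ [_ [[-> H]|[u [H1 H2 H3 H4]]]].
      by rewrite eqxx => u; apply: H.
    have Hu : vr s1 vBs <= m.
      by rewrite H3; apply: leq_trans (max_card _) _; rewrite card_ord.
    rewrite ifN; last by rewrite ltn_eqF.
    by exists u; split=> // x; apply: H4.
by clear; nia.
Qed.

End Rows.

(** * The steps of the search *)

Definition pop : cmd :=
  Ite (Var vG) (vG ::= Sub (Var vG) (Cst 1))%cmd (vRun ::= Cst 0)%cmd.

Definition leaf : cmd :=
  Ite (Var vCand)
    (Sto aQ (Add (Var vOff) (Sub (Var vCand) (Cst 1))) (Cst 1) ;;
     Sto aV (Var vG) (Cst 0))%cmd pop.

Definition child : cmd :=
  Ite (Arr aQ (Add (Var vOff) (Var vV)))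
    (Sto aV (Var vG) (Add (Var vV) (Cst 1)))
    (vW ::= Add (Add (Var vOff) (Cst 1)) (Var vV) ;;
     mult vC vW ;;
     merge ;;
     Ite (Var vCh)
       (vG ::= Add (Var vG) (Cst 1) ;;
        Sto aOff (Var vG) (Var vC) ;;
        Sto aV (Var vG) (Cst 0))
       (Sto aV (Var vG) (Add (Var vV) (Cst 1))))%cmd.

Definition load_in : cmd :=
  (vW ::= Add (Add (Var vOff) (Cst 1)) (Var vX) ;;
   mult vC vW ;;
   scan vC ;;
   vSuc ::= Cst 0 ;;
   Ite (Arr aQ (Add (Var vOff) (Var vX))) Skip
     (Ite (Sub (Var vD) (Var vG)) Skip (vSuc ::= Cst 1)) ;;
   load_row ;;
   vRow ::= Add (Var vRow) (Var vM))%cmd.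

Definition load : cmd := (vRow ::= Cst 0 ;; For vX vM load_in)%cmd.

Definition commit_node : cmd :=
  (load ;; warshall ;; best_row ;;
   Ite (Sub (Add (Var vM) (Cst 1)) (Var vBs))
     (save_row ;; Sto aV (Var vG) (Cst 0)) pop)%cmd.

Definition search_step : cmd :=
  (vOff ::= Arr aOff (Var vG) ;;
   vV ::= Arr aV (Var vG) ;;
   scan vOff ;;
   Ite (Sub (Var vG) (Var vD)) pop
     (Ite (Sub (Var vK) (Var vG))
        (Ite (Sub (Var vM) (Var vV)) child commit_node) leaf))%cmd.

Definition search : cmd := While (Var vRun) search_step.

Lemma run_iteT e c1 c2 s n Q : eval s e != 0 -> run c1 s n Q ->
  run (Ite e c1 c2) s n.+1 Q.
Proof.
move=> He [t [s' [E H q]]]; exists t.+1, s'; split=> //; exact: EIteT.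
Qed.

Lemma run_iteF e c1 c2 s n Q : eval s e = 0 -> run c2 s n Q ->
  run (Ite e c1 c2) s n.+1 Q.
Proof.
move=> He [t [s' [E H q]]]; exists t.+1, s'; split=> //; exact: EIteF.
Qed.

(** * Correctness and cost of each step *)

Section Search.
Variables (m : nat) (arc : rel 'I_m) (k : nat).
Hypotheses (arc_irr : irreflexive arc) (m_gt0 : 0 < m).
Implicit Types (Q : seq 'I_m -> {set 'I_m}) (w x y : seq 'I_m) (a t u : 'I_m).
Implicit Types (S X : {set 'I_m}).

(* [m] times the number of [w] in the heap order of the [m]-ary tree. *)
Definition offset w : nat := foldl (fun o a => m * (o + 1 + nat_of_ord a)) 0 w.

Lemma offset_rcons w a : offset (rcons w a) = m * (offset w + 1 + a).
Proof. by rewrite /offset -cats1 foldl_cat. Qed.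

Lemma offset_inj x y t u : offset x + t = offset y + u -> x = y /\ t = u.
Proof.
have div o (i : 'I_m) : (m * o + i) %/ m = o /\ (m * o + i) %% m = i.
  by rewrite mulnC divnMDl // modnMDl divn_small ?modn_small ?addn0.
have step o o' (i j : 'I_m) : m * o + i = m * o' + j -> o = o' /\ i = j.
  move=> E; have [d1 r1] := div o i; have [d2 r2] := div o' j.
  by split; [rewrite -d1 -d2 E|apply: val_inj; rewrite /= -r1 -r2 E].
elim/last_ind: x y t u => [|x a IH] y t u; case/lastP: y => [|y b].
- by move/val_inj.
- by rewrite offset_rcons -[offset [::]](muln0 m) => /step[]; rewrite -addnA addnCA.
- by rewrite offset_rcons -[offset [::]](muln0 m) => /step[]; rewrite -addnA addnCA.
- rewrite !offset_rcons => /step[E ->]; split=> //.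
  by have [|-> ->] := IH y a b; first by move: E; lia.
Qed.

Lemma offset_row x y t : x != y ->
  (offset x + t < offset y) || (offset y + m <= offset x + t).
Proof.
move=> xy; rewrite ltnNge; case: (leqP (offset y) (offset x + t)) => //= le1.
rewrite leqNgt; apply/negP=> lt2.
have lt : offset x + t - offset y < m by move: le1 lt2; clear; lia.
have [E _] : x = y /\ t = Ordinal lt by apply: offset_inj; rewrite /= subnKC.
by rewrite E eqxx in xy.
Qed.

Definition sets_rep (s : store) Q : Prop :=
  forall x, size x <= k -> row_ok s aQ (offset x) (Q x).

Lemma sets_rep_upd s s' Q x X : sets_rep s Q -> row_ok s' aQ (offset x) X ->
  (forall z, (z < offset x) || (offset x + m <= z) -> ar s' aQ z = ar s aQ z) ->
  sets_rep s' (upd Q x X).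
Proof.
move=> H HX Hz y yk; have [->|N] := eqVneq y x; first by rewrite updE.
by rewrite upd_neq // => t; rewrite Hz ?offset_row //; exact: H.
Qed.

Lemma sets_rep_eq s s' Q : (forall z, ar s' aQ z = ar s aQ z) -> sets_rep s Q -> sets_rep s' Q.
Proof. by move=> E H x xk t; rewrite E; exact: H. Qed.

Definition arc_ok_eq s s' : arc_ok arc s -> vr s' vM = vr s vM ->
  (forall z, ar s' aArc z = ar s aArc z) -> arc_ok arc s'.
Proof. by move=> [H1 H2] E1 E2; split=> [|u t]; rewrite ?E1 ?E2. Qed.

Record search_rep (s : store) Q w (v : nat) : Prop := SearchRep {
  sr_arc : arc_ok arc s;
  sr_k : vr s vK = k;
  sr_run : vr s vRun = 1;
  sr_q : sets_rep s Q;
  sr_g : vr s vG = size w;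
  sr_off : forall i, i <= size w -> ar s aOff i = offset (take i w);
  sr_path : forall y a (z : seq 'I_m), w = y ++ a :: z -> ar s aV (size y) = a;
  sr_top : ar s aV (size w) = v
}.

Record search_result (s : store) : Prop := SearchResult {
  rs_m : vr s vM = m;
  rs_run : vr s vRun = 0;
  rs_q : exists S, row_ok s aQ 0 S /\ (S = setT <-> reach arc k set0 setT)
}.

Lemma search_rep_next s s' Q Q' w (v v' : nat) : search_rep s Q w v ->
  (forall i, i \in [:: vM; vK; vRun; vG] -> vr s' i = vr s i) ->
  (forall i, ar s' aArc i = ar s aArc i) ->
  (forall i, ar s' aOff i = ar s aOff i) ->
  (forall i, ar s' aV i = if i == size w then v' else ar s aV i) ->
  sets_rep s' Q' -> search_rep s' Q' w v'.
Proof.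
move=> [R1 R2 R3 R4 R5 R6 R7 R8] Ev Ea Eo EV HQ; split=> //.
- exact: arc_ok_eq R1 (Ev _ _) Ea.
- by rewrite Ev.
- by rewrite Ev.
- by rewrite Ev.
- by move=> i iw; rewrite Eo; exact: R6.
- move=> y a z E; rewrite EV (R7 _ _ _ E) ifN //.
  by rewrite E size_cat /=; apply/eqP; clear; lia.
- by rewrite EV eqxx.
Qed.

Variable b : nat.

Definition search_inv (f : nat) (s : store) : Prop :=
  search_result s \/
  exists Q w v, [/\ search_rep s Q w v, tree_inv arc k Q w v, v <= m & fuel k b Q w v <= f].

Lemma run_pop s Q w v f : search_rep s Q w v -> tree_inv arc k Q w v -> v <= m ->
  dsep arc (Q w) < size w \/ stuck arc k (Q w) -> fuel k b Q w v <= f ->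
  run pop s 3 (fun s' => exists2 f', search_inv f' s' & f' + node_fuel k b w v <= f).
Proof.
move=> R I vm D Hf; eapply run_le.
  have Eg : (eval s (Var vG) != 0) = (w != [::]) by rewrite /= (sr_g R) size_eq0.
  apply: (run_iteb Eg) => Hw; cstep; last first.
    have Ew : w = [::] by apply/eqP; rewrite -[_ == _]negbK.
    exists 0; last by apply: leq_trans Hf; rewrite add0n /fuel leq_addl.
    left; split=> //=; first by have [] := sr_arc R.
    exists (Q [::]); split; first exact: (sr_q R (x := [::])).
    apply: (search_done (v := v)); first by rewrite -Ew.
    by rewrite -Ew; case: D => //; rewrite Ew.
  case/lastP: w R I D Hf Eg Hw => // y a R I D Hf _ _.
  have yk : size y < k by have := inv_size I; rewrite size_rcons.
  exists (fuel k b Q y a); last by rewrite (fuel_pop _ _ _ _ yk).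
  right; exists Q, y, a; split=> //; last 2 first.
  - exact: tree_inv_pop I D.
  - exact: ltnW.
  case: R => R1 R2 R3 R4 R5 R6 R7 R8; split=> //=.
  - by rewrite R5 size_rcons subn1.
  - move=> i iy; rewrite R6 ?size_rcons; last exact: leqW.
    by rewrite -cats1 takel_cat.
  - by move=> y' a' z E; apply: (R7 y' a' (rcons z a)); rewrite E -rcons_cons rcons_cat.
  - by apply: (R7 y a [::]); rewrite cats1.
by [].
Qed.

Lemma run_leaf s Q w v f : search_rep s Q w v -> tree_inv arc k Q w v -> v <= m ->
  vr s vOff = offset w -> cand_spec arc (Q w) (vr s vCand) ->
  size w = k -> dsep arc (Q w) = size w -> fuel k b Q w v <= f ->
  run leaf s 5 (fun s' => exists2 f', search_inv f' s' & f' + b * m ^ 2 <= f).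
Proof.
move=> R I vm Eo; rewrite /leaf; case Ec: (vr s vCand) => [|c] /= C wk D Hf.
  eapply run_le; first apply: run_iteF => //.
    eapply run_conseq; first apply: (run_pop R I vm _ Hf).
      by right; apply: (leaf_stuck I wk D).
    move=> s' _ [f' H1 H2]; exists f' => //.
    by apply: leq_trans H2; rewrite leq_add2l node_fuel_ge.
  by [].
have [u [Eu uQ du]] := C; eapply run_le.
  apply: run_iteT; first by rewrite /= Ec.
  do 2 cstep; cstep; pose X := u |: Q w.
  have PX : Q w \proper X.
    by apply/properP; split; [exact: subsetUr | exists u; rewrite ?setU11].
  exists (fuel k b (upd Q w X) w 0); last by apply: leq_trans Hf; exact: fuel_leaf.
  right; exists (upd Q w X), w, 0; split=> //; last first.
    by apply: (tree_inv_grow I); apply: (leaf_grow I wk du).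
  apply: (search_rep_next R) => //=.
    by move=> i; rewrite (sr_g R); case: eqP.
  apply: (sets_rep_upd (s := s)); first exact: sr_q R.
    move=> t; rewrite /= Eo Ec subn1 /= eqn_add2l -Eu -[t == u :> nat]/(t == u).
    rewrite in_setU1; case: (eqVneq t u) => [//|_] /=.
    exact: (sr_q R (inv_size I)).
  move=> z Hz; rewrite /= Eo Ec subn1 /=; case: eqP => // E.
  by move: Hz (ltn_ord u); rewrite E Eu; clear; lia.
by [].
Qed.


Lemma offset_child w a : offset w + m <= offset (rcons w a).
Proof. by rewrite offset_rcons; move: m_gt0 (nat_of_ord a); clear; nia. Qed.

Lemma run_child s Q w v f : search_rep s Q w v -> tree_inv arc k Q w v -> v < m ->
  vr s vOff = offset w -> vr s vV = v -> size w < k -> dsep arc (Q w) = size w ->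
  fuel k b Q w v <= f ->
  run child s (11 * m + 20) (fun s' => exists2 f', search_inv f' s' & f' + b * m ^ 2 <= f).
Proof.
move=> R I vm Eo Ev wk D Hf; pose a := Ordinal vm; eapply run_le.
  have next s' : (forall i, i \in [:: vM; vK; vRun; vG] -> vr s' i = vr s i) ->
      (forall i, ar s' aArc i = ar s aArc i) ->
      (forall i, ar s' aOff i = ar s aOff i) ->
      (forall i, ar s' aV i = if i == size w then v.+1 else ar s aV i) ->
      sets_rep s' Q ->
      (a \notin Q w -> Q (rcons w a) :|: (a |: Q w) = Q (rcons w a)) ->
      exists2 f', search_inv f' s' & f' + b * m ^ 2 <= f.
    move=> H1 H2 H3 H4 H5 H6; exists (fuel k b Q w v.+1); last by rewrite fuel_next.
    right; exists Q, w, v.+1; split=> //; first exact: search_rep_next R _ _ _ _ _.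
    apply: (tree_inv_next I) => u Eu; have -> : u = a by exact: val_inj.
    exact: H6.
  have Ea : (eval s (Arr aQ (Add (Var vOff) (Var vV))) != 0) = (a \in Q w).
    by rewrite /= Eo Ev; exact: (sr_q R (inv_size I) a).
  apply: (run_iteb Ea) => Ha.
    cstep; apply: next => //=.
    - by move=> i; rewrite (sr_g R) Ev addn1; case: eqP.
    - by apply: sets_rep_eq (sr_q R).
    - by rewrite Ha.
  have Hm : vr s vM = m by case: (sr_arc R).
  have ck : size (rcons w a) <= k by rewrite size_rcons.
  do 2 cstep; cstep; eapply run_conseq; first exact: (run_mult (m := m)).
  move=> s1 fr1 /= E1; rewrite Eo Ev -(offset_rcons w a) in E1.
  have qr1 : sets_rep s1 Q by apply: sets_rep_eq (sr_q R) => z; rewrite (fr_a fr1).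
  cstep; eapply run_conseq.
    apply: (run_merge (m := m) (a := a) (S := Q w) (Sc := Q (rcons w a)));
      rewrite ?E1 ?(fr_v fr1) //= ?Eo.
    - exact: offset_child.
    - exact: qr1 (inv_size I).
    - exact: qr1 ck.
  move=> s2 fr2 [Rm Ech Ez]; rewrite E1 in Rm Ez.
  have V2 i : i \in [:: vM; vK; vRun; vG; vOff; vV] -> vr s2 i = vr s i.
    by rewrite !inE => Hi; rewrite (fr_v fr2) ?(fr_v fr1) //=; move: Hi;
      do ![case/predU1P=> [-> //|]]; move/eqP->.
  have EC2 : vr s2 vC = offset (rcons w a) by rewrite (fr_v fr2).
  have A2 z i : z \in [:: aArc; aOff; aV] -> ar s2 z i = ar s z i.
    by rewrite !inE => Hi; rewrite (fr_a fr2) ?(fr_a fr1) //=; move: Hi;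
      do ![case/predU1P=> [-> //|]]; move/eqP->.
  pose X := Q (rcons w a) :|: (a |: Q w); pose Q' := upd Q (rcons w a) X.
  have qr2 : sets_rep s2 Q' by exact: sets_rep_upd qr1 Rm Ez.
  have Ech' : (eval s2 (Var vCh) != 0) = (X != Q (rcons w a)) by rewrite /= Ech.
  apply: (run_iteb Ech') => HX; last first.
    have EX : X = Q (rcons w a) by apply/eqP; rewrite -[_ == _]negbK.
    cstep; apply: next => //=.
    - by move=> i; rewrite !inE => /or4P[] /eqP ->; rewrite V2.
    - by move=> i; rewrite A2.
    - by move=> i; rewrite A2.
    - by move=> i; rewrite !V2 // (sr_g R) Ev addn1 A2 //; case: eqP.
    - apply: (sets_rep_eq (s := s2)) => // x xk; have := qr2 x xk.
      by rewrite /Q' /upd; case: eqP => // ->; rewrite EX.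
  do 2 cstep; do 2 cstep; cstep.
  have PX : Q (rcons w a) \proper X.
    by rewrite properEneq subsetUl andbT eq_sym.
  exists (fuel k b Q' (rcons w a) 0); last first.
    by apply: leq_trans Hf; apply: fuel_push.
  right; exists Q', (rcons w a), 0; split=> //; last exact: tree_inv_push.
  have [R1 R2 R3 R4 R5 R6 R7 R8] := R.
  split=> //=.
  - apply: (arc_ok_eq R1) => /=; first by rewrite V2.
    by move=> z; rewrite A2.
  - by rewrite V2.
  - by rewrite V2.
  - by rewrite V2 // R5 size_rcons addn1.
  - move=> i; rewrite size_rcons V2 // R5 addn1 EC2 A2 // leq_eqVlt.
    case/orP=> [/eqP ->|]; first by rewrite eqxx -(size_rcons w a) take_size.
    rewrite ltnS => iw; rewrite ltn_eqF ?ltnS // R6 //.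
    by rewrite -cats1 takel_cat.
  - move=> y u z; rewrite V2 // R5 addn1; case/lastP: z => [|z d].
      by rewrite cats1 => /rcons_inj[<- <-]; rewrite ltn_eqF // A2.
    rewrite -rcons_cons -rcons_cat => /rcons_inj [E _].
    rewrite A2 // (R7 _ _ _ E) ltn_eqF // E size_cat /=; clear; lia.
  - by rewrite V2 // R5 addn1 size_rcons eqxx.
by clear; lia.
Qed.


(** Children without success get an empty row: they contribute nothing to the closure and are never
    chosen as smallest nonempty row. *)
Definition success_row Q w u : {set 'I_m} :=
  if success arc Q w u then Q (rcons w u) else set0.

Lemma run_load s Q w v : search_rep s Q w v -> vr s vOff = offset w -> size w < k ->
  run load s (40 * m ^ 3 + 40 * m ^ 2 + 40 * m + 3)
    (fun s' => rows_ok s' (success_row Q w)).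
Proof.
move=> R Eo wk; have [Hm Harc] := sr_arc R; eapply run_le.
  rewrite /load; do 2 cstep.
  pose Inv i s' := vr s' vRow = i * m /\
    forall u : 'I_m, u < i -> row_ok s' aMx (u * m) (success_row Q w u).
  eapply (run_forc (n := m) (Inv := Inv)) => //.
  - move=> i s1 im fr xi [Er HW]; pose a := Ordinal im.
    have ck : size (rcons w a) <= k by rewrite size_rcons.
    have Hm1 : vr s1 vM = m by rewrite (fr_v fr).
    have Eo1 : vr s1 vOff = offset w by rewrite (fr_v fr).
    have Eg1 : vr s1 vG = size w by rewrite (fr_v fr) //= (sr_g R).
    have qr1 : sets_rep s1 Q by apply: sets_rep_eq (sr_q R) => z; rewrite (fr_a fr).
    rewrite /load_in; do 2 cstep; cstep; eapply run_conseq; first exact: (run_mult (m := m)).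
    move=> s2 fr2 /= E2; rewrite Eo1 xi -(offset_rcons w a) in E2.
    have qr2 : sets_rep s2 Q by apply: sets_rep_eq qr1 => z; rewrite (fr_a fr2).
    cstep; eapply run_conseq.
      apply: (run_scan arc_irr (S := Q (rcons w a))) => //; last by right.
        apply: (arc_ok_eq (sr_arc R)); first by rewrite (fr_v fr2) //= (fr_v fr).
        by move=> z; rewrite (fr_a fr2) //= (fr_a fr).
      by rewrite E2; exact: qr2.
    move=> s3 fr3 [Ed _]; do 2 cstep.
    have E3 : (eval (setv s3 vSuc 0) (Arr aQ (Add (Var vOff) (Var vX))) != 0) = (a \in Q w).
      rewrite /= (fr_v fr3) //= (fr_v fr2) //= Eo1 (fr_v fr3) //= (fr_v fr2) //= xi.
      by rewrite (fr_a fr3) //= (fr_a fr2) //; exact: (qr1 w (ltnW wk) a).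
    have E4 : (eval (setv s3 vSuc 0) (Sub (Var vD) (Var vG)) != 0) =
        ~~ (dsep arc (Q (rcons w a)) <= size w).
      by rewrite /= Ed (fr_v fr3) //= (fr_v fr2) //= Eg1 subn_eq0.
    have fin s4 : frame (Asg vSuc (Cst 0)) s3 s4 -> (vr s4 vSuc != 0) = success arc Q w a ->
        run (load_row ;; vRow ::= Add (Var vRow) (Var vM))%cmd s4 (5 * m + 3)
          (fun s' => Inv i.+1 (setv s' vX i.+1)).
      move=> fr4 Es; eapply run_le.
        cstep; eapply run_conseq.
          apply: (run_load_row (m := m) (S := Q (rcons w a)) (b := success arc Q w a)) => //.
            by rewrite (fr_v fr4) //= (fr_v fr3) //= (fr_v fr2).
          rewrite (fr_v fr4) //= (fr_v fr3) //= E2 => t.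
          by rewrite (fr_a fr4) //= (fr_a fr3) //; exact: qr2.
        have E5 : vr s4 vRow = i * m.
          by rewrite (fr_v fr4) //= (fr_v fr3) //= (fr_v fr2).
        move=> s5 fr5; rewrite E5 => -[H5 Z5]; cstep; split=> /=.
          rewrite !(fr_v fr5) //= E5 (fr_v fr4) //= (fr_v fr3) //= (fr_v fr2) //=.
          by rewrite Hm1 mulSnr.
        move=> u; rewrite ltnS leq_eqVlt => /orP[/eqP E|ui].
          have -> : u = a by exact: val_inj.
          exact: H5.
        move=> t /=; rewrite Z5; last first.
          apply/orP; left; apply: leq_trans (_ : u.+1 * m <= _).
            by rewrite mulSnr ltn_add2l.
          by rewrite leq_mul2r ui orbT.
        rewrite (fr_a fr4) //= (fr_a fr3) //= (fr_a fr2) //; exact: HW.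
      by clear; lia.
    have fr0 : frame (Asg vSuc (Cst 0)) s3 (setv s3 vSuc 0).
      by split=> //= x; rewrite eq_sym => ->.
    cstep; apply: (run_iteb E3) => Ha.
      cstep; apply: fin => //=; by rewrite /success Ha.
    apply: (run_iteb E4) => Hd.
      cstep; apply: fin => //=; by rewrite /success (negPf Hd) andbF.
    cstep; apply: fin => /=; last by rewrite /success Ha -[_ <= _]negbK.
    by split=> //= x; rewrite eq_sym => ->.
  - by move=> s1 _ [_ H] u; apply: H.
by rewrite !expnS; clear; nia.
Qed.

(** For a successful [x] in [W u], the row [W x] is nonempty and contained in [W u], hence equal to
    it by minimality of the cardinality. A set [X] closed in the sense of [search_commit] and
    containing [x] meets [W u] in a set closed under the loaded rows, which therefore contains
    [W x = W u]. *)
Lemma commit_row Q w W u : tree_inv arc k Q w m -> dsep arc (Q w) = size w -> size w < k ->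
  closed_upto m W -> generated (success_row Q w) W -> W u != set0 ->
  (forall x : 'I_m, W x != set0 -> #|W u| <= #|W x|) ->
  good arc k (Q w) (W u) /\ Q w \proper W u.
Proof.
move=> I D wk C G Wu min.
have rowE (x : 'I_m) : success arc Q w x -> Q (rcons w x) = success_row Q w x by rewrite /success_row => ->.
have self (x : 'I_m) : success arc Q w x -> x \in W x.
  move=> sx; have [G1 _] := G x; apply: (subsetP G1); rewrite -rowE //.
  have /andP[xQ _] := sx; have [/reach_sub H _] := child_good I xQ.
  by apply: (subsetP H); exact: setU11.
have su : success arc Q w u.
  apply: contraNT Wu => ns; rewrite -subset0; have [_] := G u; apply.
    by rewrite /success_row (negPf ns).
  by move=> x; rewrite inE.
have uW := self u su.
have sub : Q w \subset W u.
  have [G1 _] := G u; apply: subset_trans G1; rewrite -rowE //.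
  have /andP[uQ _] := su; have [/reach_sub H _] := child_good I uQ.
  by apply: subset_trans H; exact: subsetUr.
split; last by apply/properP; split=> //; exists u => //; case/andP: su.
apply: (search_commit I D wk su uW sub) => [x sx xW|x X sx xW QX xX HX].
  rewrite rowE //; have [G1 _] := G x; apply: subset_trans G1 _.
  exact: C.
have Wx : W x \subset W u by exact: C.
have EW : W x = W u.
  by apply/eqP; rewrite eqEcard Wx min //; apply/set0Pn; exists x; exact: self.
have inW (y : 'I_m) : y \in W u -> success_row Q w y \subset W u.
  by move=> yW; have [G1 _] := G y; apply: subset_trans G1 _; exact: C.
suff : W x \subset X :&: W u by rewrite EW subsetI => /andP[].
have HX' (y : 'I_m) : y \in W u -> y \in X -> success_row Q w y \subset X :&: W u.
  move=> yW yX; rewrite subsetI inW // andbT /success_row; case: ifP => sy; last exact: sub0set.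
  exact: HX.
have [_] := G x; apply; first exact: HX'.
by move=> y; rewrite in_setI => /andP[yX yW]; exact: HX'.
Qed.

Lemma run_commit s Q w f : search_rep s Q w m -> tree_inv arc k Q w m ->
  vr s vOff = offset w -> size w < k -> dsep arc (Q w) = size w ->
  fuel k b Q w m <= f ->
  run commit_node s (60 * m ^ 3 + 60 * m ^ 2 + 70 * m + 60)
    (fun s' => exists2 f', search_inv f' s' & f' + b * m ^ 3 <= f).
Proof.
move=> R I Eo wk D Hf; eapply run_le.
  have Hm : vr s vM = m by case: (sr_arc R).
  rewrite /commit_node; cstep; eapply run_conseq; first exact: (run_load R).
  move=> s1 fr1 H1; cstep; eapply run_conseq.
    by apply: (run_warshall _ H1); rewrite (fr_v fr1).
  move=> s2 fr2 [W [H2 C2 G2]]; cstep; eapply run_conseq.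
    by apply: (run_best_row _ H2); rewrite (fr_v fr2) //= (fr_v fr1).
  move=> s3 fr3 HB.
  have V3 i : i \in [:: vM; vK; vRun; vG; vOff] -> vr s3 i = vr s i.
    rewrite !inE => Hi; rewrite (fr_v fr3) ?(fr_v fr2) ?(fr_v fr1) //=; move: Hi;
      do ![case/predU1P=> [-> //|]]; by move/eqP->.
  have A3 z i : z \in [:: aArc; aOff; aV; aQ] -> ar s3 z i = ar s z i.
    rewrite !inE => Hi; rewrite (fr_a fr3) ?(fr_a fr2) ?(fr_a fr1) //=; move: Hi;
      do ![case/predU1P=> [-> //|]]; by move/eqP->.
  have E3 : (eval s3 (Sub (Add (Var vM) (Cst 1)) (Var vBs)) != 0) = (vr s3 vBs <= m).
    by rewrite /= V3 // Hm -lt0n subn_gt0 addn1 ltnS.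
  have row3 u : row_ok s3 aMx (u * m) (W u).
    by move=> t; rewrite (fr_a fr3) //; exact: H2.
  have R3 : search_rep s3 Q w m.
    apply: (search_rep_next R) => [i|i|i|i|]; rewrite ?A3 //.
    - by rewrite !inE => /or4P[] /eqP ->; rewrite V3.
    - by case: eqP => // ->; exact: sr_top R.
    - by apply: sets_rep_eq (sr_q R) => z; rewrite A3.
  apply: (run_iteb E3) => Hbs; last first.
    eapply run_conseq; first apply: (run_pop R3 I _ _ Hf) => //.
      right; apply: (search_stuck I D) => u; apply/negP => su.
      move: HB; case: eqP => [_ H|_ [u' [_ _ H _]]]; last by rewrite H in Hbs.
      have /andP[uQ _] := su; have [/reach_sub Hu _] := child_good I uQ.
      have [G1 _] := G2 u; have : u \in W u.
        by apply: (subsetP G1); rewrite /success_row su; apply: (subsetP Hu); exact: setU11.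
      by rewrite H inE.
    move=> s' _ [f' L1 L2]; exists f' => //; apply: leq_trans L2.
    by rewrite leq_add2l /node_fuel ltn_eqF // leq_addl.
  move: HB; rewrite ltn_eqF // => -[u [Ebr Wu _ min]].
  have [gW PW] := commit_row I D wk C2 G2 Wu min.
  cstep; eapply run_conseq.
    apply: (run_save_row (m := m) (A := W u)); first by rewrite V3.
    by rewrite Ebr; exact: row3.
  move=> s4 fr4 [R4 Z4]; cstep.
  rewrite V3 // Eo in R4 Z4.
  exists (fuel k b (upd Q w (W u)) w 0); last by apply: leq_trans Hf; exact: fuel_commit.
  right; exists (upd Q w (W u)), w, 0; split=> //; last exact: (tree_inv_grow I).
  apply: (search_rep_next R) => //=.
  - move=> i; rewrite !inE => /or4P[] /eqP ->; by rewrite (fr_v fr4) //= V3.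
  - by move=> i; rewrite (fr_a fr4) //= A3.
  - by move=> i; rewrite (fr_a fr4) //= A3.
  - move=> i; rewrite (fr_v fr4) //= V3 // (sr_g R) (fr_a fr4) //= A3 //.
  - apply: (sets_rep_eq (s := s4)) => //; apply: (sets_rep_upd _ R4 Z4).
    by apply: sets_rep_eq (sr_q R) => z; rewrite A3.
by clear; nia.
Qed.


(** As [m] is positive, [400] exceeds the sum of the coefficients in the cost of a scan followed by
    the most expensive branch, [commit_node]. *)
Hypothesis b_large : 400 < b.

Lemma run_search_step s f : search_inv f s -> vr s vRun != 0 ->
  exists c, run search_step s c (fun s' => exists2 f', search_inv f' s' & c + f' < f).
Proof.
case=> [[_ -> _] //|[Q [w [v [R I vm Hf]]]]] _.
have Hm : vr s vM = m by case: (sr_arc R).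
have wk := inv_size I.
set s0 := setv (setv s vOff (offset w)) vV v.
have Eoff : eval s (Arr aOff (Var vG)) = offset w.
  by rewrite /= (sr_g R) (sr_off R) // take_size.
have EV : eval (setv s vOff (offset w)) (Arr aV (Var vG)) = v.
  by rewrite /= (sr_g R) (sr_top R).
have pre n (P : store -> Prop) :
    (forall s1, frame (scan vOff) s0 s1 -> search_rep s1 Q w v ->
       vr s1 vOff = offset w -> vr s1 vV = v -> vr s1 vD = dsep arc (Q w) ->
       cand_spec arc (Q w) (vr s1 vCand) ->
       run (Ite (Sub (Var vG) (Var vD)) pop
         (Ite (Sub (Var vK) (Var vG))
           (Ite (Sub (Var vM) (Var vV)) child commit_node) leaf)) s1 n P) ->
    run search_step s (20 * m ^ 2 + 20 * m + 6 + n) P.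
  move=> H; eapply run_le.
    rewrite /search_step; cstep; apply: run_asg; rewrite Eoff.
    cstep; apply: run_asg; rewrite EV -/s0; cstep; eapply run_conseq.
      apply: (run_scan arc_irr (S := Q w)); last by left.
        by apply: (arc_ok_eq (sr_arc R)).
      by move=> t; exact: (sr_q R wk).
    move=> s1 fr [Ed Ec]; apply: H => //; try by rewrite (fr_v fr).
    apply: (search_rep_next R) => [i|i|i|i|].
    - by rewrite !inE => /or4P[] /eqP ->; rewrite (fr_v fr).
    - by rewrite (fr_a fr).
    - by rewrite (fr_a fr).
    - by rewrite (fr_a fr) //=; case: eqP => // ->; exact: sr_top R.
    - by apply: sets_rep_eq (sr_q R) => z; rewrite (fr_a fr).
  by clear; lia.
have m2 : m <= m ^ 2 by case: (pow_le m).
have m3 : m ^ 2 <= m ^ 3 by case: (pow_le m).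
have m2_gt0 : 0 < m ^ 2 by rewrite expn_gt0 m_gt0.
have bm2 : 400 * m ^ 2 < b * m ^ 2 by rewrite ltn_mul2r m2_gt0.
have bm3 : 400 * m ^ 3 < b * m ^ 3 by rewrite ltn_mul2r expn_gt0 m_gt0.
have weaken n c s1 : run s1 s n (fun s' => exists2 f', search_inv f' s' & f' + c <= f) ->
    n < c -> run s1 s n (fun s' => exists2 f', search_inv f' s' & n + f' < f).
  move=> r lt; apply: run_conseq r _ => s' _ [f' L H]; exists f' => //.
  by move: lt H; clear; lia.
have EG s1 : search_rep s1 Q w v -> vr s1 vD = dsep arc (Q w) ->
    (eval s1 (Sub (Var vG) (Var vD)) != 0) = (dsep arc (Q w) < size w).
  by move=> R1 E; rewrite /= E (sr_g R1) -lt0n subn_gt0.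
have [ltD|geD] := ltnP (dsep arc (Q w)) (size w).
  eexists; apply: (weaken _ (b * m ^ 2)).
    eapply pre => s1 fr R1 _ _ Ed _; apply: run_iteT; first by rewrite EG.
    eapply run_conseq; first by apply: (run_pop R1 I vm _ Hf); left.
    move=> s' _ [f' L H]; exists f' => //; apply: leq_trans H.
    by rewrite leq_add2l node_fuel_ge.
  by apply: leq_ltn_trans bm2; move: m2 m2_gt0 (m_gt0); clear; lia.
have D : dsep arc (Q w) = size w by apply/eqP; rewrite eqn_leq geD (inv_dsep I).
have EK s1 : search_rep s1 Q w v -> (eval s1 (Sub (Var vK) (Var vG)) != 0) = (size w < k).
  by move=> R1; rewrite /= (sr_k R1) (sr_g R1) -lt0n subn_gt0.
have F0 (e : expr) s1 c : (eval s1 e != 0) = c -> c = false -> eval s1 e = 0.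
  by move=> <- /negbT; rewrite negbK => /eqP.
have notD : (dsep arc (Q w) < size w) = false by rewrite ltnNge geD.
have [wlt|wge] := ltnP (size w) k; last first.
  eexists; apply: (weaken _ (b * m ^ 2)).
    eapply pre => s1 fr R1 Eo _ Ed Ec.
    apply: run_iteF; first by apply: (F0 _ _ _ (EG _ R1 Ed)).
    apply: run_iteF; first by apply: (F0 _ _ _ (EK _ R1)); rewrite ltnNge wge.
    apply: (run_leaf R1 I vm Eo Ec _ D Hf).
    by apply/eqP; rewrite eqn_leq wk.
  by apply: leq_ltn_trans bm2; move: m2 m2_gt0 (m_gt0); clear; lia.
have EM s1 : search_rep s1 Q w v -> vr s1 vV = v ->
    (eval s1 (Sub (Var vM) (Var vV)) != 0) = (v < m).
  by move=> R1 E; have [E2 _] := sr_arc R1; rewrite /= E2 E -lt0n subn_gt0.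
have [vlt|vge] := ltnP v m.
  eexists; apply: (weaken _ (b * m ^ 2)).
    eapply pre => s1 fr R1 Eo Ev Ed Ec.
    apply: run_iteF; first by apply: (F0 _ _ _ (EG _ R1 Ed)).
    apply: run_iteT; first by rewrite EK.
    apply: run_iteT; first by rewrite EM.
    exact: (run_child R1 I vlt Eo Ev wlt D Hf).
  by apply: leq_ltn_trans bm2; move: m2 m2_gt0 (m_gt0); clear; lia.
have Evm : v = m by apply/eqP; rewrite eqn_leq vm.
eexists; apply: (weaken _ (b * m ^ 3)).
  eapply pre => s1 fr R1 Eo Ev Ed Ec.
  apply: run_iteF; first by apply: (F0 _ _ _ (EG _ R1 Ed)).
  apply: run_iteT; first by rewrite EK.
  apply: run_iteF; first by apply: (F0 _ _ _ (EM _ R1 Ev)); rewrite ltnNge vge.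
  rewrite Evm in R1 I Hf; exact: (run_commit R1 I Eo wlt D Hf).
by apply: leq_ltn_trans bm3; move: m2 m2_gt0 m3 (m_gt0); clear; lia.
Qed.

Lemma run_search s : arc_ok arc s -> vr s vK = k -> vr s vRun = 1 -> vr s vG = 0 ->
  (forall i, ar s aQ i = 0) -> ar s aOff 0 = 0 -> ar s aV 0 = 0 -> 1 < m ->
  run search s (10 * b * m ^ (k + 3)).+1 (fun s' => search_result s').
Proof.
move=> Ha Hk Hr Hg HQ Ho HV m1.
apply: (run_while (Inv := search_inv)).
- move=> f s1 L He; have [c H] := run_search_step L He; exists c.
  exact: H.
- by move=> f s1 [//|[Q [w [v [R _ _ _]]]]] /=; rewrite (sr_run R).
- right; exists (fun=> set0), [::], 0; split=> //; last exact: fuel0.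
    split=> //.
    + by move=> x _ t; rewrite HQ inE.
    + by case.
    + by case.
  exact: tree_inv0.
Qed.

End Search.

(** * Reading the instance *)

Definition read_bin : cmd :=
  (Rd vW ;;
   Ite (Arr aId (Var vW)) Skip
     (vM ::= Add (Var vM) (Cst 1) ;; Sto aId (Var vW) (Var vM)) ;;
   Sto aB (Var vPos) (Sub (Arr aId (Var vW)) (Cst 1)) ;;
   vPos ::= Add (Var vPos) (Cst 1))%cmd.

Definition read_queue : cmd :=
  (Rd vLen ;; Sto aLen (Var vJ) (Var vLen) ;; For vI vLen read_bin)%cmd.

Definition read_input : cmd :=
  (Rd vK ;; Rd vNQ ;; For vJ vNQ read_queue)%cmd.

(* Pallets are numbered by first occurrence; [undup] would order them by the last
   one. *)
Definition firsts (s : seq nat) : seq nat :=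
  foldl (fun a t => if t \in a then a else rcons a t) [::] s.

Lemma firsts_rcons s t :
  firsts (rcons s t) = if t \in firsts s then firsts s else rcons (firsts s) t.
Proof. by rewrite /firsts -cats1 foldl_cat. Qed.

Lemma mem_firsts s : firsts s =i s.
Proof.
elim/last_ind: s => [//|s t IH] x; rewrite firsts_rcons mem_rcons inE -IH.
case: ifP => H; last by rewrite mem_rcons inE.
by case: eqP => // ->.
Qed.

Lemma uniq_firsts s : uniq (firsts s).
Proof.
elim/last_ind: s => [//|s t IH]; rewrite firsts_rcons.
by case: ifP => // H; rewrite rcons_uniq H.
Qed.

Lemma index_firsts s t x : x \in s ->
  index x (firsts (rcons s t)) = index x (firsts s).
Proof.
rewrite -(mem_firsts s) => xs; rewrite firsts_rcons; case: ifP => // _.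
by rewrite -cats1 index_cat xs.
Qed.

Record read_ok (st : store) (s : seq nat) : Prop := ReadOk {
  rd_m : vr st vM = size (firsts s);
  rd_pos : vr st vPos = size s;
  rd_id : forall t, ar st aId t =
    if t \in firsts s then (index t (firsts s)).+1 else 0;
  rd_b : forall i, i < size s -> ar st aB i = index (nth 0 s i) (firsts s)
}.

Lemma getin_cons st x t r : inp st = t :: r ->
  getin st x = Store [eta vr st with x |-> t] (ar st) r.
Proof. by rewrite /getin => ->. Qed.

Lemma run_read_bin st s t r : inp st = t :: r -> read_ok st s ->
  run read_bin st 6 (fun st' => inp st' = r /\ read_ok st' (rcons s t)).
Proof.
move=> Hi [H1 H2 H3 H4]; eapply run_le.
  rewrite /read_bin; do 2 cstep; rewrite (getin_cons _ Hi).
  cstep; apply: (run_iteb (b := t \in firsts s)).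
  - by rewrite /= H3; case: ifP.
  - move=> ts; cstep; do 2 cstep; cstep; split=> //; split=> /=.
    + by rewrite firsts_rcons ts.
    + by rewrite H2 size_rcons addn1.
    + by move=> x; rewrite H3 firsts_rcons ts.
    + move=> i; rewrite size_rcons ltnS nth_rcons H2 H3 ts subn1 /=.
      rewrite firsts_rcons ts; case: ltngtP => // Hi' _; exact: H4.
  - move=> ts; do 2 cstep; cstep; do 2 cstep; cstep; split=> //; split=> /=.
    + by rewrite firsts_rcons (negPf ts) size_rcons H1 addn1.
    + by rewrite H2 size_rcons addn1.
    + move=> x; rewrite H3 firsts_rcons (negPf ts) mem_rcons inE.
      rewrite -cats1 index_cat; case: (eqVneq x t) => [->|N] /=.
        by rewrite (negPf ts) /= eqxx addn0 H1 addn1.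
      by case: ifP.
    + move=> i; rewrite size_rcons ltnS nth_rcons H2 eqxx subn1 H1 addn1 /=.
      case: ltngtP => // [Hi'|_] _.
        by rewrite H4 // index_firsts // mem_nth.
      by rewrite firsts_rcons (negPf ts) -cats1 index_cat (negPf ts) /= eqxx addn0.
by [].
Qed.

Lemma run_read_queue st s q r : inp st = size q :: q ++ r -> read_ok st s ->
  run read_queue st (8 * size q + 4) (fun st' =>
    [/\ inp st' = r, read_ok st' (s ++ q), ar st' aLen (vr st vJ) = size q
      & forall j, j != vr st vJ -> ar st' aLen j = ar st aLen j]).
Proof.
move=> Hi R; eapply run_le.
  rewrite /read_queue; do 2 cstep; rewrite (getin_cons _ Hi); do 2 cstep.
  pose Inv i st' := inp st' = drop i q ++ r /\ read_ok st' (s ++ take i q).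
  eapply (run_forc (n := size q) (Inv := Inv)) => //.
  - by split=> /=; rewrite ?drop0 // take0 cats0; case: R.
  - move=> i s1 iq fr xi [I1 I2]; eapply run_conseq.
      apply: (run_read_bin _ I2); rewrite I1 (drop_nth 0) //.
    move=> s2 _ [J1 J2]; split=> //=; rewrite (take_nth 0) // -rcons_cat.
    by case: J2.
  - move=> s1 fr [I1 I2]; rewrite drop_size take_size in I1 I2; split=> //.
      by rewrite (fr_a fr) //= eqxx.
    by move=> j Hj; rewrite (fr_a fr) //= (negPf Hj).
by clear; lia.
Qed.

Lemma sum_size_flatten (qs : seq (seq nat)) :
  \sum_(i < size qs) size (nth [::] qs i) = size (flatten qs).
Proof. by rewrite size_flatten sumnE big_map (big_nth [::]) big_mkord. Qed.

Lemma run_read_input p (qs : seq (seq nat)) :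
  let s := p :: size qs :: flatten [seq size q :: q | q <- qs] in
  run read_input (store0 s) (8 * size (flatten qs) + 6 * size qs + 4) (fun st =>
    [/\ vr st vK = p, vr st vNQ = size qs, read_ok st (flatten qs),
        forall j, j < size qs -> ar st aLen j = size (nth [::] qs j)
      & forall a i, a \in [:: aArc; aQ; aOff; aV] -> ar st a i = 0]).
Proof.
move=> s; eapply run_le.
  rewrite /read_input; do 4 cstep.
  pose Inv j st := [/\ inp st = flatten [seq size q :: q | q <- drop j qs],
    read_ok st (flatten (take j qs))
    & forall i, i < j -> ar st aLen i = size (nth [::] qs i)].
  eapply (run_for (n := size qs) (b := fun j => 8 * size (nth [::] qs j) + 4) (Inv := Inv)) => //.
  - by split=> //=; rewrite ?drop0 ?take0.
  - move=> j s1 jq fr xj [I1 I2 I3]; eapply run_conseq.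
      apply: (run_read_queue _ I2 (q := nth [::] qs j)).
      by rewrite I1 (drop_nth [::]) //=.
    move=> s2 fr2 [J1 J2 J3 J4]; split=> //=.
      rewrite (take_nth [::]) // -cats1 flatten_cat /= cats0; case: J2 => *; split=> //.
    move=> i; rewrite ltnS leq_eqVlt => /orP[/eqP->|ij]; first by rewrite -xj J3 xj.
    by rewrite J4 ?I3 // xj ltn_eqF.
  - move=> s1 fr [_ I2 I3]; rewrite take_size in I2; split=> //.
    + by rewrite (fr_v fr).
    + by rewrite (fr_v fr).
    + by move=> a i; rewrite !inE => /or4P[] /eqP ->; rewrite (fr_a fr).
rewrite -sum_size_flatten big_split /= big_split /= !sum_nat_const card_ord -big_distrr /=.
by clear; lia.
Qed.

(** * Building the arcs from first and last occurrences *)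

Definition clear_marks : cmd :=
  For vU vM
    (Sto aFst (Var vU) (Var vLen) ;; Sto aLast (Var vU) (Cst 0))%cmd.

Definition mark_bin : cmd :=
  (vW ::= Arr aB (Var vPos) ;;
   Ite (Sub (Arr aFst (Var vW)) (Var vI)) (Sto aFst (Var vW) (Var vI)) Skip ;;
   Sto aLast (Var vW) (Var vI) ;;
   vPos ::= Add (Var vPos) (Cst 1))%cmd.

Definition add_arcs : cmd :=
  (vUm ::= Cst 0 ;;
   For vU vM
     (For vV vM
        (Ite (Sub (Arr aLast (Var vV)) (Arr aFst (Var vU)))
           (Ite (Add (Sub (Var vU) (Var vV)) (Sub (Var vV) (Var vU)))
              (Sto aArc (Add (Var vUm) (Var vV)) (Cst 1)) Skip)
           Skip) ;;
      vUm ::= Add (Var vUm) (Var vM)))%cmd.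

Definition queue_arcs : cmd :=
  (vLen ::= Arr aLen (Var vJ) ;;
   clear_marks ;;
   For vI vLen mark_bin ;;
   add_arcs)%cmd.

Definition build_arcs : cmd :=
  (vPos ::= Cst 0 ;; For vJ vNQ queue_arcs)%cmd.

Section Marks.
Variable m : nat.
Implicit Types u v : 'I_m.

Definition fst_ok (st : store) (l : nat) (p : seq nat) : Prop :=
  forall u, ar st aFst u = if (u : nat) \in p then index (u : nat) p else l.

(** Says that some occurrence lies behind position [f]. This form does not separate an absent pallet
    from one occurring only at position [0]: both are marked [0] and come behind nothing. *)
Definition last_ok (st : store) (p : seq nat) : Prop :=
  forall u f, (f < ar st aLast u) = ((u : nat) \in drop f.+1 p).

Lemma run_clear_marks st : vr st vM = m ->
  run clear_marks st (4 * m + 2) (fun st' => fst_ok st' (vr st vLen) [::] /\ last_ok st' [::]).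
Proof.
move=> Hm; pose Inv i st' := forall u, u < i ->
  ar st' aFst u = vr st vLen /\ ar st' aLast u = 0.
eapply run_le.
  eapply (run_forc (n := m) (Inv := Inv)) => //.
  - move=> i s1 im fr xi I; do 2 cstep; cstep => u /=; rewrite xi ltnS.
    rewrite (fr_v fr) //=; case: ltngtP => // ui _; exact: I.
  - move=> s1 _ I; split=> u; first by have [] := I u (ltn_ord u).
    by move=> f; have [_ ->] := I u (ltn_ord u).
by clear; lia.
Qed.

Lemma run_mark_bin st l p v : vr st vI = size p -> size p < l ->
  ar st aB (vr st vPos) = v -> fst_ok st l p -> last_ok st p ->
  run mark_bin st 5 (fun st' =>
    [/\ vr st' vPos = (vr st vPos).+1, fst_ok st' l (rcons p v)
      & last_ok st' (rcons p v)]).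
Proof.
move=> Hi pl HB F L; eapply run_le.
  have L' : last_ok (seta st aLast v (size p)) (rcons p v).
    move=> u f /=; rewrite -[(u : nat) == v]/(u == v).
    have [Ef|Ef] := ltnP (size p) f.+1.
      rewrite [drop _ _]drop_oversize ?size_rcons // in_nil.
      case: (eqVneq u v) => _; first by rewrite ltnNge -ltnS Ef.
      by rewrite L drop_oversize // ltnW.
    rewrite drop_rcons // mem_rcons inE -[(u : nat) == v]/(u == v) -L.
    by case: (eqVneq u v).
  have F' u : (if (u : nat) == v then (if size p < ar st aFst v then size p else ar st aFst v)
      else ar st aFst u) = if (u : nat) \in rcons p v then index (u : nat) (rcons p v) else l.
    rewrite mem_rcons inE -cats1 index_cat F F.
    case: (eqVneq (u : nat) v) => [->|N] /=; last by case: ifP.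
    case vp: ((v : nat) \in p); first by rewrite ltnNge index_size.
    by rewrite pl /= eqxx addn0.
  rewrite /mark_bin; do 2 cstep; rewrite HB; cstep.
  apply: (run_iteb (b := size p < ar st aFst v)).
  - by rewrite /= Hi -lt0n subn_gt0.
  - move=> H; cstep; do 2 cstep; cstep; split=> /=; first by rewrite addn1.
    + by move=> u /=; rewrite -F' H Hi; case: eqP.
    + by move=> u f; rewrite -L' /= Hi.
  - move=> /negPf H; cstep; do 2 cstep; cstep; split=> /=; first by rewrite addn1.
    + by move=> u /=; rewrite -F' H; case: eqP => // ->.
    + by move=> u f; rewrite -L' /= Hi.
by [].
Qed.

(** An absent [u] is marked with [size p], beyond every last occurrence, which agrees with
    [before]. *)
Lemma before_marks st p u v : fst_ok st (size p) p -> last_ok st p ->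
  (ar st aFst u < ar st aLast v) = before p u v.
Proof.
move=> F L; rewrite L /before F; case: ifP => // /negbT up.
by rewrite (memNindex up).
Qed.

Lemma run_add_arcs st p (e : rel 'I_m) : vr st vM = m ->
  fst_ok st (size p) p -> last_ok st p ->
  (forall u v, (ar st aArc (u * m + v) != 0) = e u v) ->
  run add_arcs st (6 * m ^ 2 + 8 * m + 8) (fun st' =>
    forall u v, (ar st' aArc (u * m + v) != 0) = e u v || (u != v) && before p u v).
Proof.
move=> Hm F L He; pose d u v := (u != v) && before p u v.
have cell u v u' v' : (u * m + v == u' * m + v') = (u == u') && (v == v').
  apply/eqP/andP => [E|[/eqP-> /eqP-> //]].
  have m0 : 0 < m by apply: leq_trans (ltn_ord v).
  have := congr1 (fun x => x %/ m) E; rewrite !divnMDl // !divn_small // !addn0 => Eu.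
  have {}Eu : u = u' by exact: val_inj.
  split; first exact/eqP.
  by move/eqP: E; rewrite Eu eqn_add2l => /eqP E; apply/eqP/val_inj.
eapply run_le.
  rewrite /add_arcs; do 2 cstep.
  pose Inv i st' := vr st' vUm = i * m /\
    forall u v, (ar st' aArc (u * m + v) != 0) = e u v || (u < i) && d u v.
  eapply (run_forc (n := m) (Inv := Inv)) => //.
  - by split=> //= u v; rewrite orbF.
  - move=> i s1 im fr ui [Eum H1]; pose x := Ordinal im.
    have Hm1 : vr s1 vM = m by rewrite (fr_v fr).
    cstep.
    pose Inv' j st' := forall u v, (ar st' aArc (u * m + v) != 0) =
      e u v || ((u < i) || (u == x) && (v < j)) && d u v.
    eapply (run_forc (n := m) (Inv := Inv')) => //.
    + by move=> u v /=; rewrite H1 andbF orbF.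
    + move=> j s2 jm fr2 vj H2; pose y := Ordinal jm.
      have E1 : (eval s2 (Sub (Arr aLast (Var vV)) (Arr aFst (Var vU))) != 0) = before p x y.
        rewrite /= vj (fr_v fr2) //= ui -lt0n subn_gt0.
        rewrite (fr_a fr2) //= (fr_a fr) //= (fr_a fr2) //= (fr_a fr) //=.
        exact: (before_marks x y F L).
      have E2 : (eval s2 (Add (Sub (Var vU) (Var vV)) (Sub (Var vV) (Var vU))) != 0) = (x != y).
        rewrite /= vj (fr_v fr2) //= ui -val_eqE /=; clear; lia.
      have yS v : (v < j.+1) = (v < j) || (v == y).
        by rewrite ltnS leq_eqVlt orbC.
      have skip : d x y = false -> Inv' j.+1 (setv s2 vV j.+1).
        move=> Hd u v; rewrite /= H2 yS.
        case: (eqVneq u x) => [->|_]; last by rewrite !orbF.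
        case: (eqVneq v y) => [->|_]; last by rewrite !orbF.
        by rewrite Hd !andbF.
      apply: (run_iteb E1) => Hb; last by cstep; apply: skip; rewrite /d (negPf Hb) andbF.
      apply: (run_iteb E2) => Hn; last by cstep; apply: skip; rewrite /d (negPf Hn).
      cstep; move=> u v; rewrite /= vj (fr_v fr2) //= Eum (cell u v x y) yS.
      case: (eqVneq u x) => [->|N] /=; last by rewrite H2 (negPf N).
      case: (eqVneq v y) => [->|_] /=; first by rewrite !orbT /d Hn Hb orbT.
      by have /= -> := H2 x v; rewrite eqxx /= !orbF.
    + move=> s2 fr2 H2; cstep; split=> /=.
        by rewrite !(fr_v fr2) //= Eum Hm1 mulSnr.
      move=> u v; have -> : (u < i.+1) = (u < i) || (u == x).
        by rewrite ltnS leq_eqVlt orbC.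
      by rewrite H2 ltn_ord andbT.
  - by move=> s1 _ [_ H] u v; rewrite H ltn_ord.
by clear; nia.
Qed.

End Marks.

Lemma before_map (T : seq nat) (q : seq nat) u t :
  uniq T -> {subset q <= T} -> u \in T -> t \in T ->
  before [seq index x T | x <- q] (index u T) (index t T) = before q u t.
Proof.
move=> UT qT uT tT.
have inj x y : x \in T -> y \in T -> (index x T == index y T) = (x == y).
  by move=> xT yT; apply/eqP/eqP => [E|-> //]; rewrite -(nth_index 0 xT) E nth_index.
have memE s x : {subset s <= T} -> x \in T ->
    (index x T \in [seq index y T | y <- s]) = (x \in s).
  move=> sT xT; apply/mapP/idP => [[y ys E]|xs]; last by exists x.
  suff -> : x = y by [].
  by apply/eqP; rewrite -inj // ?sT // E.
have idxE s : {subset s <= T} ->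
    index (index u T) [seq index y T | y <- s] = index u s.
  elim: s => //= x s IH sT; have xT : x \in T by apply: sT; exact: mem_head.
  rewrite inj // IH // => y ys.
  by apply: sT; rewrite inE ys orbT.
rewrite /before idxE // -map_drop memE // => x /mem_drop; exact: qT.
Qed.

Lemma run_build_arcs (qs : seq (seq nat)) st (T := firsts (flatten qs)) (m := size T) :
  vr st vNQ = size qs -> read_ok st (flatten qs) ->
  (forall j, j < size qs -> ar st aLen j = size (nth [::] qs j)) ->
  (forall i, ar st aArc i = 0) ->
  run build_arcs st
    (7 * size (flatten qs) + size qs * (6 * m ^ 2 + 12 * m + 20) + 4)
    (fun st' => forall u v : 'I_m, (ar st' aArc (u * m + v) != 0) =
       (u != v) && has (fun q => before q (nth 0 T u) (nth 0 T v)) qs).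
Proof.
move=> Hq R Hlen Harc; pose ids (q : seq nat) := [seq index x T | x <- q].
pose e j (u v : 'I_m) :=
  (u != v) && has (fun q => before q (nth 0 T u) (nth 0 T v)) (take j qs).
eapply run_le.
  rewrite /build_arcs; do 2 cstep.
  pose Inv j st' := vr st' vPos = size (flatten (take j qs)) /\
    forall u v : 'I_m, (ar st' aArc (u * m + v) != 0) = e j u v.
  eapply (run_for (n := size qs)
    (b := fun j => 7 * size (nth [::] qs j) + (6 * m ^ 2 + 12 * m + 16)) (Inv := Inv)) => //.
  - split=> /=; first by rewrite take0.
    by move=> u v; rewrite Harc /e take0 andbF.
  - move=> j s1 jq fr xj [Epos He].
    have Hm1 : vr s1 vM = m by rewrite (fr_v fr) //= (rd_m R).
    set q := nth [::] qs j.
    have qqs : q \in qs by exact: mem_nth.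
    have Eqs : flatten qs = flatten (take j qs) ++ q ++ flatten (drop j.+1 qs).
      by rewrite -{1}(cat_take_drop j qs) flatten_cat (drop_nth [::]).
    have El : ar s1 aLen j = size q by rewrite (fr_a fr) //= Hlen.
    have Esize : size (ids q) = size q by rewrite size_map.
    eapply run_le.
      rewrite /queue_arcs; do 2 cstep; rewrite xj El; cstep; eapply run_conseq.
        exact: (run_clear_marks (m := m)).
      move=> s2 fr2 [/= F2 L2].
      pose Inv' i st' := [/\ vr st' vPos = size (flatten (take j qs)) + i,
        fst_ok m st' (size q) (take i (ids q)) & last_ok m st' (take i (ids q))].
      cstep; eapply (run_forc (n := size q) (Inv := Inv')) => //.
      + by rewrite (fr_v fr2).
      + by split=> /=; rewrite ?take0 // (fr_v fr2) //= Epos addn0.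
      + move=> i s3 iq fr3 Ei [P3 F3 L3].
        have tT : nth 0 q i \in T.
          rewrite mem_firsts; apply/flattenP; exists q => //; exact: mem_nth.
        have im : index (nth 0 q i) T < m by rewrite index_mem.
        have Epi : size (flatten (take j qs)) + i < size (flatten qs).
          by rewrite Eqs !size_cat ltn_add2l (leq_trans iq) ?leq_addr.
        have Eb : ar s3 aB (vr s3 vPos) = Ordinal im.
          have En : nth 0 (flatten qs) (size (flatten (take j qs)) + i) = nth 0 q i.
            by rewrite Eqs nth_cat ltnNge leq_addr addKn /= nth_cat iq.
          by rewrite P3 (fr_a fr3) //= (fr_a fr2) //= (fr_a fr) //= (rd_b R) // En.
        have Ert : take i.+1 (ids q) = rcons (take i (ids q)) (Ordinal im).
          by rewrite (take_nth 0) ?Esize // (nth_map 0).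
        have Est : size (take i (ids q)) = i by rewrite size_takel // Esize ltnW.
        eapply run_conseq.
          apply: (run_mark_bin _ _ Eb F3 L3); by rewrite Est.
        move=> s4 _ [P4 F4 L4]; split=> /=; first by rewrite P4 P3 addnS.
          by rewrite Ert.
        by rewrite Ert.
      + move=> s3 fr3 [P3 F3 L3]; rewrite -Esize take_size in F3 L3.
        eapply run_conseq.
          apply: (run_add_arcs _ F3 L3 (e := e j)).
            by rewrite (fr_v fr3) // (fr_v fr2).
          by move=> u v; rewrite (fr_a fr3) //= (fr_a fr2) //=; exact: He.
        move=> s4 fr4 H4; split=> /=.
          rewrite (fr_v fr4) // P3 (take_nth [::]) // -cats1 flatten_cat size_cat /=.
          by rewrite cats0.
        move=> u v; rewrite H4 /e (take_nth [::]) // has_rcons -/q.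
        have uT (x : 'I_m) : nth 0 T x \in T by exact: mem_nth.
        have iT (x : 'I_m) : index (nth 0 T x) T = x by rewrite index_uniq // uniq_firsts.
        rewrite -(@before_map T q) ?uniq_firsts // ?iT; last first.
          by move=> x xq; rewrite mem_firsts; apply/flattenP; exists q.
        by rewrite -andb_orr orbC.
    by clear; nia.
  - by move=> s1 _ [_ H] u v; rewrite H /e take_size.
rewrite -sum_size_flatten 2!big_split /= !sum_nat_const card_ord -big_distrr /=.
by clear; nia.
Qed.

(** * The whole program and its running time *)

Definition report : cmd :=
  (vRes ::= Cst 1 ;;
   For vT vM (Ite (Arr aQ (Var vT)) Skip (vRes ::= Cst 0)))%cmd.

Lemma run_report m st (S : {set 'I_m}) : vr st vM = m -> row_ok st aQ 0 S ->
  run report st (4 * m + 3) (fun st' => vr st' vRes = (S == setT)).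
Proof.
move=> Hm HS; eapply run_le.
  rewrite /report; do 2 cstep.
  pose Inv i st' := vr st' vRes = [forall t : 'I_m, (t < i) ==> (t \in S)].
  eapply (run_forc (n := m) (Inv := Inv)) => //.
  - by rewrite /Inv /= (introT forallP) // => t.
  - move=> i s1 im fr xi H; pose t := Ordinal im.
    have E1 : (eval s1 (Arr aQ (Var vT)) != 0) = (t \in S).
      by rewrite /= xi (fr_a fr) //=; exact: (HS t).
    apply: (run_iteb E1) => Ht; cstep; rewrite /Inv /=.
      rewrite H; congr nat_of_bool; apply: eq_forallb => u; rewrite ltnS [in RHS]leq_eqVlt.
      by case: eqP => //= E; have -> : u = t; [exact: val_inj|rewrite Ht implybT].
    symmetry; apply/eqP; rewrite eqb0; apply/forallPn; exists t.
    by rewrite negb_imply /= ltnSn.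
  - move=> s1 _ ->; congr nat_of_bool; apply/forallP/eqP => [H|-> t]; last by rewrite inE implybT.
    by apply/setP=> t; have := H t; rewrite ltn_ord inE.
by clear; lia.
Qed.

Definition stackup : cmd :=
  (read_input ;; build_arcs ;;
   vK ::= Sub (Var vK) (Cst 1) ;;
   vG ::= Cst 0 ;;
   vRun ::= Cst 1 ;;
   search ;; report)%cmd.

Lemma stackup_wf : wfc stackup.
Proof. by vm_compute. Qed.

Lemma run_stackup (I : fifo_instance) : practical I ->
  run stackup (store0 (fifo_encode I))
    (4500 * (nbins I + npallets I ^ (places I + 2)))
    (fun st => exists b : bool, vr st 0 = b /\ (b <-> stackable I)).
Proof.
move=> pI; set qs := [seq map (@plt I) q | q <- queues I].
set T := firsts (flatten qs); set m := size T.
have Eflat : flatten qs = map (@plt I) (bins I) by rewrite /bins map_flatten.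
have Tm : T =i pallets I by move=> t; rewrite mem_firsts Eflat mem_undup.
have Em : m = npallets I.
  apply: perm_size; apply: uniq_perm; rewrite ?undup_uniq ?uniq_firsts //.
have En : size (flatten qs) = nbins I by rewrite Eflat size_map.
have Eq : size qs = nqueues I by rewrite size_map.
have Eenc : fifo_encode I = places I :: size qs :: flatten [seq size q :: q | q <- qs].
  rewrite /fifo_encode Eq -map_comp; congr [:: _, _ & flatten _].
  by apply: eq_map => q /=; rewrite size_map.
have Earc (u v : 'I_m) : (u != v) && has (fun q => before q (nth 0 T u) (nth 0 T v)) qs =
    pallet_arc I u v by rewrite /pallet_arc has_map.
have p0 := places_gt0 pI; have pm := places_lt pI; have qm := nqueues_lt pI.
rewrite -Em in pm qm; have m1 : 1 < m by apply: leq_ltn_trans pm.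
have irr : irreflexive (@pallet_arc I T) by move=> u; rewrite /pallet_arc eqxx.
rewrite Eenc -En -Em; eapply run_le.
  rewrite /stackup; cstep; eapply run_conseq; first exact: run_read_input.
  move=> s1 fr1 [K1 N1 R1 L1 Z1]; cstep; eapply run_conseq.
    by apply: (run_build_arcs N1 R1 L1) => i; rewrite Z1.
  move=> s2 fr2 A2.
  have M2 : vr s2 vM = m by rewrite (fr_v fr2) // (rd_m R1).
  have K2 : vr s2 vK = places I by rewrite (fr_v fr2).
  have Z2 a i : a \in [:: aQ; aOff; aV] -> ar s2 a i = 0.
    by rewrite !inE => /or3P[] /eqP ->; rewrite (fr_a fr2) // Z1.
  do 2 cstep; do 2 cstep; do 2 cstep; cstep; eapply run_conseq.
    (* The least value that [b_large] admits. The search then costs about [4010 * m ^ (p + 2)], and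
       the total of [4500] leaves room for reading, building the arcs and reporting. *)
    apply: (run_search (b := 401) irr _ _ (k := (places I).-1)) => //=.
    - exact: ltnW.
    - by split=> //= u v; rewrite A2 Earc.
    - by rewrite K2 subn1.
    - by move=> i; rewrite Z2.
    - by rewrite Z2.
    - by rewrite Z2.
  move=> s3 _ [M3 _ [S [RS HS]]]; eapply run_conseq; first exact: (run_report M3 RS).
  move=> s4 _ ->; exists (S == setT); split=> //.
  rewrite (stackable_reach pI (uniq_firsts _) Tm) -HS; split; first by move/eqP.
  by move->.
rewrite -/m; have -> : (places I).-1 + 3 = places I + 2 by lia.
have m3 : m ^ 3 <= m ^ (places I + 2) by rewrite leq_exp2l //; lia.
have [h1 h2] := pow_le m.
(* There are fewer sequences than pallets, so the graph costs [O(m ^ 3)], which [m3] bounds by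
   [m ^ (p + 2)] because [p] is positive. *)
have h3 : size qs * (6 * m ^ 2 + 12 * m + 20) <= 38 * m ^ 3.
  apply: leq_trans (_ : m * (38 * m ^ 2) <= _); last by rewrite mulnCA -expnS.
  apply: leq_mul; first by rewrite Eq ltnW.
  by move: h1 m1; clear; lia.
move: (size qs * _) h3 => X h3; rewrite -Eq in qm.
by move: (m ^ (places I + 2)) (size (flatten qs)) (m ^ 3) (m ^ 2) m3 h1 h2 h3 m1 qm;
  clear; lia.
Qed.

Lemma stackup_decides : exists (P : program) (C : nat),
  decides_within (L := fifo_stackup) P
    (fun I : fifo_instance => C * (nbins I + npallets I ^ (places I + 2))).
Proof.
exists (ccmd stackup 0), (size (ccmd stackup 0) * 4500) => I pI.
have [t [s [E Ht [b [Eb Hb]]]]] := run_stackup pI; exists b; split=> //.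
apply: (halts_within_leq (t := size (ccmd stackup 0) * t)).
  by rewrite -mulnA leq_mul2l Ht orbT.
rewrite -Eb; exact: compile_correct stackup_wf E.
Qed.

(** * Membership in XP *)

Lemma computable_const c : computable (fun=> c).
Proof. by exists [:: IConst 0 c] => x; exists 1. Qed.

Lemma computable_addn c : computable (addn^~ c).
Proof. by exists [:: IRead 0; IConst 1 c; IAdd 0 0 1] => x; exists 3. Qed.

Lemma leq_size_bitsize (L : problem) (I : instance L) : size (encode I) <= bitsize I.
Proof. by rewrite /bitsize -sum1_size; apply: leq_sum. Qed.

Lemma nbins_bitsize (I : fifo_instance) : nbins I + 2 <= bitsize (L := fifo_stackup) I.
Proof.
apply: leq_trans (leq_size_bitsize _); rewrite /= addn2 !ltnS /nbins /bins.
by elim: (queues I) => //= q s IH; rewrite !size_cat size_map; clear -IH; lia.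
Qed.

Lemma npallets_nbins (I : fifo_instance) : npallets I <= nbins I.
Proof. by apply: leq_trans (size_undup _) _; rewrite size_map. Qed.

(** Both summands are at most [N ^ (p + 2)] for the bit size [N]; since [N] is at least [2], one
    more factor [N] absorbs their sum. *)
Lemma stackup_time (I : fifo_instance) :
  nbins I + npallets I ^ (places I + 2) <=
  bitsize (L := fifo_stackup) I ^ (places I + 3).
Proof.
have := nbins_bitsize I; set N := bitsize _ => HN.
have N2 : 1 < N by apply: leq_trans HN; rewrite addn2.
have nN : nbins I <= N by apply: leq_trans HN; exact: leq_addr.
have h1 : N <= N ^ (places I + 2) by rewrite -{1}[N]expn1 leq_exp2l // addn2.
have h2 : npallets I ^ (places I + 2) <= N ^ (places I + 2).
  by rewrite leq_exp2r ?addn2 //; exact: leq_trans (npallets_nbins I) nN.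
have h3 : 2 * N ^ (places I + 2) <= N ^ (places I + 3) by rewrite [places I + 3]addnS expnS leq_mul2r N2 orbT.
by move: (N ^ _) (N ^ _) (npallets I ^ _) h1 h2 h3 nN; clear; lia.
Qed.

Theorem theorem11 :
  solvable_in_O (L := fifo_stackup)
    (fun I : fifo_instance => nbins I + npallets I ^ (places I + 2))
  /\ XP (L := fifo_stackup) places.
Proof.
split; first exact: stackup_decides.
have [P [C dP]] := stackup_decides.
exists (fun=> C), (addn^~ 3), P; split.
- exact: computable_const.
- exact: computable_addn.
move=> I pI; have [b [hb eb]] := dP I pI; exists b; split=> //.
by apply: halts_within_leq hb; rewrite leq_mul2l stackup_time orbT.
Qed.
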